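(* Let $n\ge2$, let $\Gamma$ be a torsion-free cocompact lattice in $\mathrm{SO}_0(1,n)$, and let $\rho:\Gamma\to\mathrm{SO}_0(2,n)$ be a faithful representation with discrete image preserving an acausal topological $(n-1)$-sphere $\Lambda_\rho\subset\mathrm{Ein}_n$, such that $\mathrm{Conv}(\Lambda_\rho)$ has non-empty interior. Fix $x_0\in\mathrm{Conv}(\Lambda_\rho)\setminus\Lambda_\rho$, let $D(\Gamma)\subset E(\Lambda_\rho)$ be the Dirichlet domain with base point $x_0$, and let $\mathrm{Cl}(D(\Gamma))$ be its closure in $E(\Lambda_\rho)$. Then $\bar D_{\mathrm{conv}}(\Gamma):=\mathrm{Cl}(D(\Gamma))\cap\mathrm{Conv}(\Lambda_\rho)$ is a compact fundamental domain for the action of $\rho(\Gamma)$ on $\mathrm{Conv}(\Lambda_\rho)\setminus\Lambda_\rho$; that is, it is compact, its translates $\rho(\gamma)\bar D_{\mathrm{conv}}(\Gamma)$, $\gamma\in\Gamma$, cover $\mathrm{Conv}(\Lambda_\rho)\setminus\Lambda_\rho$, and the sets $\rho(\gamma)(D(\Gamma)\cap\mathrm{Conv}(\Lambda_\rho))$, $\gamma\in\Gamma$, are pairwise disjoint.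
   Context: $\mathbb{R}^{2,n}$ is $\mathbb{R}^{n+2}$ with $q_{2,n}(u,v,x_1,\dots,x_n)=-u^2-v^2+x_1^2+\dots+x_n^2$ and bilinear form $\langle\cdot|\cdot\rangle$; $\mathrm{SO}_0(2,n)$ is the identity component of its isometry group; $\mathbb{S}(\mathbb{R}^{2,n})$ is the sphere of rays. $\mathrm{Ein}_n\subset\mathbb{S}(\mathbb{R}^{2,n})$ is the set of rays of nonzero isotropic vectors, identified with $\mathbb{S}^1\times\mathbb{S}^{n-1}$ by $(\theta,y)\mapsto$ ray of $(\cos\theta,\sin\theta,y)$. $\mathrm{AdS}_{n+1}=\{q_{2,n}=-1\}$, identified with its image $\{q_{2,n}<0\}$ in $\mathbb{S}(\mathbb{R}^{2,n})$. An acausal topological $(n-1)$-sphere $\Lambda\subset\mathrm{Ein}_n$ is the injective projection of the graph $\{(f(y),y)\}\subset\mathbb{R}\times\mathbb{S}^{n-1}$ of a function $f$ with $|f(y)-f(y')|<d(y,y')$ for $y\neq y'$ ($d$ the round distance). $E(\Lambda)=\{x\in\mathrm{AdS}_{n+1}:\langle x|y\rangle<0\ \forall y\in\Lambda\}$. $\mathrm{Conv}(\Lambda)\subset\mathbb{S}(\mathbb{R}^{2,n})$ is the set of rays of combinations $t_1x_1+\dots+t_kx_k$ with $t_i>0$, $\sum t_i=1$ and $x_i$ isotropic vectors whose rays are in $\Lambda$; one has $\mathrm{Conv}(\Lambda)\setminus\Lambda\subset E(\Lambda)$. Dirichlet domain: regarding $E(\Lambda_\rho)\subset\mathrm{AdS}_{n+1}\subset\mathbb{R}^{2,n}$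 as vectors of $q_{2,n}$-norm $-1$, for $\gamma\in\Gamma\setminus\{1\}$ put $D(\gamma)=\{x\in E(\Lambda_\rho):\langle x|x_0\rangle>\langle x|\rho(\gamma)x_0\rangle\}$, and $D(\Gamma)=\bigcap_{\gamma\in\Gamma\setminus\{1\}}D(\gamma)$. *)

(* Defs.v *)
From HB Require Import structures.
From mathcomp Require Import all_boot all_order all_algebra generic_quotient.
From mathcomp Require Import all_classical all_reals all_analysis.

Set Implicit Arguments.
Unset Strict Implicit.
Unset Printing Implicit Defensive.
Import Order.TTheory GRing.Theory Num.Theory.
Import numFieldNormedType.Exports.

Local Open Scope classical_set_scope.
Local Open Scope ring_scope.
Local Open Scope quotient_scope.

Section Fibres.
Variables (T : choiceType) (U : Type) (f : T -> U).

Definition same_image : rel T := fun x y => `[< f x = f y >].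

Lemma same_image_equiv : equiv_class_of same_image.
Proof.
split=> [x|x y|y x z]; first by apply/asboolP.
  by apply/asboolP/asboolP => ->.
by move=> /asboolP xy /asboolP yz; apply/asboolP; rewrite xy.
Qed.

Definition same_image_rel := EquivRelPack same_image_equiv.

End Fibres.

(* The quotient of T by the partition into fibres of f; with f sending a point
   to its orbit, this is the orbit space. *)
Definition fibre_space (T : topologicalType) (U : Type) (f : T -> U) :=
  quotient_topology {eq_quot (same_image_rel f)}.

Section Rays.
Variables (R : realType) (m : nat).
Implicit Type V : set 'cV[R]_m.

Definition open_ray (v : 'cV[R]_m) : set 'cV[R]_m :=
  [set t *: v | t in [set t : R | 0 < t]].

Definition nonzero_vectors : set 'cV[R]_m := [set v | v != 0].

Definition ray_sphere :=
  fibre_space (fun v : nonzero_vectors => open_ray (\val v)).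

Definition vectors_on (s : ray_sphere) : set 'cV[R]_m :=
  open_ray (\val (repr s)).

Definition cone (A : set ray_sphere) : set 'cV[R]_m :=
  [set v | exists2 s, A s & vectors_on s v].

(* The zero vector lies on no ray, so it contributes nothing here. *)
Definition rays V : set ray_sphere :=
  [set s | exists2 v, V v & vectors_on s v].

(* The image of A under the action of an invertible g on rays. *)
Definition ray_image (g : 'M[R]_m) (A : set ray_sphere) : set ray_sphere :=
  rays [set g *m v | v in cone A].

End Rays.

Arguments nonzero_vectors R m : clear implicits.

Section IsometryGroups.
Variables (R : realType) (p q : nat).

Definition bform (x y : 'cV[R]_(p + q)) : R :=
  - (\sum_(i < p) x (lshift q i) 0 * y (lshift q i) 0)
  + \sum_(j < q) x (rshift p j) 0 * y (rshift p j) 0.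

Definition isometries : set 'M[R]_(p + q) :=
  [set g | forall x y, bform (g *m x) (g *m y) = bform x y].

Definition SO0 : set 'M[R]_(p + q) := connected_component isometries 1%:M.

End IsometryGroups.

Arguments isometries R p q : clear implicits.
Arguments SO0 R p q : clear implicits.

Definition discrete_subset (R : realType) (m : nat) (A : set 'M[R]_m) :=
  A `<=` isolated A.

Definition torsion_free (R : realType) (m : nat) (Gamma : set 'M[R]_m) :=
  forall g k, Gamma g -> (0 < k)%N -> g ^+ k = 1%:M -> g = 1%:M.

Section Lattices.
Variables (R : realType) (p q : nat).
Implicit Type Gamma : set 'M[R]_(p + q).

Definition subgroup_of_SO0 Gamma :=
  [/\ Gamma `<=` SO0 R p q, Gamma 1%:M,
      (forall g h, Gamma g -> Gamma h -> Gamma (g *m h))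
    & (forall g, Gamma g -> Gamma (invmx g))].

Definition orbit_space Gamma :=
  fibre_space (fun g : SO0 R p q => [set h *m \val g | h in Gamma]).

(* A discrete subgroup with compact quotient automatically has finite
   covolume. *)
Definition cocompact_lattice Gamma :=
  [/\ subgroup_of_SO0 Gamma, discrete_subset Gamma
    & compact [set: orbit_space Gamma]].

End Lattices.

(* p and q cannot be recovered from p + q. *)
Arguments subgroup_of_SO0 {R} p q Gamma.
Arguments orbit_space {R} p q Gamma.
Arguments cocompact_lattice {R} p q Gamma.

Section AntiDeSitter.
Variables (R : realType) (n : nat).
Implicit Types (Lambda : set (ray_sphere R (2 + n))).

Definition Ein : set (ray_sphere R (2 + n)) :=
  rays [set v | bform v v = 0].

(* Subsets of AdS are kept as sets of vectors; [rays] realises the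
   identification of AdS with the open subset {q < 0} of the sphere of rays. *)
Definition AdS : set 'cV[R]_(2 + n) := [set x | bform x x = -1].

Definition unit_sphere : set 'cV[R]_n := [set y | (y^T *m y) 0 0 = 1].

Definition round_dist (y y' : 'cV[R]_n) : R := acos ((y^T *m y') 0 0).

(* (cos theta, sin theta, y) *)
Definition Ein_param (theta : R) (y : 'cV[R]_n) : 'cV[R]_(2 + n) :=
  col_mx (\col_(i < 2) if i == 0 then cos theta else sin theta) y.

(* The projection to Ein is injective on a graph because it keeps y. *)
Definition acausal_sphere Lambda :=
  Lambda `<=` Ein /\
  exists f : 'cV[R]_n -> R,
    (forall y y', unit_sphere y -> unit_sphere y' -> y <> y' ->
       `|f y - f y'| < round_dist y y') /\
    Lambda = rays [set Ein_param (f y) y | y in unit_sphere].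

Definition E Lambda : set 'cV[R]_(2 + n) :=
  [set x | AdS x /\ forall y, cone Lambda y -> bform x y < 0].

Definition Conv Lambda : set (ray_sphere R (2 + n)) :=
  rays [set v | exists (k : nat) (t : 'I_k -> R) (x : 'I_k -> 'cV[R]_(2 + n)),
    [/\ forall i, 0 < t i, \sum_(i < k) t i = 1,
        forall i, bform (x i) (x i) = 0 /\ cone Lambda (x i)
      & v = \sum_(i < k) t i *: x i]].

Section Dirichlet.
Variables (Gamma : set 'M[R]_(1 + n)) (rho : 'M[R]_(1 + n) -> 'M[R]_(2 + n)).
Variables (Lambda : set (ray_sphere R (2 + n))) (x0 : 'cV[R]_(2 + n)).

Definition half_domain (g : 'M[R]_(1 + n)) : set 'cV[R]_(2 + n) :=
  [set x | E Lambda x /\ bform x x0 > bform x (rho g *m x0)].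

Definition Dirichlet : set 'cV[R]_(2 + n) :=
  \bigcap_(g in Gamma `\ 1%:M) half_domain g.

Definition Dirichlet_closure : set 'cV[R]_(2 + n) :=
  closure Dirichlet `&` E Lambda.

Definition Dirichlet_conv : set (ray_sphere R (2 + n)) :=
  rays Dirichlet_closure `&` Conv Lambda.

End Dirichlet.

(* rho is only meaningful on Gamma; its values elsewhere are irrelevant. *)
Definition faithful_discrete_rep
    (Gamma : set 'M[R]_(1 + n)) (rho : 'M[R]_(1 + n) -> 'M[R]_(2 + n)) :=
  [/\ forall g, Gamma g -> SO0 R 2 n (rho g),
      forall g h, Gamma g -> Gamma h -> rho (g *m h) = rho g *m rho h,
      set_inj Gamma rho
    & discrete_subset (rho @` Gamma)].

End AntiDeSitter.

Arguments Ein R n : clear implicits.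
Arguments AdS R n : clear implicits.
Arguments unit_sphere R n : clear implicits.

(* Main.v *)
Require Import Defs.
From HB Require Import structures.
From mathcomp Require Import all_boot all_order all_fingroup all_algebra generic_quotient.
From mathcomp Require Import all_classical all_reals all_analysis.
From mathcomp Require Import ring lra.
Set Implicit Arguments.
Unset Strict Implicit.
Unset Printing Implicit Defensive.
Import Order.TTheory GRing.Theory Num.Theory.
Import numFieldNormedType.Exports.

(** Vectors of the cone over Conv(Lambda) pair nonpositively, and a vector x of E(Lambda)
    satisfies <x|z> <= -c|z| on this cone; since the cone has interior points, only
    finitely many orbit points rho(g)x0 satisfy <x|rho(g)x0> >= -M. Hence every x in
    Conv(Lambda) \ Lambda has a translate in the weak Dirichlet domain
    { <x|x0> >= <x|rho(g)x0> for all g }. If rho(g)x0 were causally related to x0 for some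
    g <> 1, then so would be all rho(g)^k x0, because rho(g) preserves the time
    orientation; these are infinitely many orbit points, as Gamma is torsion free. So
    <x0|rho(g)x0> < -1, and pushing a point of the weak domain slightly towards x0 moves it
    into D(Gamma): the weak domain is the closure of D(Gamma).

    If this domain were not compact in Conv(Lambda) \ Lambda, a null vector l in the cone
    over Lambda would satisfy <l|rho(g)x0> <= <l|x0> for all g. Averaging the points
    rho(g)x0 over the g that move the base point of hyperbolic space H^n close to a given
    point, and then keeping the last n coordinates of the normalised average, defines a
    continuous map from H^n to R^n, identified with H^n by (sqrt(1 + |y|^2), y). This map
    is coarsely injective, because -<x|y> is at most the cosh of the distance between the
    images of x and y, and it misses the points of R^n far away in the direction of l.
    But a coarsely injective continuous map from H^n to itself is onto, by Brouwer's
    theorem. This is where the cocompactness of Gamma in SO_0(1,n) enters: the orbit has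
    to fill a space of the dimension of a Cauchy hypersurface. *)

(** * Sperner's lemma for the Kuhn triangulation *)

(** The unit vectors of the convex cone that satisfy the weak Dirichlet inequalities form a compact
    set, because the cone is spanned by a compact set lying in an open half-space. Compactness in
    Conv(Lambda) \ Lambda can therefore fail only if this set contains a null vector, and acausality
    puts the nonzero null vectors of the cone over Lambda. So everything rests on excluding
    horoballs. Hyperbolic distances occur only through their cosh, with cosh (a + b) <= 2 cosh a
    cosh b as triangle inequality; coarse statements absorb the factor 2. AdS contains closed
    timelike curves, so the relation of being in the future is not transitive there. It is
    transitive on triples with negative products, which the convex cone supplies for orbit points. A
    coarse left inverse obtained by averaging a net may vanish on the sphere used in the argument
    with Brouwer's theorem; a generic small offset removes these zeros. Genericity is proved by
    counting boxes, the averages being Lipschitz. *)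

Lemma xor_free_involution (T : finType) (f : T -> T) (d : pred T) :
  involutive f -> (forall x, f x != x) -> (forall x, d (f x) = d x) ->
  \big[addb/false]_x d x = false.
Proof.
(* Ranks put one element of each two-point orbit of [f] in each half; [f] exchanges the halves, so
   their sums cancel mod 2. *)
move=> fK f_free df; rewrite (bigID (fun x => enum_rank x < enum_rank (f x))) /=.
rewrite [X in _ (+) X](reindex_inj (inv_inj fK)) /=.
rewrite [X in _ (+) X](eq_big (fun x => enum_rank x < enum_rank (f x)) d) ?addbb //.
move=> x; rewrite fK -leqNgt ltn_neqAle leq_eqVlt.
case: eqVneq => [e|//].
by move: (f_free x); rewrite -(enum_rank_inj (val_inj e)) eqxx.
Qed.

(** Sperner's door count in one simplex: a door is a facet carrying all labels but [ord_max], and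
    [k] stands for the facet opposite to vertex [k]. A bijective labelling has one door. Otherwise a
    door [k0] forces the label of [k0] to recur at exactly one other vertex [k1], whose opposite
    facet is the only other door. *)
Lemma xor_faces n (a : 'I_n.+1 -> 'I_n.+1) :
  \big[addb/false]_k
     [forall c, (c != ord_max) ==> [exists j, (j != k) && (a j == c)]] =
  [forall c, exists k, a k == c].
Proof.
pose g k := [forall c, (c != ord_max) ==> [exists j, (j != k) && (a j == c)]].
rewrite -/(\big[addb/false]_k g k).
case: (boolP [forall c, _]) => [/forallP a_surj|not_full].
  have a_inj : injective a.
    apply: in2T; apply/image_injP; rewrite eqn_leq leq_image_card /=.
    by apply: subset_leq_card; apply/fintype.subsetP => c _;
       have /existsP[k /eqP <-] := a_surj c; apply: fintype.image_f.
  have /existsP[k0 /eqP k0_max] := a_surj ord_max.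
  rewrite (bigD1 k0) //= big1 ?addbF => [|k kk0].
    apply/forallP => c; apply/implyP => c_max.
    have /existsP[j /eqP jc] := a_surj c; apply/existsP; exists j.
    by rewrite jc eqxx andbT; apply: contraNneq c_max => e; rewrite -jc e k0_max.
  apply/negbTE/forallPn; exists (a k); rewrite negb_imply -k0_max.
  rewrite (inj_eq a_inj) kk0 /=; apply/existsPn => j.
  by rewrite (inj_eq a_inj) andNb.
case: (boolP [exists k, g k]) => [/existsP[k0 gk0]|/existsPn no_g]; last first.
  by rewrite big1 // => k _; apply/negbTE/no_g.
pose A := [set~ k0].
have cA : #|A| = n by have := cardsC1 k0; rewrite card_ord.
have max_im : [set~ ord_max] \subset a @: A.
  apply/fintype.subsetP => c; rewrite !inE => c_max.
  have /existsP[j /andP[jk /eqP <-]] := implyP (forallP gk0 c) c_max.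
  by apply: imset_f; rewrite !inE.
have imA : a @: A = [set~ ord_max].
  apply/eqP; rewrite eq_sym eqEcard max_im cardsC1 card_ord.
  by rewrite -[X in _ <= X]cA leq_imset_card.
have a_inj : {in A &, injective a}.
  by apply/imset_injP; rewrite imA cA cardsC1 card_ord.
have k0_nmax : a k0 != ord_max.
  apply: contra not_full => /eqP k0_max; apply/forallP => c.
  have [->|c_max] := eqVneq c ord_max; first by apply/existsP; exists k0; apply/eqP.
  have : c \in a @: A by rewrite imA !inE.
  by case/imsetP => j _ ->; apply/existsP; exists j.
have /imsetP[k1] : a k0 \in a @: A by rewrite imA !inE.
rewrite !inE => k10 ak01.
rewrite (bigD1 k0) //= (bigD1 k1) //= big1 => [|k /andP[kk0 kk1]].
  rewrite gk0; suff -> : g k1 by [].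
  apply/forallP => c; apply/implyP => /(implyP (forallP gk0 c)).
  case/existsP => j /andP[jk0 jc]; apply/existsP.
  have [jk1|jk1] := eqVneq j k1; last by exists j; rewrite jk1.
  by exists k0; rewrite eq_sym k10 ak01 -jk1.
apply/negbTE/forallPn; exists (a k); rewrite negb_imply.
have -> /= : a k != ord_max.
  have : a k \in a @: A by apply: imset_f; rewrite !inE.
  by rewrite imA !inE.
apply/existsPn => j; apply/negP => /andP[jk /eqP jak].
have [jk0|jk0] := eqVneq j k0.
  by move: kk1; rewrite (a_inj k k1) ?eqxx ?inE // -jak jk0.
by move: jk; rewrite (a_inj j k) ?eqxx ?inE.
Qed.

Section Kuhn.
Variables n' N' : nat.
Local Notation n := n'.+1.
Local Notation N := N'.+1.
Local Notation cell := ({ffun 'I_n -> 'I_N} * 'S_n)%type.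

(* The cube v + [0,1]^n is cut into the simplices on which the coordinates are
   ordered as prescribed by s; k indexes the n + 1 vertices of such a simplex. *)
Definition kuhn_vertex (c : cell) (k : nat) : 'I_n -> nat :=
  fun i => c.1 i + (c.2 i < k).

Definition fully_labelled (l : ('I_n -> nat) -> 'I_n.+1) (c : cell) :=
  [forall a, exists k : 'I_n.+1, l (kuhn_vertex c k) == a].

Definition face_labelled (l : ('I_n -> nat) -> 'I_n.+1) (F : cell * 'I_n.+1) :=
  [forall a, (a != ord_max) ==>
     [exists j, (j != F.2) && (l (kuhn_vertex F.1 j) == a)]].

Definition cycle_perm : 'S_n := perm (can_inj (@ordSK n)).

(* Face k of a simplex is opposite to its k-th vertex; crossing it leads to the
   neighbouring simplex, the grid being wrapped around at the boundary. *)
Definition cross (F : cell * 'I_n.+1) : cell * 'I_n.+1 :=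
  let: ((v, s), k) := F in
  if k == 0 :> nat then
    (([ffun i => if s i == 0 :> nat then ordS (v i) else v i],
      (s * cycle_perm^-1)%g), ord_max)
  else if k == n :> nat then
    (([ffun i => if s i == n' :> nat then ord_pred (v i) else v i],
      (s * cycle_perm)%g), ord0)
  else ((v, (s * tperm (inord k.-1) (inord k))%g), k).

Lemma cycle_permE i : cycle_perm i = ordS i.
Proof. by rewrite permE. Qed.

Lemma cycle_permVE i : (cycle_perm^-1)%g i = ord_pred i.
Proof. by apply: (@perm_inj _ cycle_perm); rewrite permKV cycle_permE ord_predK. Qed.

Lemma val_ordS m (i : 'I_m.+1) : ordS i = (if i == m :> nat then 0 else i.+1) :> nat.
Proof.
rewrite /=; case: eqP => [->|/eqP ne]; first by rewrite modnn.
by rewrite modn_small // ltnS ltn_neqAle ne -ltnS ltn_ord.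
Qed.

Lemma val_ord_pred m (i : 'I_m.+1) :
  ord_pred i = (if i == 0 :> nat then m else i.-1) :> nat.
Proof.
case: i => [] [|i] im /=; first by rewrite modn_small.
by rewrite modnDr modn_small // ltnW.
Qed.

Lemma crossK : involutive cross.
Proof.
move=> [[v s] k]; rewrite /cross.
case: (eqVneq (k : nat) 0) => [k0|k0].
  rewrite /= eqxx; congr (_, _, _).
  - apply/ffunP => i; rewrite !ffunE permM cycle_permVE val_ord_pred.
    case: (eqVneq (s i : nat) 0) => [_|si0]; rewrite ?eqxx ?ordSK //.
    case: ifP => // /eqP e; move: (ltn_ord (s i)).
    by rewrite -(prednK (n := s i)) ?lt0n // e ltnn.
  - by rewrite -mulgA mulVg mulg1.
  - by apply/val_inj.
case: (eqVneq (k : nat) n) => [kn|kn] /=.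
  congr (_, _, _).
  - apply/ffunP => i; rewrite !ffunE permM cycle_permE val_ordS.
    by case: (eqVneq (s i : nat) n') => [_|sin]; rewrite ?eqxx ?ord_predK.
  - by rewrite -mulgA mulgV mulg1.
  - by apply/val_inj.
by rewrite (negbTE k0) (negbTE kn) -mulgA tperm2 mulg1.
Qed.

Lemma cross_free F : cross F != F.
Proof.
case: F => [[v s] k]; rewrite /cross.
case: (eqVneq (k : nat) 0) => [k0|k0].
  by apply/negP => /eqP /(congr1 snd) /= kE; move: k0; rewrite -kE.
case: (eqVneq (k : nat) n) => [kn|kn].
  by apply/negP => /eqP /(congr1 snd) /= kE; move: kn; rewrite -kE.
have kln : k < n by rewrite ltn_neqAle kn -ltnS ltn_ord.
apply/negP => /eqP /(congr1 (fun F => s^-1 * F.1.2)%g) /=.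
rewrite mulKg mulVg => /permP /(_ (inord k)).
rewrite tpermR perm1 => /(congr1 val) /=.
rewrite !inordK //; last by rewrite (leq_ltn_trans (leq_pred _)).
by apply/eqP; rewrite -eqSS prednK ?lt0n // neq_ltn ltnSn.
Qed.

Definition on_boundary (w : 'I_n -> nat) := exists i, w i = 0 \/ w i = N.

(** The vertex chain raises coordinate [i] at step [s i]. Around an omitted inner vertex, two
    consecutive steps are swapped; when an end vertex is omitted, its step moves to the other end of
    the chain and the cell is shifted. Only this shift can leave the grid, and then the whole facet
    lies on one side of the cube. *)
Lemma cross_face (v : {ffun 'I_n -> 'I_N}) (s : 'S_n) (k : 'I_n.+1) :
  let F := ((v, s), k) in
  (forall j : 'I_n.+1, j != k -> on_boundary (kuhn_vertex F.1 j)) \/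
  (forall l, face_labelled l (cross F) = face_labelled l F).
Proof.
rewrite /cross; case: eqVneq => [k0|k0].
  pose i0 := (s^-1)%g ord0.
  have si0 : s i0 = ord0 by rewrite permKV.
  case: (eqVneq (v i0 : nat) N') => [viN|viN].
    left => j jk; exists i0; right; rewrite /kuhn_vertex /= viN si0 /=.
    have -> : 0 < j; last exact: addn1.
    by rewrite lt0n; apply: contraNneq jk => j0; apply/eqP/val_inj; rewrite /= j0.
  right => l; rewrite /face_labelled; apply: eq_forallb => a; congr (_ ==> _).
  have E (j : 'I_n.+1) : j != ord_max ->
    kuhn_vertex ([ffun i => if s i == 0 :> nat then ordS (v i) else v i],
      (s * cycle_perm^-1)%g) j = kuhn_vertex (v, s) j.+1.
    move=> jm; apply: boolp.funext => i; rewrite /kuhn_vertex /= ffunE permM.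
    rewrite cycle_permVE val_ord_pred.
    have jn : j <= n' by rewrite -ltnS ltn_neqAle -ltnS ltn_ord andbT; apply: contraNneq jm => e; apply/eqP/val_inj.
    case: eqVneq => [si|si].
      rewrite val_ordS.
      have -> : i = i0 by apply: (@perm_inj _ s); rewrite si0; apply/val_inj.
      by rewrite si0 (negbTE viN) (ltnNge n') jn /= addn0 addn1.
    by rewrite -(prednK (n := s i)) ?lt0n // ltnS prednK ?lt0n.
  apply/existsP/existsP => -[j /andP[/= jk]].
    rewrite (E _ jk) => lj.
    have jn : j.+1 < n.+1 by rewrite ltnS ltn_neqAle -ltnS ltn_ord andbT; apply: contraNneq jk => e; apply/eqP/val_inj.
    exists (Ordinal jn); rewrite lj andbT; apply/eqP => e.
    by move: k0; rewrite -e.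
  have j0 : 0 < j by rewrite lt0n; apply: contraNneq jk => e; apply/eqP/val_inj; rewrite /= e.
  have jn : j.-1 < n.+1 by rewrite (leq_ltn_trans (leq_pred _)).
  move=> lj; exists (Ordinal jn).
  have jm : Ordinal jn != ord_max.
    by apply/eqP => /(congr1 val) /= e; move: (ltn_ord j); rewrite -(prednK j0) e ltnn.
  by rewrite jm E //= prednK.
case: eqVneq => [kn|kn].
  pose i0 := (s^-1)%g ord_max.
  have si0 : s i0 = ord_max by rewrite permKV.
  have jlt (j : 'I_n.+1) : j != k -> j < n.
    by move=> jk; rewrite ltn_neqAle -ltnS ltn_ord andbT; apply: contraNneq jk => e; apply/eqP/val_inj; rewrite /= kn.
  case: (eqVneq (v i0 : nat) 0) => [vi0|vi0].
    left => j jk; exists i0; left; rewrite /kuhn_vertex /= vi0 si0 /= add0n.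
    by rewrite ltnNge -ltnS jlt.
  right => l; rewrite /face_labelled; apply: eq_forallb => a; congr (_ ==> _).
  have E (j : nat) : j < n ->
    kuhn_vertex ([ffun i => if s i == n' :> nat then ord_pred (v i) else v i],
      (s * cycle_perm)%g) j.+1 = kuhn_vertex (v, s) j.
    move=> jn; apply: boolp.funext => i; rewrite /kuhn_vertex /= ffunE permM.
    rewrite cycle_permE val_ordS.
    case: eqVneq => [si|si] //.
    rewrite val_ord_pred.
    have -> : i = i0 by apply: (@perm_inj _ s); rewrite si0; apply/val_inj.
    by rewrite (negbTE vi0) si0 /= ltnNge -ltnS jn addn0 addn1 prednK ?lt0n.
  apply/existsP/existsP => -[j /andP[/= jk]].
    have j0 : 0 < j by rewrite lt0n; apply: contraNneq jk => e; apply/eqP/val_inj; rewrite /= e.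
    have jn : j.-1 < n by rewrite prednK // -ltnS ltn_ord.
    rewrite -{1}(prednK j0) E // => lj.
    exists (Ordinal (leqW jn)); rewrite lj andbT; apply/eqP => e.
    by move: kn (jn); rewrite -e /= => ->; rewrite ltnn.
  move=> lj; have jn := jlt _ jk.
  by exists (Ordinal (jn : j.+1 < n.+1)) => /=; rewrite E.
right => l; rewrite /face_labelled; apply: eq_forallb => a; congr (_ ==> _).
apply: eq_existsb => j /=; case: (eqVneq j k) => //= jk.
have kln : k < n by rewrite ltn_neqAle kn -ltnS ltn_ord.
have k1n : k.-1 < n by rewrite (leq_ltn_trans (leq_pred _)).
congr (l _ == _); apply: boolp.funext => i; rewrite /kuhn_vertex /=; congr (_ + _).
have K : (k.-1 < j) = (k < j).
  by rewrite -[LHS]ltnS prednK ?lt0n // ltnS leq_eqVlt val_eqE eq_sym (negbTE jk).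
by rewrite permM; case: tpermP => [->|->|] //; rewrite !inordK // K.
Qed.

Lemma xor_fully_labelled l :
  \big[addb/false]_c fully_labelled l c = \big[addb/false]_F face_labelled l F.
Proof.
rewrite -(pair_bigA _ (fun c k => face_labelled l (c, k))) /=.
apply: eq_bigr => c _.
exact: (esym (xor_faces (fun k => l (kuhn_vertex c k)))).
Qed.

(** Comparing two labellings with the same boundary values avoids counting doors on the boundary,
    and with it the usual induction on the dimension: a boundary facet contributes equally to both,
    and any other facet is counted from both sides. *)
Lemma fully_labelled_parity l l' :
  (forall w, on_boundary w -> l w = l' w) ->
  \big[addb/false]_c fully_labelled l c = \big[addb/false]_c fully_labelled l' c.
Proof.
move=> ll'; rewrite !xor_fully_labelled; set x := LHS; set y := RHS.
suff : x (+) y = false by case: x; case: y.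
rewrite -big_split /=; apply: (xor_free_involution crossK cross_free) => F.
have bd G : (forall j : 'I_n.+1, j != G.2 -> on_boundary (kuhn_vertex G.1 j)) ->
    face_labelled l G (+) face_labelled l' G = false.
  move=> Gb; suff -> : face_labelled l G = face_labelled l' G by rewrite addbb.
  apply: eq_forallb => a; congr (_ ==> _); apply: eq_existsb => j.
  by case: (eqVneq j G.2) => //= jG; rewrite ll' //; apply: Gb.
have [Fb|Fe] : (forall j : 'I_n.+1, j != F.2 -> on_boundary (kuhn_vertex F.1 j)) \/
  (forall l, face_labelled l (cross F) = face_labelled l F).
- by case: F => [[v s] k]; exact: cross_face.
- have [Gb|e] : (forall j : 'I_n.+1, j != (cross F).2 -> on_boundary (kuhn_vertex (cross F).1 j)) \/
    (forall l, face_labelled l (cross (cross F)) = face_labelled l (cross F)).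
  + by case: (cross F) => [[v s] k]; exact: cross_face.
  + by rewrite !bd.
  + by have := e l; have := e l'; rewrite crossK => -> ->.
- by rewrite !Fe.
Qed.

(* The value n means that b is nowhere true. *)
Definition first_true (b : 'I_n -> bool) : 'I_n.+1 := inord (find b (enum 'I_n)).

Lemma first_trueP (b : 'I_n -> bool) (i : 'I_n) :
  (i < first_true b -> ~~ b i) /\ (i = first_true b :> nat -> b i).
Proof.
have sz : find b (enum 'I_n) <= n by rewrite -[X in _ <= X](size_enum_ord n) find_size.
rewrite /first_true inordK ?ltnS //; split=> [ilt|ie].
  by have := before_find ord0 ilt; rewrite nth_ord_enum => ->.
have : has b (enum 'I_n) by rewrite has_find -ie size_enum_ord ltn_ord.
by move=> /(nth_find ord0); rewrite -ie nth_ord_enum.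
Qed.

(** Coordinates only grow along the vertices of a simplex, so this label is monotone there; being
    onto, it equals [k] at vertex [k]. Hence coordinate [i] passes from at most [c] to above [c]
    exactly at step [i], which determines the simplex. *)
Lemma fully_labelled_std (c : nat) : c < N ->
  \big[addb/false]_x fully_labelled (fun w => first_true (fun i => w i <= c)) x.
Proof.
move=> cN.
pose x0 : cell := ([ffun=> Ordinal cN], 1%g).
have lab (x : cell) : fully_labelled (fun w => first_true (fun i => w i <= c)) x -> x = x0.
  move=> /forallP fx.
  pose l k := first_true (fun i => kuhn_vertex x k i <= c).
  have lmono (k k' : nat) : k <= k' -> l k <= l k'.
    move=> kk'; rewrite leqNgt; apply/negP => llt.
    have ln : l k' < n by rewrite (leq_trans llt) // -ltnS ltn_ord.
    have [nb _] := first_trueP (fun i => kuhn_vertex x k i <= c) (Ordinal ln).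
    have [_ bb] := first_trueP (fun i => kuhn_vertex x k' i <= c) (Ordinal ln).
    move/negP: (nb llt); apply; apply: leq_trans (bb erefl).
    rewrite /kuhn_vertex leq_add2l.
    by case: (x.2 _ < k) / boolP => // sk; rewrite (leq_trans sk kk').
  have lE (k : 'I_n.+1) : l k = k.
    have l_inj : injective (fun k : 'I_n.+1 => l k).
      apply: in2T; apply/image_injP; rewrite eqn_leq leq_image_card /=.
      apply: subset_leq_card; apply/fintype.subsetP => a _.
      by have /existsP[k' /eqP <-] := fx a; apply: (fintype.image_f (fun k : 'I_n.+1 => l k)).
    have ge (j : nat) : j < n.+1 -> j <= l j.
      elim: j => // j IH jn; apply: (leq_ltn_trans (IH (ltnW jn))).
      rewrite ltn_neqAle lmono // andbT; apply/eqP => e.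
      have := l_inj (Ordinal (ltnW jn)) (Ordinal jn) (val_inj e).
      by move=> /(congr1 val) /= /n_Sn.
    have le (j : nat) : j < n.+1 -> l (n - j) <= n - j.
      elim: j => [_|j IH jn]; first by rewrite subn0 -ltnS.
      have h : n - j = (n - j.+1).+1 by rewrite subnSK.
      have h1 : n - j < n.+1 by rewrite ltnS leq_subr.
      have h2 : n - j.+1 < n.+1 by rewrite ltnS leq_subr.
      rewrite -ltnS -h; apply: leq_trans (IH (ltnW jn)).
      rewrite ltn_neqAle lmono ?h // andbT; apply/eqP => e.
      have e' : l (n - j.+1) = l (n - j) by apply/val_inj; rewrite /= e -?h.
      have /(congr1 val) /= := l_inj (Ordinal h2) (Ordinal h1) e'.
      by rewrite h => /n_Sn.
    apply/val_inj/eqP; rewrite eqn_leq; apply/andP; split; last exact: (ge k (ltn_ord k)).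
    have := le (n - k); rewrite subKn; last by rewrite -ltnS.
    by apply; rewrite ltnS leq_subr.
  have vlt (i : 'I_n) (k : nat) : k < n.+1 -> i < k -> c < kuhn_vertex x k i.
    move=> kn ik; rewrite ltnNge.
    have [nb _] := first_trueP (fun i => kuhn_vertex x k i <= c) i.
    by apply: nb; have := lE (Ordinal kn); rewrite /l => ->.
  have vle (i : 'I_n) : kuhn_vertex x i i <= c.
    have [_ bb] := first_trueP (fun j => kuhn_vertex x i j <= c) i.
    apply: bb; have i1 : i < n.+1 by exact: leqW.
    by have := lE (Ordinal i1); rewrite /l => ->.
  have vS (i : 'I_n) : c < kuhn_vertex x i.+1 i by exact: (vlt i i.+1 (ltn_ord i) (ltnSn i)).
  have si (i : 'I_n) : x.2 i = i /\ x.1 i = c :> nat.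
    move: (vle i) (vS i); rewrite /kuhn_vertex (ltnS (x.2 i)).
    case: (ltngtP (x.2 i) i) => [lt|gt|e] h1.
    - by rewrite ltnNge h1.
    - by rewrite ltnNge h1.
    rewrite /= addn1 ltnS addn0 in h1 * => h2.
    by split; [exact/val_inj|apply/eqP; rewrite eqn_leq h1 h2].
  rewrite [x]surjective_pairing; congr (_, _).
    by apply/ffunP => i; rewrite ffunE; apply/val_inj; case: (si i).
  by apply/permP => i; rewrite perm1; case: (si i).
rewrite (bigD1 x0) //= big1 => [|x /eqP xx0]; last by apply/negbTE/negP => /lab.
rewrite addbF; apply/forallP => a; apply/existsP; exists a.
rewrite -val_eqE /= eqn_leq; apply/andP; split; rewrite leqNgt; apply/negP => h.
  have an : a < n by rewrite (leq_trans h) // -ltnS ltn_ord.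
  have [nb _] := first_trueP (fun i => kuhn_vertex x0 a i <= c) (Ordinal an).
  move/negP: (nb h); apply.
  by rewrite /kuhn_vertex /= ffunE perm1 /= ltnn addn0.
set f := first_true _ in h.
have fn : f < n by rewrite (leq_trans h) // -ltnS ltn_ord.
have [_ bb] := first_trueP (fun i => kuhn_vertex x0 a i <= c) (Ordinal fn).
have := bb erefl; rewrite /kuhn_vertex /= ffunE perm1 /= -/f h addn1.
by rewrite ltnn.
Qed.

Lemma kuhn_sperner (c : nat) (l : ('I_n -> nat) -> 'I_n.+1) : c < N ->
  (forall w, on_boundary w -> l w = first_true (fun i => w i <= c)) ->
  exists x, fully_labelled l x.
Proof.
move=> cN lb; apply/existsP; apply: contraT => /existsPn nox.
have := fully_labelled_std cN.
rewrite -(fully_labelled_parity lb) big1 // => x _; exact/negbTE/nox.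
Qed.

End Kuhn.

Local Open Scope classical_set_scope.
Local Open Scope ring_scope.

(** * Brouwer's theorem *)

Section MatrixTopology.
Variable R : realType.

Lemma coord_le_norm m n (x : 'M[R]_(m, n)) i j : `|x i j| <= `|x|.
Proof.
rewrite [leRHS]/Num.norm /= mx_normrE; apply: (le_bigmax_cond _ (fun ij => `|x ij.1 ij.2|) (j := (i, j))) => //.
Qed.

Lemma norm_le_coord m n (x : 'M[R]_(m, n)) M :
  0 <= M -> (forall i j, `|x i j| <= M) -> `|x| <= M.
Proof.
move=> M0 xM; rewrite /Num.norm /= mx_normrE.
by apply/bigmax_leP; split => // ij _; exact: xM.
Qed.

Lemma mx_cvg (T : Type) (F : set_system T) (FF : Filter F) m n
    (f : T -> 'M[R]_(m, n)) (l : 'M[R]_(m, n)) :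
  (forall i j, f x i j @[x --> F] --> l i j) -> f @ F --> l.
Proof.
move=> fl A [P lP PA].
suff : \forall x \near F, forall i j, P i j (f x i j).
  by apply: filterS => x Px; apply: PA.
have : \forall x \near F, forall ij : 'I_m * 'I_n, P ij.1 ij.2 (f x ij.1 ij.2).
  by apply: filter_forall => -[i j] /=; apply: fl; apply: lP.
by apply: filterS => x Px i j; exact: (Px (i, j)).
Qed.

Lemma mx_continuous (T : topologicalType) m n (f : T -> 'M[R]_(m, n)) :
  (forall i j, continuous (fun x => f x i j)) -> continuous f.
Proof. by move=> fc x; apply: mx_cvg => i j; exact: fc. Qed.

Lemma compact_ball_cV n (r : R) : compact [set x : 'cV[R]_n | `|x| <= r].
Proof.
have -> : [set x : 'cV[R]_n | `|x| <= r] = trmx @` [set x : 'rV[R]_n | `|x| <= r].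
  apply/seteqP; split=> [x /= xr|_ [x /= xr <-]].
    exists x^T; last exact: trmxK.
    apply: norm_le_coord => [|i j]; first exact: le_trans xr.
    by rewrite mxE; apply: le_trans xr; exact: coord_le_norm.
  apply: norm_le_coord => [|i j]; first exact: le_trans xr.
  by rewrite mxE; apply: le_trans xr; exact: coord_le_norm.
apply: continuous_compact.
  apply: continuous_subspaceT; apply: mx_continuous => i j.
  have -> : (fun x : 'rV[R]_n => x^T i j) = fun x => x j i.
    by apply/funext => x; rewrite mxE.
  exact: coord_continuous.
apply: bounded_closed_compact.
  by exists r; split=> [|M rM x]; [exact: num_real|]; move=> /= xr; apply: le_trans (ltW rM).
apply: (@preimage_closed _ _ (fun x : 'rV[R]_n => `|x|) [set x | x <= r]).
  by move=> x _; exact: norm_continuous.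
exact: closed_le.
Qed.

Lemma compact_cV n (A : set 'cV[R]_n) (r : R) :
  closed A -> (forall x, A x -> `|x| <= r) -> compact A.
Proof.
by move=> Acl Ar; apply: subclosed_compact Acl (@compact_ball_cV n r) _.
Qed.

End MatrixTopology.

Lemma continuous_sub (R : realType) (V : normedModType R) (T : topologicalType) (f g : T -> V) :
  continuous f -> continuous g -> continuous (fun t => f t - g t).
Proof. by move=> fc gc t; apply: cvgB; [exact: fc|exact: gc]. Qed.

Lemma continuous_add (R : realType) (V : normedModType R) (T : topologicalType) (f g : T -> V) :
  continuous f -> continuous g -> continuous (fun t => f t + g t).
Proof. by move=> fc gc t; apply: cvgD; [exact: fc|exact: gc]. Qed.

Lemma continuous_scale (R : realType) (V : normedModType R) (T : topologicalType)
    (a : T -> R) (f : T -> V) :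
  continuous a -> continuous f -> continuous (fun t => a t *: f t).
Proof. by move=> ac fc t; apply: cvgZ; [exact: ac|exact: fc]. Qed.

Lemma continuous_maxR (R : realType) (T : topologicalType) (f g : T -> R) :
  continuous f -> continuous g -> continuous (fun t => Num.max (f t) (g t)).
Proof. by move=> fc gc t; apply: (@continuous_max _ _ f g); [exact: fc|exact: gc]. Qed.

Lemma continuous_minR (R : realType) (T : topologicalType) (f g : T -> R) :
  continuous f -> continuous g -> continuous (fun t => Num.min (f t) (g t)).
Proof. by move=> fc gc t; apply: (@continuous_min _ _ f g); [exact: fc|exact: gc]. Qed.

Lemma continuous_mul (R : realType) (T : topologicalType) (f g : T -> R) :
  continuous f -> continuous g -> continuous (fun t => f t * g t).
Proof. by move=> fc gc t; apply: cvgM; [exact: fc|exact: gc]. Qed.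

Lemma continuous_inv (R : realType) (T : topologicalType) (f : T -> R) :
  (forall t, f t != 0) -> continuous f -> continuous (fun t => (f t)^-1).
Proof. by move=> f0 fc t; apply: cvgV => //; exact: fc. Qed.

Lemma continuous_cst (S T : topologicalType) (c : T) : continuous (fun _ : S => c).
Proof. by move=> t; exact: cvg_cst. Qed.

Lemma continuous_sum (R : realType) (V : normedModType R) (T : topologicalType)
    (I : Type) (r : seq I) (F : I -> T -> V) :
  (forall i, continuous (F i)) -> continuous (fun t => \sum_(i <- r) F i t).
Proof.
move=> Fc; elim: r => [|i r IH] t.
  have -> : (fun t => \sum_(i <- [::]) F i t) = cst 0 by apply/funext => u; rewrite big_nil.
  exact: cst_continuous.
have -> : (fun t => \sum_(j <- i :: r) F j t) = (fun t => F i t + \sum_(j <- r) F j t).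
  by apply/funext => u; rewrite big_cons.
by apply: continuous_add.
Qed.

Lemma continuous_entry (T : topologicalType) m n i j : continuous (fun M : 'M[T]_(m, n) => M i j).
Proof.
move=> M B MB; exists (fun i' j' => if (i' == i) && (j' == j) then B else setT).
  by move=> i' j'; case: ifP => [/andP[/eqP -> /eqP ->]|_] //; exact: filterT.
by move=> N /= /(_ i j); rewrite !eqxx.
Qed.

Lemma near_positive (R : realType) (T : topologicalType) (f : T -> R) (x : T) :
  continuous f -> 0 < f x -> \forall y \near x, 0 < f y.
Proof.
move=> fc fx; apply: (fc x [set z | 0 < z]); apply: open_nbhs_nbhs.
by split=> //; exact: open_gt.
Qed.

(** Without a zero, some coordinate of [F] would keep a strict sign on each ball of a uniform radius
    [d]. On a grid finer than [d], a fully labelled simplex contradicts this: label [i] gives a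
    vertex where coordinate [i] is nonpositive, the last label a vertex where all are positive. *)
Lemma brouwer_zero (R : realType) n (F : 'cV[R]_n -> 'cV[R]_n) (r : R) :
  continuous F -> (forall x, r <= `|x| -> F x = x) -> exists x, F x = 0.
Proof.
case: n F => [F _ _|n F Fc Fid]; first by exists 0; apply: flatmx0.
apply: contrapT => /forallNP F0.
wlog r0 : r Fid / 0 < r.
  move=> /(_ (Num.max r 1)); apply; last by rewrite lt_max ltr01 orbT.
  by move=> x; rewrite ge_max => /andP[/Fid].
pose P (d : R) (x : 'cV[R]_n.+1) := exists i,
  (forall y, `|x - y| <= d -> 0 < F y i 0) \/ (forall y, `|x - y| <= d -> F y i 0 < 0).
have [d [d0 dP]] : exists d, 0 < d /\ forall x, `|x| <= r -> P d x.
  have /compact_near_coveringP/(_ R 0^'+ P _) cov := @compact_ball_cV R n.+1 r.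
  have : \forall d \near 0^'+, [set x | `|x| <= r] `<=` P d.
    apply: cov => x _.
    have [i Fi0] : exists i, F x i 0 != 0.
      apply: contrapT => /forallNP h; apply: (F0 x); apply/matrixP => i j.
      by rewrite ord1 mxE; apply/eqP/negP => /negP; exact: h.
    have Fic : continuous (fun y => F y i 0).
      move=> y; apply: (@continuous_comp _ _ _ F (fun M : 'cV[R]_n.+1 => M i 0)).
        exact: Fc.
      exact: coord_continuous.
    have : \forall y \near x, 0 < F x i 0 * F y i 0.
      apply: (@near_positive _ _ (fun y => F x i 0 * F y i 0)).
        by move=> y; apply: continuousM; [exact: cst_continuous|exact: Fic].
      by rewrite -expr2 exprn_even_gt0.
    move=> /nbhs_ballP[e /= e0 eA].
    near=> x' d => /=; exists i.
    have xx' : `|x - x'| < e / 2.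
      near: x'; apply/nbhs_ballP; exists (e / 2); first by rewrite /= divr_gt0.
      by rewrite -ball_normE.
    have de : d < e / 2 by near: d; apply: nbhs_right_lt; rewrite divr_gt0.
    have yA y : `|x' - y| <= d -> 0 < F x i 0 * F y i 0.
      move=> x'y; apply: eA; rewrite -ball_normE /=.
      have -> : x - y = (x - x') + (x' - y) by rewrite addrA subrK.
      by apply: le_lt_trans (ler_normD _ _) _; lra.
    have [Fneg|Fpos] := ltP (F x i 0) 0.
      by right=> y /yA; rewrite nmulr_rgt0.
    left=> y /yA; rewrite pmulr_rgt0 // lt_neqAle eq_sym.
    by rewrite Fi0.
  by move=> /(filterI (nbhs_right_gt _)) /filter_ex[d [d0 dP]]; exists d; split.
have [c c0 hd] : exists2 c : nat, (0 < c)%N & r / c%:R < d.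
  exists (Num.truncn (r / d)).+1 => //.
  rewrite ltr_pdivrMr ?ltr0n // -ltr_pdivrMl // mulrC.
  exact: truncnS_gt.
pose h := r / c%:R.
have h0 : 0 < h by rewrite divr_gt0 // ltr0n.
have ch : c%:R * h = r by rewrite /h mulrC divfK // pnatr_eq0 -lt0n.
have ch_norm : `|c%:R * h| = r by rewrite ch gtr0_norm.
(* The grid of side [2 * c] is mapped onto the cube of radius [r], with [c] at the origin; on its
   boundary the sup norm is [r], so [F] is the identity and the label is the standard one. *)
pose pos (w : 'I_n.+1 -> nat) : 'cV[R]_n.+1 := \col_i (((w i)%:R - c%:R) * h).
pose l w := first_true (fun i => F (pos w) i 0 <= 0).
pose N' := (c + c).-1.
have cN : (c < N'.+1)%N by rewrite prednK ?addn_gt0 ?c0 // -addn1 leq_add2l.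
have [w wb|x /forallP xfull] := @kuhn_sperner n N' c l cN.
  rewrite /l; congr first_true; apply/funext => i; rewrite Fid.
    rewrite mxE pmulr_lle0 // subr_le0 ler_nat.
    by [].
  case: wb => j wj; apply: le_trans (coord_le_norm _ j 0).
  rewrite mxE; case: wj => ->.
    by rewrite sub0r mulNr normrN ch_norm.
  rewrite prednK ?addn_gt0 ?c0 // natrD addrK.
  by rewrite ch_norm.
pose y k := pos (kuhn_vertex x k).
have y_r : `|y 0%N| <= r.
  apply: norm_le_coord => [|i j]; first exact: ltW.
  rewrite mxE normrM (gtr0_norm h0) -ch ler_pM2r // /kuhn_vertex /= addn0.
  have v0 : 0 <= (x.1 i)%:R :> R by [].
  have v2c : (x.1 i)%:R <= c%:R + c%:R :> R.
    rewrite -natrD ler_nat -ltnS; apply: (leq_trans (ltn_ord (x.1 i))).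
    by rewrite prednK // addn_gt0 c0.
  by rewrite ler_norml; lra.
have y_near k : `|y 0%N - y k| <= d.
  apply: norm_le_coord => [|i j]; first exact: ltW.
  rewrite !mxE -mulrBl normrM (gtr0_norm h0) /kuhn_vertex /= addn0 natrD.
  apply: le_trans (ltW hd); rewrite -[leRHS]mul1r ler_pM2r //.
  case: (x.2 i < k)%N => /=; rewrite ler_norml; lra.
have [i [ipos|ineg]] := dP _ y_r.
  have /existsP[k /eqP lk] := xfull (widen_ord (leqnSn _) i).
  have [_ /(_ _)] := first_trueP (fun i => F (y k) i 0 <= 0) i.
  rewrite -/(l (kuhn_vertex x k)) lk => /(_ erefl).
  by rewrite leNgt ipos.
have /existsP[k /eqP lk] := xfull ord_max.
have [/(_ _) + _] := first_trueP (fun i => F (y k) i 0 <= 0) i.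
rewrite -/(l (kuhn_vertex x k)) lk => /(_ (ltn_ord i)).
by rewrite ltW // ineg.
Unshelve. all: by end_near. Qed.

(** * Coarse embeddings of hyperbolic space *)

Section Hyperboloid.
Variables (R : realType) (n : nat).
Implicit Types x y z : 'cV[R]_n.

Definition dotp x y : R := \sum_i x i 0 * y i 0.

Lemma dotpC x y : dotp x y = dotp y x.
Proof. by apply: eq_bigr => i _; rewrite mulrC. Qed.

Lemma dotpDl x y z : dotp (x + y) z = dotp x z + dotp y z.
Proof. by rewrite /dotp -big_split /=; apply: eq_bigr => i _; rewrite mxE mulrDl. Qed.

Lemma dotpZl a x y : dotp (a *: x) y = a * dotp x y.
Proof. by rewrite /dotp mulr_sumr; apply: eq_bigr => i _; rewrite mxE mulrA. Qed.

Lemma dotpNl x y : dotp (- x) y = - dotp x y.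
Proof. by rewrite -scaleN1r dotpZl mulN1r. Qed.

Lemma dotpDr x y z : dotp z (x + y) = dotp z x + dotp z y.
Proof. by rewrite !(dotpC z) dotpDl. Qed.

Lemma dotpZr a x y : dotp x (a *: y) = a * dotp x y.
Proof. by rewrite !(dotpC x) dotpZl. Qed.

Lemma dotpNr x y : dotp x (- y) = - dotp x y.
Proof. by rewrite !(dotpC x) dotpNl. Qed.

Definition dotpE := (dotpDl, dotpDr, dotpNl, dotpNr, dotpZl, dotpZr).

Lemma dotp0l x : dotp 0 x = 0.
Proof. by rewrite -(scale0r x) dotpZl mul0r. Qed.

Lemma dotp_suml (I : Type) (r : seq I) (P : pred I) (F : I -> 'cV[R]_n) x :
  dotp (\sum_(i <- r | P i) F i) x = \sum_(i <- r | P i) dotp (F i) x.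
Proof.
elim/big_rec2: _ => [|i a b _ <-]; first exact: dotp0l.
by rewrite dotpDl.
Qed.

Lemma dotp_ge0 x : 0 <= dotp x x.
Proof. by apply: sumr_ge0 => i _; rewrite -expr2 sqr_ge0. Qed.

Lemma dotp_eq0 x : dotp x x = 0 -> x = 0.
Proof.
move=> /eqP; rewrite psumr_eq0 => [/allP x0|i _]; last by rewrite -expr2 sqr_ge0.
apply/colP => i; rewrite mxE; apply/eqP.
by have /(_ (mem_index_enum i)) := x0 i; rewrite /= mulf_eq0 orbb.
Qed.

Lemma cauchy_schwarz x y : dotp x y ^+ 2 <= dotp x x * dotp y y.
Proof.
have [/dotp_eq0->|y0] := eqVneq (dotp y y) 0.
  by rewrite dotpC !dotp0l mulr0 expr0n.
have yy : 0 < dotp y y by rewrite lt_neqAle eq_sym y0 dotp_ge0.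
have := dotp_ge0 (dotp y y *: x - dotp x y *: y).
rewrite !dotpE (dotpC y x) => h.
have : 0 <= dotp y y * (dotp x x * dotp y y - dotp x y ^+ 2) by nra.
by rewrite pmulr_rge0 // subr_ge0.
Qed.

Lemma cauchy_schwarz_le x y a b : 0 <= a -> 0 <= b ->
  dotp x x <= a ^+ 2 -> dotp y y <= b ^+ 2 -> dotp x y <= a * b.
Proof.
move=> a0 b0 xa yb; apply: le_trans (ler_norm _) _.
rewrite -(@ler_pXn2r _ 2) ?nnegrE ?mulr_ge0 // real_normK ?num_real //.
by apply: le_trans (cauchy_schwarz _ _) _; rewrite exprMn ler_pM ?dotp_ge0.
Qed.

Lemma sqr_coord_le_dotp x i : (x i 0) ^+ 2 <= dotp x x.
Proof.
rewrite /dotp (bigD1 i) //= -expr2 lerDl; apply: sumr_ge0 => j _.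
by rewrite -expr2 sqr_ge0.
Qed.

Lemma dotp_le_norm x : dotp x x <= n%:R * `|x| ^+ 2.
Proof.
apply: (@le_trans _ _ (\sum_(i < n) `|x| ^+ 2)).
  apply: ler_sum => i _; rewrite -expr2 -real_normK ?num_real //.
  by rewrite ler_pXn2r ?nnegrE // coord_le_norm.
by rewrite sumr_const card_ord mulr_natl.
Qed.

(* (htime x, x) is the point above x of the upper sheet of -t^2 + |x|^2 = -1. *)
Definition htime x : R := Num.sqrt (1 + dotp x x).

(** The cosh of the hyperbolic distance between the points above [x] and [y]. *)
Definition coshd x y : R := htime x * htime y - dotp x y.

Lemma sqr_htime x : htime x ^+ 2 = 1 + dotp x x.
Proof. by rewrite sqr_sqrtr // addr_ge0 // dotp_ge0. Qed.

Lemma htime_ge1 x : 1 <= htime x.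
Proof. by rewrite -[leLHS]sqrtr1 ler_sqrt ?lerDl ?dotp_ge0 ?addr_ge0 ?dotp_ge0. Qed.

Lemma htime_gt0 x : 0 < htime x.
Proof. exact: lt_le_trans ltr01 (htime_ge1 x). Qed.

Lemma htime0 : htime 0 = 1.
Proof. by rewrite /htime dotp0l addr0 sqrtr1. Qed.

Lemma norm_le_htime x : `|x| <= htime x.
Proof.
apply: norm_le_coord => [|i j]; first exact: ltW (htime_gt0 x).
rewrite ord1 -(@ler_pXn2r _ 2) ?nnegrE ?(ltW (htime_gt0 x)) //.
rewrite real_normK ?num_real // sqr_htime.
by apply: le_trans (sqr_coord_le_dotp _ _) _; rewrite lerDr.
Qed.

Lemma coshdC x y : coshd x y = coshd y x.
Proof. by rewrite /coshd mulrC dotpC. Qed.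

Lemma coshdxx x : coshd x x = 1.
Proof. by rewrite /coshd -expr2 sqr_htime addrK. Qed.

Lemma coshd0x x : coshd 0 x = htime x.
Proof. by rewrite /coshd htime0 mul1r dotp0l subr0. Qed.

Lemma dotp_lt_htime x y : dotp x y < htime x * htime y.
Proof.
have [xy|xy] := ltP (dotp x y) 0.
  by apply: lt_trans xy _; rewrite mulr_gt0 ?htime_gt0.
have h0 : 0 <= htime x * htime y by rewrite mulr_ge0 ?ltW ?htime_gt0.
rewrite -(@ltr_pXn2r _ 2) ?nnegrE // exprMn !sqr_htime.
apply: le_lt_trans (cauchy_schwarz _ _) _.
by have := dotp_ge0 x; have := dotp_ge0 y; nra.
Qed.

Lemma coshd_gt0 x y : 0 < coshd x y.
Proof. by rewrite subr_gt0 dotp_lt_htime. Qed.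

(* A vector orthogonal to a timelike one is spacelike; this gives the bound
   cosh (a + b) <= 2 cosh a cosh b. *)
Lemma coshd_triangle x y z : coshd x z <= 2 * coshd x y * coshd y z.
Proof.
set a := coshd x y; set b := coshd y z.
have a0 : 0 < a := coshd_gt0 x y.
have b0 : 0 < b := coshd_gt0 y z.
pose w0 := b * htime x + a * htime z - 2 * a * b * htime y.
pose w := b *: x + a *: z + (- (2 * a * b)) *: y.
have yw : dotp y w = htime y * w0.
  rewrite /w !dotpDr !dotpZr (dotpC y x).
  have -> : dotp x y = htime x * htime y - a by rewrite /a /coshd; ring.
  have -> : dotp y z = htime y * htime z - b by rewrite /b /coshd; ring.
  have -> : dotp y y = htime y ^+ 2 - 1 by rewrite sqr_htime; ring.
  by rewrite /w0; ring.
have w0_le : w0 ^+ 2 <= dotp w w.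
  have := cauchy_schwarz y w; rewrite yw exprMn sqr_htime => h.
  have := dotp_ge0 y; have := dotp_ge0 w; have := sqr_ge0 w0.
  move: (dotp y y) (dotp w w) (w0 ^+ 2) h => p q r h r0 q0 p0.
  rewrite leNgt; apply/negP => qr.
  nra.
have ww : dotp w w - w0 ^+ 2 = 2 * a * b * (2 * a * b - coshd x z) - a ^+ 2 - b ^+ 2.
  rewrite /w !dotpDl !dotpDr !dotpZl !dotpZr (dotpC y x) (dotpC z x) (dotpC z y).
  have -> : dotp x y = htime x * htime y - a by rewrite /a /coshd; ring.
  have -> : dotp y z = htime y * htime z - b by rewrite /b /coshd; ring.
  have -> : dotp x z = htime x * htime z - coshd x z by rewrite /coshd; ring.
  have -> : dotp x x = htime x ^+ 2 - 1 by rewrite sqr_htime; ring.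
  have -> : dotp y y = htime y ^+ 2 - 1 by rewrite sqr_htime; ring.
  have -> : dotp z z = htime z ^+ 2 - 1 by rewrite sqr_htime; ring.
  by rewrite /w0; ring.
rewrite -subr_ge0 -(@pmulr_rge0 _ (2 * a * b)) ?mulr_gt0 //.
have := sqr_ge0 a; have := sqr_ge0 b; lra.
Qed.

Lemma htime_le_coshd x y : htime y <= 2 * htime x * coshd x y.
Proof. by rewrite -coshd0x -(coshd0x x); exact: coshd_triangle. Qed.

End Hyperboloid.

Section HyperboloidContinuity.
Variables (R : realType) (n : nat) (T : topologicalType).
Implicit Types f g : T -> 'cV[R]_n.

Lemma continuous_dotp f g : continuous f -> continuous g ->
  continuous (fun t => dotp (f t) (g t)).
Proof.
move=> fc gc; apply: continuous_sum => i t; apply: continuousM.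
  apply: (@continuous_comp _ _ _ f (fun M : 'cV[R]_n => M i 0)); first exact: fc.
  exact: coord_continuous.
apply: (@continuous_comp _ _ _ g (fun M : 'cV[R]_n => M i 0)); first exact: gc.
exact: coord_continuous.
Qed.

Lemma continuous_htime f : continuous f -> continuous (fun t => htime (f t)).
Proof.
move=> fc t; apply: (@continuous_comp _ _ _ (fun t => 1 + dotp (f t) (f t)) Num.sqrt).
  by apply: continuousD; [exact: cst_continuous|exact: continuous_dotp].
exact: sqrt_continuous.
Qed.

Lemma continuous_coshd f g : continuous f -> continuous g ->
  continuous (fun t => coshd (f t) (g t)).
Proof.
move=> fc gc t; rewrite /coshd.
apply: (@continuousB _ _ _ (fun t => htime (f t) * htime (g t)) (fun t => dotp (f t) (g t)));
  last exact: continuous_dotp.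
by apply: continuousM; exact: continuous_htime.
Qed.

End HyperboloidContinuity.

Lemma truncn_eq_dist (R : realType) (x y : R) :
  0 <= x -> 0 <= y -> Num.truncn x = Num.truncn y -> `|x - y| < 1.
Proof.
move=> x0 y0 xy; have /andP[] := truncn_itv x0; have /andP[] := truncn_itv y0.
rewrite xy -natr1 => h1 h2 h3 h4; rewrite ltr_norml; lra.
Qed.

(* The sphere is cut into boxes of side 2 r / N; there are O(N^n) of them, too few to
   separate a grid of points o with N^(n+1) elements. *)
Lemma lipschitz_sphere_image_not_all (R : realType) n (s : 'cV[R]_n.+1) (r rho M : R)
    (A : 'cV[R]_n.+1 -> 'cV[R]_n.+1) (V : 'cV[R]_n.+1 -> R) :
  0 < r -> 0 < rho -> 0 <= M ->
  (forall t t', `|t - s| = r -> `|t' - s| = r -> `|A t - A t'| <= M * `|t - t'|) ->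
  (forall t t', `|t - s| = r -> `|t' - s| = r -> `|V t - V t'| <= M * `|t - t'|) ->
  (forall t, `|t - s| = r -> 1 / 2 <= V t) ->
  exists2 o, `|o| <= rho & forall t, `|t - s| = r -> A t <> V t *: o.
Proof.
move=> r0 rho0 M0 Alip Vlip V_ge; apply: contrapT => none.
have {}none o : `|o| <= rho -> exists t, `|t - s| = r /\ A t = V t *: o.
  move=> orho; apply: contrapT => /forallNP no_t; apply: none; exists o => // t ts At.
  by apply: (no_t t).
(* Two grid points with the same key would give [rho / (2 * m) <= M * (1 + rho) * (2 * r / N)],
   since [V >= 1 / 2]; with [N = a * m] this [a] excludes it. The size of [m] then makes the grid
   outnumber the keys, as [N.+1 <= a.+1 * m]. *)
pose a := (Num.truncn (4 * M * (1 + rho) * r / rho)).+1.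
have a_gt : 4 * M * (1 + rho) * r / rho < a%:R by exact: truncnS_gt.
pose m := (n.+1 * 2 * a.+1 ^ n).+1.
pose N := (a * m)%N.
have m0 : (0 < m)%N by [].
have mR0 : 0 < m%:R :> R by rewrite ltr0n.
have N0 : 0 < N%:R :> R by rewrite ltr0n muln_gt0.
pose o (k : {ffun 'I_n.+1 -> 'I_m}) : 'cV[R]_n.+1 := \col_i (rho * (k i)%:R / m%:R).
have o_le k : `|o k| <= rho.
  apply: norm_le_coord => [|i j]; first exact: ltW.
  rewrite mxE ger0_norm ?divr_ge0 ?mulr_ge0 // ?(ltW rho0) //.
  by rewrite ler_pdivrMr // ler_pM2l // ler_nat ltnW.
have /choice[t tP] : forall k, exists t, `|t - s| = r /\ A t = V t *: o k.
  by move=> k; exact: none.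
have /choice[ix ixP] : forall k, exists i, `|(t k - s) i 0| = r.
  move=> k; have [tr _] := tP k.
  have : mx_norm (t k - s) != 0 by rewrite (_ : mx_norm _ = r) // gt_eqF.
  by move=> /mx_norm_neq0[[i j] e]; exists i; rewrite -tr [RHS]e /= ord1.
pose scaled k j := (t k j 0 - s j 0 + r) / (2 * r) * N%:R.
have dist_s k j : `|t k j 0 - s j 0| <= r.
  by have [<- _] := tP k; have := coord_le_norm (t k - s) j 0; rewrite !mxE.
have scaled_ge0 k j : 0 <= scaled k j.
  have := dist_s k j; rewrite ler_norml => /andP[h1 h2].
  by rewrite /scaled mulr_ge0 ?divr_ge0 ?mulr_ge0 // ?(ltW N0) //; lra.
have scaled_le k j : (Num.truncn (scaled k j) < N.+1)%N.
  have := dist_s k j; rewrite ler_norml => /andP[h1 h2].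
  have /andP[trunc_le _] := truncn_itv (scaled_ge0 k j).
  rewrite ltnS -(ler_nat R); apply: le_trans trunc_le _.
  rewrite /scaled ler_piMl ?(ltW N0) // ler_pdivrMr; lra.
(* A sphere of the sup norm is the boundary of a cube: the key records the face containing [t k], by
   coordinate and sign, and a box in the remaining coordinates. *)
pose key k : 'I_n.+1 * bool * {ffun 'I_n -> 'I_N.+1} :=
  (ix k, 0 <= (t k - s) (ix k) 0, [ffun j => inord (Num.truncn (scaled k (lift (ix k) j)))]).
have key_inj : injective key.
  move=> k k' kk'; apply/eqP; apply: contraPT kk' => neq [ixE sgnE /ffunP cellE].
  have tt' : `|t k - t k'| <= 2 * r / N%:R.
    apply: norm_le_coord => [|j i]; first by rewrite divr_ge0 ?mulr_ge0 ?ltW.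
    rewrite ord1 !mxE {i}.
    have [j' ->|->] := unliftP (ix k) j.
      have := cellE j'; rewrite !ffunE -ixE => /(congr1 val) /=.
      rewrite !inordK ?scaled_le // => /(truncn_eq_dist (scaled_ge0 _ _) (scaled_ge0 _ _)).
      rewrite /scaled -mulrBl -mulrBl normrM (gtr0_norm N0) -ltr_pdivlMr // div1r.
      rewrite normrM [X in _ * X]gtr0_norm ?invr_gt0 ?mulr_gt0 //.
      rewrite ltr_pdivrMr ?mulr_gt0 // mulrC => h; apply: ltW; apply: le_lt_trans h.
      by rewrite le_eqVlt; apply/orP; left; apply/eqP; congr `|_|; ring.
    have := ixP k; have := ixP k'; rewrite -ixE.
    have -> : t k (ix k) 0 - t k' (ix k) 0 = (t k - s) (ix k) 0 - (t k' - s) (ix k) 0.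
      by rewrite !mxE; ring.
    move: sgnE; rewrite -ixE => sgnE h1 h2.
    suff -> : (t k - s) (ix k) 0 - (t k' - s) (ix k) 0 = 0.
      by rewrite normr0 divr_ge0 ?mulr_ge0 // ltW.
    move: sgnE h1 h2; case: lerP => ? /esym.
      by move=> ?; do 2 (rewrite ger0_norm //); lra.
    move/negbT; rewrite -ltNge => ?; do 2 (rewrite ltr0_norm //); lra.
  have [i ki] : exists i, k i != k' i.
    by apply/existsP; apply: contraNT neq => /existsPn h; apply/eqP/ffunP => i; apply/eqP; have := h i; rewrite negbK.
  have o_dist : rho / m%:R <= `|o k - o k'|.
    apply: le_trans (coord_le_norm _ i 0); rewrite !mxE -mulrBl -mulrBr !normrM.
    rewrite (gtr0_norm rho0) (@gtr0_norm _ m%:R^-1) ?invr_gt0 // ler_pM2r ?invr_gt0 //.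
    rewrite ler_peMr ?(ltW rho0) //.
    have [lt|lt|e] := ltngtP (k i) (k' i); last by move: ki; rewrite -val_eqE /= e eqxx.
      by rewrite distrC ger0_norm ?subr_ge0 ?ler_nat ?(ltnW lt) // -natrB ?(ltnW lt) // ler1n subn_gt0.
    by rewrite ger0_norm ?subr_ge0 ?ler_nat ?(ltnW lt) // -natrB ?(ltnW lt) // ler1n subn_gt0.
  have [ts At] := tP k; have [ts' At'] := tP k'.
  have VE : V (t k) *: (o k - o k') = (A (t k) - A (t k')) + (V (t k') - V (t k)) *: o k'.
    by rewrite At At' scalerBr scalerBl addrA subrK.
  have : 1 / 2 * (rho / m%:R) <= M * (1 + rho) * (2 * r / N%:R).
    apply: (@le_trans _ _ `|V (t k) *: (o k - o k')|).
      rewrite normrZ; apply: ler_pM => //; first by rewrite divr_ge0 // ltW.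
      by apply: le_trans (ler_norm _); exact: V_ge.
    rewrite VE; apply: le_trans (ler_normD _ _) _; rewrite normrZ.
    apply: (@le_trans _ _ (M * `|t k - t k'| + M * `|t k - t k'| * rho)).
      apply: lerD; first exact: Alip.
      by apply: ler_pM => //; rewrite distrC Vlip.
    rewrite [leLHS](_ : _ = M * (1 + rho) * `|t k - t k'|); last by ring.
    by apply: ler_wpM2l => //; rewrite mulr_ge0 // addr_ge0 // ltW.
  apply/negP; rewrite -ltNge /N natrM invfM.
  have -> : M * (1 + rho) * (2 * r * (a%:R^-1 * m%:R^-1)) =
    (2 * (M * (1 + rho) * r) / a%:R) / m%:R by ring.
  rewrite (mulrA (1 / 2)) ltr_pM2r ?invr_gt0 // ltr_pdivrMr ?ltr0n //.
  by move: a_gt; rewrite ltr_pdivrMr //; lra.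
have := leq_card key key_inj.
rewrite !card_prod card_bool !card_ffun !card_ord.
apply/negP; rewrite -ltnNge expnS.
apply: (@leq_ltn_trans (n.+1 * 2 * (a.+1 * m) ^ n)).
  rewrite leq_mul2l; apply/orP; right.
  have Nm : (N.+1 <= a.+1 * m)%N by rewrite mulSn -addn1 addnC leq_add.
  by case: (posnP n) => [->//|n0]; rewrite leq_exp2r.
by rewrite expnMn mulnA ltn_pmul2r ?expn_gt0.
Qed.

(** * Bounded Lipschitz functions *)

Section LipschitzBounded.
Variables (R : realType) (n : nat) (D : set 'cV[R]_n).
Implicit Types f g : 'cV[R]_n -> R.

(** Boundedness is included so that the class is stable under products. *)
Definition lip_bounded f := exists M : R, [/\ 0 <= M, forall t, D t -> `|f t| <= M &
  forall t t', D t -> D t' -> `|f t - f t'| <= M * `|t - t'|].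

Lemma lip_bounded_cst c : lip_bounded (cst c).
Proof.
exists `|c|; split=> // t t' _ _.
by rewrite subrr normr0 mulr_ge0.
Qed.

Lemma lip_boundedD f g : lip_bounded f -> lip_bounded g ->
  lip_bounded (fun t => f t + g t).
Proof.
move=> [M [M0 fM fl]] [M' [M'0 gM gl]]; exists (M + M'); split.
- exact: addr_ge0.
- by move=> t Dt; apply: le_trans (ler_normD _ _) _; rewrite lerD ?fM ?gM.
- move=> t t' Dt Dt'; rewrite opprD addrACA mulrDl.
  by apply: le_trans (ler_normD _ _) _; rewrite lerD ?fl ?gl.
Qed.

Lemma lip_boundedM f g : lip_bounded f -> lip_bounded g ->
  lip_bounded (fun t => f t * g t).
Proof.
move=> [M [M0 fM fl]] [M' [M'0 gM gl]]; exists (M * M' + M * M'); split.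
- by rewrite addr_ge0 // mulr_ge0.
- move=> t Dt; rewrite normrM; apply: (@le_trans _ _ (M * M')); last by rewrite lerDl mulr_ge0.
  by rewrite ler_pM ?fM ?gM.
- move=> t t' Dt Dt'.
  have -> : f t * g t - f t' * g t' = (f t - f t') * g t + f t' * (g t - g t') by ring.
  apply: le_trans (ler_normD _ _) _; rewrite !normrM mulrDl lerD //.
    by rewrite [leRHS]mulrAC ler_pM ?fl ?gM.
  by rewrite -mulrA ler_pM ?gl ?fM.
Qed.

Lemma lip_bounded_sum (I : Type) (r : seq I) (F : I -> 'cV[R]_n -> R) :
  (forall i, lip_bounded (F i)) -> lip_bounded (fun t => \sum_(i <- r) F i t).
Proof.
move=> Fl; elim: r => [|i r IH].
  have -> : (fun t => \sum_(i <- [::]) F i t) = cst 0 by apply/funext => u; rewrite big_nil.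
  exact: lip_bounded_cst.
have -> : (fun t => \sum_(j <- i :: r) F j t) = (fun t => F i t + \sum_(j <- r) F j t).
  by apply/funext => u; rewrite big_cons.
exact: lip_boundedD.
Qed.

Lemma lip_bounded_contract f g : lip_bounded f ->
  (forall t, D t -> `|g t| <= `|f t|) ->
  (forall t t', D t -> D t' -> `|g t - g t'| <= `|f t - f t'|) -> lip_bounded g.
Proof.
move=> [M [M0 fM fl]] gf gfl; exists M; split=> // [t Dt|t t' Dt Dt'].
  by apply: le_trans (gf _ Dt) _; exact: fM.
by apply: le_trans (gfl _ _ Dt Dt') _; exact: fl.
Qed.

Lemma lip_bounded_pospart f : lip_bounded f -> lip_bounded (fun t => Num.max 0 (f t)).
Proof.
move=> fl; apply: (lip_bounded_contract fl) => [t _|t t' _ _].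
  by case: (lerP 0 (f t)); rewrite ?normr0.
by case: (lerP 0 (f t)); case: (lerP 0 (f t')) => ? ?;
  rewrite ?subrr ?normr0 // ?sub0r ?subr0 ?normrN; rewrite ler_norml; have := ler_norm (f t - f t');
  have := ler_norm (- (f t - f t')); rewrite normrN; lra.
Qed.

Hypothesis D_bounded : exists M : R, forall t, D t -> `|t| <= M.

Lemma lip_bounded_coord i : lip_bounded (fun t => t i 0).
Proof.
have [M DM] := D_bounded; exists (`|M| + 1); split=> [|t Dt|t t' _ _].
- by rewrite addr_ge0.
- apply: le_trans (coord_le_norm _ _ _) _; apply: le_trans (DM _ Dt) _.
  by have := ler_norm M; lra.
- have := coord_le_norm (t - t') i 0; rewrite !mxE => h; apply: le_trans h _.
  by rewrite ler_peMl // lerDr.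
Qed.

Lemma lip_bounded_dotp x : lip_bounded (fun t => dotp x t).
Proof.
apply: lip_bounded_sum => i; apply: lip_boundedM; last exact: lip_bounded_coord.
exact: lip_bounded_cst.
Qed.

(** The square of [htime] is polynomial, and [htime >= 1] makes the square root contract
    differences. *)
Lemma lip_bounded_htime : lip_bounded (@htime R n).
Proof.
have sq : lip_bounded (fun t => 1 + dotp t t).
  apply: lip_boundedD; first exact: lip_bounded_cst.
  by apply: lip_bounded_sum => i; apply: lip_boundedM; exact: lip_bounded_coord.
apply: (lip_bounded_contract sq) => [t _|t t' _ _].
  rewrite -sqr_htime ger0_norm; last exact: ltW (htime_gt0 t).
  by rewrite normrX ger0_norm ?ler_eXnr ?htime_ge1 // ltW ?htime_gt0.
rewrite -!sqr_htime subr_sqr normrM ler_peMr //.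
by have := htime_ge1 t; have := htime_ge1 t' => *; rewrite ger0_norm; lra.
Qed.

Lemma lip_bounded_coshd x : lip_bounded (fun t => coshd x t).
Proof.
have -> : (fun t => coshd x t) = (fun t => htime x * htime t + -1 * dotp x t).
  by apply/funext => t; rewrite /coshd mulN1r.
apply: lip_boundedD; apply: lip_boundedM; try exact: lip_bounded_cst.
  exact: lip_bounded_htime.
exact: lip_bounded_dotp.
Qed.

End LipschitzBounded.

Section CoarseEmbedding.
Variables (R : realType) (n : nat) (Phi : 'cV[R]_n.+1 -> 'cV[R]_n.+1) (C : R).
Hypothesis Phi_cont : continuous Phi.
Hypothesis Phi_coarse : forall x y, coshd (Phi x) (Phi y) <= 4 -> coshd x y <= C.

Lemma coarse_ge1 : 1 <= C.
Proof. by rewrite -(coshdxx (0 : 'cV[R]_n.+1)); apply: Phi_coarse; rewrite coshdxx; lra. Qed.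

(** By coarse injectivity the points sent near a given [t] are within bounded distance of any one of
    them; compactness makes the bound uniform. The value [7 / 5] is fitted to the hypothesis, as 2
    (7/5)^2 <= 4. *)
Lemma coarse_proper s r : exists M, forall x, `|Phi x - s| <= r -> `|x| <= M.
Proof.
pose P (M : R) t := forall x, Phi x = t -> `|x| <= M.
have cov : \forall M \near +oo, [set t | `|t| <= r + `|s|] `<=` P M.
  have /compact_near_coveringP := @compact_ball_cV R n.+1 (r + `|s|).
  apply => t _.
  have near_t : \forall t' \near t, 0 < 7 / 5 - coshd t t'.
    apply: (@near_positive _ _ (fun t' => 7 / 5 - coshd t t')); last by rewrite coshdxx; lra.
    apply: continuous_sub; first exact: cst_continuous.
    by apply: continuous_coshd; move=> ?; [exact: cst_continuous|exact: cvg_id].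
  have [[x1 tx1]|none] := pselect (exists x, coshd t (Phi x) <= 7 / 5); last first.
    near=> t' M.
    have tt' : coshd t t' <= 7 / 5 by rewrite -subr_ge0 ltW //; near: t'.
    by move=> x xt'; exfalso; apply: none; exists x; rewrite xt'.
  near=> t' M.
  have tt' : coshd t t' <= 7 / 5 by rewrite -subr_ge0 ltW //; near: t'.
  have MM : 2 * htime x1 * C <= M by near: M; apply: nbhs_pinfty_ge; exact: num_real.
  move=> x xt'; apply: le_trans MM.
  have /Phi_coarse x1x : coshd (Phi x1) (Phi x) <= 4.
    apply: le_trans (coshd_triangle _ t _) _; rewrite coshdC xt'.
    have := coshd_gt0 t (Phi x1); have := coshd_gt0 t t'; nra.
  apply: le_trans (norm_le_htime _) _; apply: le_trans (htime_le_coshd x1 _) _.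
  by rewrite ler_pM2l // mulr_gt0 ?htime_gt0.
have [M MP] := filter_ex cov; exists M => x xr; apply: (MP (Phi x)) => //=.
by rewrite -(subrK s (Phi x)) (le_trans (ler_normD _ _)) // lerD2r.
Unshelve. all: by end_near. Qed.

Lemma coarse_bounded s m : exists2 r, 0 < r & forall x, `|x| <= m -> `|Phi x - s| < r.
Proof.
have : compact (Phi @` [set x | `|x| <= m]).
  apply: continuous_compact; first exact: continuous_subspaceT.
  exact: compact_ball_cV.
move=> /compact_bounded[M [_ MP]].
exists (`|M| + 1 + `|s| + 1) => [|x xm]; first by rewrite ltr_pwDr ?ltr01 // !addr_ge0.
apply: le_lt_trans (ler_normB _ _) _.
have : `|Phi x| <= `|M| + 1.
  by apply: (MP (`|M| + 1)); [have := ler_norm M; lra|exists x].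
lra.
Qed.

Lemma coarse_net m : exists xs : seq 'cV[R]_n.+1,
  forall x, `|x| <= m -> exists2 x', x' \in xs & coshd (Phi x') (Phi x) < 3 / 2.
Proof.
have := @compact_ball_cV R n.+1 m; rewrite compact_cover => cov.
have [|x xm|D' _ D'P] := cov _ [set: 'cV[R]_n.+1] (fun x' => [set x | 0 < 3 / 2 - coshd (Phi x') (Phi x)]).
- move=> x' _; apply: (@open_comp _ _ (fun x => 3 / 2 - coshd (Phi x') (Phi x)) [set z | 0 < z]).
    move=> x _; apply: continuous_sub; first exact: cst_continuous.
    by apply: continuous_coshd; [move=> ?; exact: cst_continuous|exact: Phi_cont].
  exact: open_gt.
- by exists x => //=; rewrite coshdxx; lra.
exists (finmap.enum_fset D') => x /D'P[x' /= x'D' xx']; exists x' => //.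
by rewrite -subr_gt0.
Qed.

(** * A coarse left inverse by averaging a net *)

Section Weights.
Variable xs : seq 'cV[R]_n.+1.

(** The average is kept as a fraction [A] over [V]. Here [V] is the maximum of [W] and 1/2, hence
    bounded away from 0, and it agrees with [W] once a net point lies at [coshd] below 3/2. Weights
    vanish from [coshd] equal to 2 on, within reach of [Phi_coarse]. *)
Let w x' t := Num.max 0 (2 - coshd (Phi x') t).
Let W t := \sum_(x' <- xs) w x' t.
Let V t := W t + Num.max 0 (1 / 2 - W t).
Let A t := \sum_(x' <- xs) w x' t *: x'.

Lemma weight_ge0 x' t : 0 <= w x' t.
Proof. by rewrite le_max lexx. Qed.

Lemma weightV_ge t : 1 / 2 <= V t.
Proof. by rewrite -lerBlDl le_max lexx orbT. Qed.

Lemma weightV_eq x' t : x' \in xs -> coshd (Phi x') t < 3 / 2 -> V t = W t.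
Proof.
move=> x'xs lt; rewrite /V max_l ?addr0 // subr_le0 /W (big_rem x') //=.
apply: (@le_trans _ _ (w x' t)); first by rewrite /w le_max; apply/orP; right; lra.
by rewrite lerDl; apply: sumr_ge0 => y _; exact: weight_ge0.
Qed.

(** A point [x'] of positive weight has [coshd x' x <= C], hence [dotp x' x >= htime x - C]: far
    out, the average taken at [Phi x] points along [x]. *)
Lemma weight_dotp x : W (Phi x) * (htime x - C) <= dotp (A (Phi x)) x.
Proof.
rewrite /W /A mulr_suml dotp_suml; apply: ler_sum => x' _.
rewrite dotpZl; have [->|w0] := eqVneq (w x' (Phi x)) 0; first by rewrite !mul0r.
apply: ler_wpM2l; first exact: weight_ge0.
have : coshd x' x <= C.
  apply: Phi_coarse; apply: contraNT w0; rewrite -ltNge => h.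
  by apply/eqP; rewrite /w max_l //; lra.
have := htime_ge1 x'; have := htime_gt0 x; rewrite /coshd; nra.
Qed.

Lemma lip_bounded_weight (D : set 'cV[R]_n.+1) x' :
  (exists M : R, forall t, D t -> `|t| <= M) -> lip_bounded D (w x').
Proof.
move=> Db; apply: lip_bounded_pospart.
have -> : (fun t => 2 - coshd (Phi x') t) = (fun t => 2 + -1 * coshd (Phi x') t).
  by apply/funext => t; rewrite mulN1r.
apply: lip_boundedD; first exact: lip_bounded_cst.
apply: lip_boundedM; [exact: lip_bounded_cst|exact: lip_bounded_coshd].
Qed.

Lemma lip_bounded_V (D : set 'cV[R]_n.+1) :
  (exists M : R, forall t, D t -> `|t| <= M) -> lip_bounded D V.
Proof.
move=> Db; have WL : lip_bounded D W.
  by apply: lip_bounded_sum => x'; exact: lip_bounded_weight.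
apply: lip_boundedD => //; apply: lip_bounded_pospart.
have -> : (fun t => 1 / 2 - W t) = (fun t => 1 / 2 + -1 * W t).
  by apply/funext => t; rewrite mulN1r.
apply: lip_boundedD; first exact: lip_bounded_cst.
by apply: lip_boundedM; first exact: lip_bounded_cst.
Qed.

Lemma lipschitz_A (D : set 'cV[R]_n.+1) :
  (exists M : R, forall t, D t -> `|t| <= M) ->
  exists2 M, 0 <= M & forall t t', D t -> D t' -> `|A t - A t'| <= M * `|t - t'|.
Proof.
move=> Db.
have Ai i : exists M : R, 0 <= M /\
    forall t t', D t -> D t' -> `|A t i 0 - A t' i 0| <= M * `|t - t'|.
  have : lip_bounded D (fun t => \sum_(x' <- xs) w x' t * x' i 0).
    apply: lip_bounded_sum => x'; apply: lip_boundedM; last exact: lip_bounded_cst.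
    exact: lip_bounded_weight.
  move=> [M [M0 _ Ml]]; exists M; split=> // t t' Dt Dt'.
  rewrite /A !summxE; under eq_bigr do rewrite mxE.
  by under [X in _ - X]eq_bigr do rewrite mxE; exact: Ml.
have /choice[M MP] := Ai.
exists (\sum_i M i) => [|t t' Dt Dt'].
  by apply: sumr_ge0 => i _; case: (MP i).
apply: norm_le_coord => [|i j].
  by rewrite mulr_ge0 // sumr_ge0 // => i _; case: (MP i).
have [Mi0 MiP] := MP i; rewrite ord1 !mxE; apply: le_trans (MiP _ _ Dt Dt') _.
rewrite ler_wpM2r // (bigD1 i) //= lerDl sumr_ge0 // => k _; by case: (MP k).
Qed.

Lemma continuous_weight x' : continuous (w x').
Proof.
move=> t; apply: (@continuous_max _ _ (cst 0) (fun t => 2 - coshd (Phi x') t)).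
  exact: cst_continuous.
apply: continuous_sub; first exact: cst_continuous.
by apply: continuous_coshd; move=> ?; [exact: cst_continuous|exact: cvg_id].
Qed.

Lemma continuous_V : continuous V.
Proof.
have Wc : continuous W by apply: continuous_sum => x'; exact: continuous_weight.
move=> t; apply: continuousD; first exact: Wc.
apply: (@continuous_max _ _ (cst 0) (fun t => 1 / 2 - W t)).
  exact: cst_continuous.
by apply: continuous_sub; [exact: cst_continuous|exact: Wc].
Qed.

Lemma continuous_A : continuous A.
Proof.
apply: mx_continuous => i j.
have -> : (fun t => A t i j) = (fun t => \sum_(x' <- xs) w x' t * x' i j).
  by apply/funext => t; rewrite /A summxE; apply: eq_bigr => x' _; rewrite mxE.
apply: continuous_sum => x' t; apply: continuousM; last exact: cst_continuous.
exact: continuous_weight.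
Qed.

End Weights.

(* Suppose Phi misses s. Pushing a large ball L around s radially onto its boundary
   sphere and composing with a coarse left inverse of Phi (averages of the points of a
   net) gives a self-map of the ball of radius Rr + 1 that points outwards on its
   boundary; it misses a generic small vector o, contradicting Brouwer. *)
Theorem coarse_embedding_surjective s : exists x, Phi x = s.
Proof.
apply: contrapT => /forallNP miss.
have C1 := coarse_ge1.
(* Beyond [2 * C] the gain [htime x - C] exceeds the loss [htime x / 2] caused by the offset [o].
   This [r] ensures [htime x > 2 * C] whenever [Phi x] is outside the ball of radius [r] around
   [s]. *)
have [r r0 Phi_r] := coarse_bounded s (2 * C).
have [R0 R0P] := coarse_proper s r.
pose Rr := Num.max R0 (2 * C) + 1.
have Rr_out x : Rr <= `|x| -> r < `|Phi x - s| /\ 2 * C < htime x.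
  rewrite /Rr => xR; split.
    rewrite ltNge; apply/negP => /R0P h.
    have : R0 <= Num.max R0 (2 * C) by rewrite le_max lexx.
    lra.
  have : 2 * C <= Num.max R0 (2 * C) by rewrite le_max lexx orbT.
  have := norm_le_htime x; lra.
have [xs xsP] := coarse_net (Rr + 1).
set W := fun t => \sum_(x' <- xs) Num.max 0 (2 - coshd (Phi x') t).
set V := fun t => W t + Num.max 0 (1 / 2 - W t).
set A := fun t => \sum_(x' <- xs) Num.max 0 (2 - coshd (Phi x') t) *: x'.
pose D := [set t | `|t - s| = r].
have Db : exists M : R, forall t, D t -> `|t| <= M.
  exists (r + `|s|) => t ts; rewrite -(subrK s t) (le_trans (ler_normD _ _)) //.
  by rewrite lerD2r ts.
have [MV [MV0 _ Vlip]] := lip_bounded_V xs Db.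
have [MA MA0 Alip] := lipschitz_A xs Db.
(* With this radius [o] has Euclidean norm at most 1/2, as [o_dot] requires. *)
have rho0 : 0 < (2 * n.+1%:R)^-1 :> R by rewrite invr_gt0 mulr_gt0.
have [ o o_small o_miss] : exists2 o, `|o| <= (2 * n.+1%:R)^-1 &
    forall t, `|t - s| = r -> A t <> V t *: o.
  apply: (@lipschitz_sphere_image_not_all _ _ s r _ (MA + MV)) => //.
  - exact: addr_ge0.
  - move=> t t' ts t's; apply: le_trans (Alip _ _ ts t's) _.
    by rewrite ler_wpM2r // lerDl.
  - move=> t t' ts t's; apply: le_trans (Vlip _ _ ts t's) _.
    by rewrite ler_wpM2r // lerDr.
  - by move=> t _; exact: weightV_ge.
have o_dot x : dotp o x <= htime x / 2.
  rewrite mulrC; apply: cauchy_schwarz_le => //; first exact: ltW (htime_gt0 x).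
    apply: le_trans (dotp_le_norm _) _.
    apply: (@le_trans _ _ (n.+1%:R * ((2 * n.+1%:R)^-1) ^+ 2)).
      by rewrite ler_wpM2l // ler_pXn2r ?nnegrE // ltW.
    rewrite invfM exprMn mulrCA ler_piMr ?exprn_ge0 // expr2 mulrA mulfV ?pnatr_eq0 //.
    by rewrite mul1r invf_le1 ?ltr0n // ler1n.
  by rewrite sqr_htime lerDr.
(* Radial push of the ball onto its boundary, the identity outside; its composite with [Phi] is
   continuous because [Phi] misses [s]. *)
pose g t := s + Num.max 1 (r / `|t - s|) *: (t - s).
pose tau (x : 'cV[R]_n.+1) := Num.max 0 (Num.min 1 (`|x| - Rr)).
pose G x := A (g (Phi x)) - V (g (Phi x)) *: o.
(* A zero of [F] with [Phi x] in the ball is excluded by the choice of [o]. Elsewhere [G x] (up to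
   radius [Rr + 1]) and [x] both have positive product with [x], hence so do their convex
   combinations. *)
pose F x := (1 - tau x) *: G x + tau x *: x.
have Phi_s x : Phi x - s != 0 by rewrite subr_eq0; apply/eqP; exact: miss.
have Psc : continuous (fun x => Phi x - s).
  by apply: continuous_sub; [exact: Phi_cont|exact: continuous_cst].
have g_cont : continuous (fun x => g (Phi x)).
  apply: continuous_add; first exact: continuous_cst.
  apply: continuous_scale; last exact: Psc.
  apply: continuous_maxR; first exact: continuous_cst.
  apply: continuous_mul; first exact: continuous_cst.
  apply: continuous_inv => x; first by rewrite normr_eq0.
  apply: (@continuous_comp _ _ _ (fun x => Phi x - s) (fun z => `|z|)); first exact: Psc.
  exact: norm_continuous.
have G_cont : continuous G.
  apply: continuous_sub.
    move=> x; apply: (@continuous_comp _ _ _ (fun x => g (Phi x)) A); first exact: g_cont.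
    exact: continuous_A.
  apply: continuous_scale; last exact: continuous_cst.
  move=> x; apply: (@continuous_comp _ _ _ (fun x => g (Phi x)) V); first exact: g_cont.
  exact: continuous_V.
have tau_cont : continuous tau.
  apply: continuous_maxR; first exact: continuous_cst.
  apply: continuous_minR; first exact: continuous_cst.
  by apply: continuous_sub; [exact: norm_continuous|exact: continuous_cst].
have F_cont : continuous F.
  apply: continuous_add; apply: continuous_scale.
  - by apply: continuous_sub; [exact: continuous_cst|exact: tau_cont].
  - exact: G_cont.
  - exact: tau_cont.
  - by move=> x; exact: cvg_id.
have gE t : r <= `|t - s| -> g t = t.
  move=> rt; have ts0 := lt_le_trans r0 rt.
  have rt1 : r / `|t - s| <= 1 by rewrite ler_pdivrMr // mul1r.
  by rewrite /g max_l // scale1r addrC subrK.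
have G_dot x : `|x| <= Rr + 1 -> r <= `|Phi x - s| -> 2 * C < htime x -> 0 < dotp (G x) x.
  move=> xR rx Cx; rewrite /G gE // dotpDl dotpNl dotpZl.
  have [x' x'xs x'x] := xsP x xR.
  have VW : V (Phi x) = W (Phi x) := weightV_eq x'xs x'x.
  have h : W (Phi x) * (htime x - C) <= dotp (A (Phi x)) x := weight_dotp xs x.
  have W12 : 1 / 2 <= W (Phi x) by rewrite -VW; exact: weightV_ge.
  have W0 : 0 < W (Phi x) by apply: lt_le_trans W12; lra.
  have h2 := o_dot x.
  have : 0 < W (Phi x) * (htime x / 2 - C) by apply: mulr_gt0 => //; lra.
  have : W (Phi x) * dotp o x <= W (Phi x) * (htime x / 2).
    by apply: ler_wpM2l => //; exact: ltW.
  rewrite VW; lra.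
have [x Fx0] : exists x, F x = 0.
  apply: (@brouwer_zero _ _ F (Rr + 1)) => // x xR.
  have t1 : tau x = 1 by rewrite /tau min_l ?max_r //; lra.
  by rewrite /F t1 subrr scale0r scale1r add0r.
have C0 : 0 < C by lra.
have Rr0 : 0 < Rr.
  have : 2 * C <= Num.max R0 (2 * C) by rewrite le_max lexx orbT.
  rewrite /Rr; lra.
have [xR|xR] := leP `|x| Rr.
  have tau0 : tau x = 0.
    by rewrite /tau max_l // ge_min; apply/orP; right; lra.
  move: Fx0; rewrite /F tau0 subr0 scale1r scale0r addr0 => Gx0.
  have [xL|xL] := leP `|Phi x - s| r.
    have gx : `|g (Phi x) - s| = r.
      rewrite /g addrAC subrr add0r normrZ max_r; last first.
        by rewrite ler_pdivlMr ?mul1r // normr_gt0.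
      by rewrite ger0_norm ?divr_ge0 ?(ltW r0) // divfK // normr_eq0.
    by apply: (o_miss _ gx); apply/eqP; rewrite -subr_eq0; apply/eqP.
  have Cx : 2 * C < htime x.
    rewrite ltNge; apply/negP => xC.
    have := Phi_r x (le_trans (norm_le_htime x) xC); lra.
  have := G_dot x; rewrite Gx0 dotp0l ltxx => h.
  by have := h _ (ltW xL) Cx; rewrite (le_trans xR) ?lerDl // => /(_ isT).
have [PhixL Cx] := Rr_out x (ltW xR).
have xx : 0 < dotp x x.
  rewrite lt_neqAle dotp_ge0 andbT eq_sym; apply/eqP => /dotp_eq0 x0.
  by move: xR; rewrite x0 normr0; lra.
have tau01 : 0 < tau x <= 1.
  rewrite /tau; case: (lerP 1 (`|x| - Rr)) => h; rewrite max_r; lra.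
have := dotp0l x; rewrite -Fx0 /F dotpDl !dotpZl.
case/andP: tau01 => tau0 tau1.
have tx : 0 < tau x * dotp x x by rewrite mulr_gt0.
have [xR1|xR1] := leP `|x| (Rr + 1).
  have : 0 <= (1 - tau x) * dotp (G x) x.
    by rewrite mulr_ge0 ?subr_ge0 // ltW // G_dot // ltW.
  lra.
have -> : tau x = 1 by rewrite /tau min_l ?max_r //; lra.
lra.
Qed.

End CoarseEmbedding.

(** * Isometry groups *)

Section BilinearForm.
Variables (R : realType) (p q : nat).
Implicit Types x y z : 'cV[R]_(p + q).

Lemma bformE x y :
  bform x y = - dotp (usubmx x) (usubmx y) + dotp (dsubmx x) (dsubmx y).
Proof. by rewrite /bform /dotp; congr (- _ + _); apply: eq_bigr => i _; rewrite !mxE. Qed.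

Lemma bformC x y : bform x y = bform y x.
Proof. by rewrite !bformE dotpC (dotpC (dsubmx x)). Qed.

Lemma bformDl x y z : bform (x + y) z = bform x z + bform y z.
Proof. by rewrite !bformE !linearD /= !dotpDl; ring. Qed.

Lemma bformZl a x y : bform (a *: x) y = a * bform x y.
Proof. by rewrite !bformE !linearZ /= !dotpZl; ring. Qed.

Lemma bformDr x y z : bform z (x + y) = bform z x + bform z y.
Proof. by rewrite !(bformC z) bformDl. Qed.

Lemma bformZr a x y : bform x (a *: y) = a * bform x y.
Proof. by rewrite !(bformC x) bformZl. Qed.

Lemma bformNl x y : bform (- x) y = - bform x y.
Proof. by rewrite -scaleN1r bformZl mulN1r. Qed.

Lemma bformNr x y : bform x (- y) = - bform x y.
Proof. by rewrite !(bformC x) bformNl. Qed.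

Definition bform_linE := (bformDl, bformDr, bformNl, bformNr, bformZl, bformZr).

Lemma bform0l x : bform 0 x = 0.
Proof. by rewrite -(scale0r x) bformZl mul0r. Qed.

Lemma bform0r x : bform x 0 = 0.
Proof. by rewrite bformC bform0l. Qed.

Lemma bform_suml (I : Type) (r : seq I) (P : pred I) (F : I -> 'cV[R]_(p + q)) x :
  bform (\sum_(i <- r | P i) F i) x = \sum_(i <- r | P i) bform (F i) x.
Proof.
elim/big_rec2: _ => [|i a b _ <-]; first exact: bform0l.
by rewrite bformDl.
Qed.

Lemma bform_sumr (I : Type) (r : seq I) (P : pred I) (F : I -> 'cV[R]_(p + q)) x :
  bform x (\sum_(i <- r | P i) F i) = \sum_(i <- r | P i) bform x (F i).
Proof. by rewrite bformC bform_suml; apply: eq_bigr => i _; rewrite bformC. Qed.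

Lemma continuous_bform (T : topologicalType) (f g : T -> 'cV[R]_(p + q)) :
  continuous f -> continuous g -> continuous (fun t => bform (f t) (g t)).
Proof.
move=> fc gc; have cc (h : T -> 'cV[R]_(p + q)) i : continuous h -> continuous (fun t => h t i 0).
  move=> hc t; apply: (@continuous_comp _ _ _ h (fun M : 'cV[R]_(p + q) => M i 0)).
    exact: hc.
  exact: coord_continuous.
have -> : (fun t => bform (f t) (g t)) =
    fun t => \sum_(j < q) f t (rshift p j) 0 * g t (rshift p j) 0
             - \sum_(i < p) f t (lshift q i) 0 * g t (lshift q i) 0.
  by apply/funext => t; rewrite /bform addrC.
apply: continuous_sub; apply: continuous_sum => i; apply: continuous_mul; exact: cc.
Qed.

Definition signature (i : 'I_(p + q)) : R := if fintype.split i is inl _ then -1 else 1.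

Lemma signature_sqr i : signature i * signature i = 1.
Proof. by rewrite /signature; case: fintype.split => _; rewrite ?mulrNN mulr1. Qed.

Lemma signature_lshift i : signature (lshift q i) = -1.
Proof. by rewrite /signature (unsplitK (inl i : 'I_p + 'I_q)). Qed.

Lemma signature_rshift i : signature (rshift p i) = 1.
Proof. by rewrite /signature (unsplitK (inr i : 'I_p + 'I_q)). Qed.

Lemma bform_signature x y : bform x y = \sum_i signature i * (x i 0 * y i 0).
Proof.
rewrite /bform big_split_ord /= -sumrN; congr (_ + _); apply: eq_bigr => i _.
  by rewrite signature_lshift mulN1r.
by rewrite signature_rshift mul1r.
Qed.

Lemma bform_delta_l i y : bform (delta_mx i 0) y = signature i * y i 0.
Proof.
rewrite bform_signature (bigD1 i) //= big1 ?addr0 => [|j ji].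
  by rewrite mxE !eqxx mul1r.
by rewrite mxE (negbTE ji) mul0r mulr0.
Qed.

End BilinearForm.

Section Isometries.
Variables (R : realType) (p q : nat).
Implicit Types g h : 'M[R]_(p + q).

(** This is J g^T J for the diagonal matrix J of signs, the inverse of an isometry. Up to signs it
    only permutes entries, hence [norm_invmx]. *)
Definition adjoint g : 'M[R]_(p + q) :=
  \matrix_(i, j) (signature R i * signature R j * g j i).

Lemma adjointK g : isometries R p q g -> adjoint g *m g = 1%:M.
Proof.
move=> gi; apply/matrixP => j k; have := gi (delta_mx j 0) (delta_mx k 0).
rewrite bform_signature bform_delta_l => e; rewrite !mxE.
transitivity (signature R j * (signature R j * (delta_mx k 0 : 'cV[R]_(p + q)) j 0)).
  rewrite -e mulr_sumr; apply: eq_bigr => i _.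
  by rewrite -!colE !mxE !mulrA.
by rewrite mulrA signature_sqr mul1r mxE eqxx andbT.
Qed.

Lemma isometry_unit g : isometries R p q g -> g \in unitmx.
Proof. by move=> /adjointK /mulmx1_unit[]. Qed.

Lemma isometry_invmx g : isometries R p q g -> invmx g = adjoint g.
Proof.
move=> gi; have := adjointK gi => /(congr1 (fun m => m *m invmx g)).
by rewrite mulmxK ?isometry_unit // mul1mx.
Qed.

Lemma isometryV g : isometries R p q g -> isometries R p q (invmx g).
Proof.
move=> gi x y; rewrite -gi !mulmxA mulmxV ?isometry_unit //.
by rewrite !mul1mx.
Qed.

Lemma bform_invmx g x y : isometries R p q g -> bform (invmx g *m x) y = bform x (g *m y).
Proof. by move=> gi; rewrite -gi mulmxA mulmxV ?isometry_unit // mul1mx. Qed.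

Lemma norm_adjoint g : `|adjoint g| <= `|g|.
Proof.
apply: norm_le_coord => // i j; rewrite mxE !normrM.
have sn k : `|signature R k| = 1.
  by rewrite /signature; case: fintype.split => _; rewrite ?normrN1 ?normr1.
by rewrite !sn !mul1r coord_le_norm.
Qed.

Lemma norm_invmx g : isometries R p q g -> `|invmx g| <= `|g|.
Proof. by move=> gi; rewrite isometry_invmx // norm_adjoint. Qed.

End Isometries.

Lemma norm_mulmx (R : realType) m n k (A : 'M[R]_(m, n)) (B : 'M[R]_(n, k)) :
  `|A *m B| <= n%:R * (`|A| * `|B|).
Proof.
apply: norm_le_coord => [|i j]; first by rewrite !mulr_ge0.
rewrite mxE; apply: le_trans (ler_norm_sum _ _ _) _.
apply: (@le_trans _ _ (\sum_(l < n) `|A| * `|B|)).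
  by apply: ler_sum => l _; rewrite normrM ler_pM // coord_le_norm.
by rewrite sumr_const card_ord mulr_natl.
Qed.

Lemma separated_bounded_finite (R : realType) m n (A : set 'M[R]_(m, n)) (M d : R) :
  0 < d -> (forall g, A g -> `|g| <= M) ->
  (forall g h, A g -> A h -> `|g - h| < d -> g = h) -> finite_set A.
Proof.
move=> d0 AM Asep.
pose N := (Num.truncn ((M + M) / d)).+1.
pose key (g : 'M[R]_(m, n)) : {ffun 'I_m * 'I_n -> 'I_N} :=
  [ffun ij => inord (Num.truncn ((g ij.1 ij.2 + M) / d))].
have key_inj g h : A g -> A h -> key g = key h -> g = h.
  move=> Ag Ah /ffunP gh; apply: Asep => //.
  have lt0 i j : `|g i j - h i j| < d.
    have ge k : A k -> 0 <= (k i j + M) / d.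
      move=> /AM kM; rewrite divr_ge0 ?(ltW d0) //.
      have := le_trans (coord_le_norm k i j) kM; rewrite ler_norml; lra.
    have le k : A k -> (Num.truncn ((k i j + M) / d) < N)%N.
      move=> /[dup] Ak /AM kM; rewrite ltnS; apply: le_truncn.
      rewrite ler_pM2r ?invr_gt0 // lerD2r.
      by have := le_trans (coord_le_norm k i j) kM; rewrite ler_norml => /andP[].
    have := gh (i, j); rewrite !ffunE /= => /(congr1 val) /=.
    rewrite !inordK ?le // => /(truncn_eq_dist (ge _ Ag) (ge _ Ah)).
    by rewrite -mulrBl opprD addrACA subrr addr0 normrM (@gtr0_norm _ d^-1) ?invr_gt0 // ltr_pdivrMr // mul1r.
  rewrite /Num.norm /= mx_normrE; apply/bigmax_ltP; split=> // -[i j] _ /=.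
  by rewrite !mxE lt0.
pose inv k := xget 0 [set g | A g /\ key g = k].
apply: (@sub_finite_set _ _ (inv @` setT)); last exact/finite_image/finite_finset.
move=> g Ag; exists (key g) => //; rewrite /inv.
case: xgetP => [h _ [Ah gh]|/(_ g)]; first exact: key_inj.
by case.
Qed.

(** Isolated points could accumulate outside the set. In a group of isometries, isolation of the
    unit separates bounded elements uniformly, because 1 - g^-1 h = g^-1 (g - h) and g^-1 is no
    larger than g. *)
Lemma discrete_bounded_finite (R : realType) p q (G : set 'M[R]_(p + q)) (M : R) :
  G `<=` isometries R p q -> G 1%:M ->
  (forall g h, G g -> G h -> G (g *m h)) -> (forall g, G g -> G (invmx g)) ->
  discrete_subset G -> finite_set [set g | G g /\ `|g| <= M].
Proof.
move=> Giso G1 GM GV Gdisc.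
have [_ [U U1 UG]] := Gdisc _ G1.
have /nbhs_ballP[e /= e0 eU] := U1.
pose K := (p + q)%:R * (`|M| + 1) + 1.
have K0 : 0 < K by rewrite ltr_pwDr // mulr_ge0 // addr_ge0.
apply: (@separated_bounded_finite _ _ _ _ M (e / K)) => [|g []|g h [Gg gM] [Gh hM] gh] //.
  by rewrite divr_gt0.
suff : (U `&` G) (invmx g *m h).
  rewrite UG => /= /(congr1 (mulmx g)).
  by rewrite mulmxA mulmxV ?isometry_unit ?mul1mx ?mulmx1 //; exact: Giso.
split; last by apply: GM => //; exact: GV.
apply: eU; rewrite -ball_normE /=.
have -> : 1%:M - invmx g *m h = invmx g *m (g - h).
  by rewrite mulmxBr mulVmx // isometry_unit //; exact: Giso.
apply: le_lt_trans (norm_mulmx _ _) _.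
apply: (@le_lt_trans _ _ ((p + q)%:R * (`|M| + 1) * `|g - h|)).
  rewrite -mulrA ler_wpM2l // ler_wpM2r //.
  apply: le_trans (norm_invmx (Giso _ Gg)) _; apply: le_trans gM _.
  by rewrite (le_trans (ler_norm M)) // lerDl.
apply: (@le_lt_trans _ _ (K * `|g - h|)); first by rewrite ler_wpM2r // lerDl.
by rewrite mulrC -ltr_pdivlMr.
Qed.

(** The intermediate value theorem on a component; it shows that [SO0] preserves the upper sheet in
    signature (1,n) and the sign of [time_det] in signature (2,n). *)
Lemma component_pos (R : realType) (T : topologicalType) (A : set T) (x : T) (f : T -> R) :
  continuous f -> (forall y, A y -> f y != 0) -> 0 < f x ->
  forall y, connected_component A x y -> 0 < f y.
Proof.
move=> fc f0 fx y xy.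
have /connected_intervalP I : connected (f @` connected_component A x).
  apply: connected_continuous_connected; first exact: component_connected.
  exact: continuous_subspaceT.
have Ax : A x.
  by case: xy => B [Bx BA _] By; exact: BA.
rewrite ltNge; apply/negP => fy.
have [z xz fz] : (f @` connected_component A x) 0.
  apply: (I (f y) (f x)); [by exists y| |by rewrite fy ltW].
  by exists x => //; exact: connected_component_refl.
by have := f0 z (connected_component_sub xz); rewrite fz eqxx.
Qed.

(** * Cocompact lattices in SO(1,n) *)

Section HyperbolicSpace.
Variables (R : realType) (n : nat).
Implicit Types (x y : 'cV[R]_n) (g h : 'M[R]_(1 + n)) (v : 'cV[R]_(1 + n)).

Local Notation i0 := (lshift n (0 : 'I_1)).

Definition hyp_point x : 'cV[R]_(1 + n) := col_mx (const_mx (htime x)) x.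

Lemma bform_hyp_point x y : bform (hyp_point x) (hyp_point y) = - coshd x y.
Proof.
rewrite bformE /hyp_point !col_mxKu !col_mxKd /coshd.
by rewrite {1}/dotp big_ord1 !mxE opprB addrC.
Qed.

Lemma hyp_point0 : hyp_point 0 = delta_mx i0 0.
Proof.
apply/matrixP => i j; rewrite /hyp_point htime0 !mxE ord1 eqxx andbT.
case: splitP => k e; rewrite mxE -val_eqE /= e ?ord1 //.
Qed.

Lemma bform_hyp_point0 v : bform (hyp_point 0) v = - v i0 0.
Proof. by rewrite hyp_point0 bform_delta_l signature_lshift mulN1r. Qed.

Lemma lorentz_row g i : isometries R 1 n g ->
  \sum_(k < n) g i (rshift 1 k) ^+ 2 = signature R i + g i i0 ^+ 2.
Proof.
move=> /adjointK/mulmx1C => /matrixP/(_ i i).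
rewrite !mxE eqxx mulr1n big_split_ord /= big_ord1 !mxE signature_lshift => e.
rewrite -[signature R i]mulr1 -e mulrDr mulr_sumr.
have s2 := @signature_sqr R 1 n i.
have -> : signature R i * (g i i0 * (-1 * signature R i * g i i0)) = - g i i0 ^+ 2.
  transitivity (- (signature R i * signature R i) * g i i0 ^+ 2); first by ring.
  by rewrite s2 mulN1r.
rewrite addrAC addNr add0r; apply: eq_bigr => k _.
rewrite !mxE signature_rshift mul1r.
by transitivity ((signature R i * signature R i) * g i (rshift 1 k) ^+ 2); [rewrite s2 mul1r|ring].
Qed.

Lemma lorentz_col g i : isometries R 1 n g ->
  \sum_(k < n) g (rshift 1 k) i ^+ 2 = signature R i + g i0 i ^+ 2.
Proof.
move=> gi; have := @lorentz_row (adjoint g) i; rewrite -isometry_invmx // => /(_ (isometryV gi)).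
have sq j k : (adjoint g) j k ^+ 2 = g k j ^+ 2.
  rewrite mxE !exprMn !(expr2 (signature _ _)) !signature_sqr !mul1r.
  by [].
rewrite isometry_invmx // sq => <-.
by apply: eq_bigr => k _; rewrite sq.
Qed.

(** Columns give g_k0^2 <= g_00^2 - 1 for k <> 0, and then rows give g_kl^2 <= 1 + g_k0^2 <= g_00^2.
    As g_00 is, up to sign, the cosh of the displacement of the base point, bounded displacement
    means bounded matrix. *)
Lemma lorentz_entry_le g i j : isometries R 1 n g -> `|g i j| <= `|g i0 i0|.
Proof.
move=> gi; rewrite -(@ler_pXn2r _ 2) ?nnegrE // !real_normK ?num_real //.
have i0_le (k : 'I_(1 + n)) : g k i0 ^+ 2 <= g i0 i0 ^+ 2 /\ (k != i0 -> g k i0 ^+ 2 <= g i0 i0 ^+ 2 - 1).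
  rewrite -(splitK k); case: (fintype.split k) => l /=.
    by rewrite ord1; split=> // /eqP[].
  suff : g (rshift 1 l) i0 ^+ 2 <= g i0 i0 ^+ 2 - 1 by split=> //; lra.
  have := lorentz_col i0 gi; rewrite signature_lshift (bigD1 l) //= => e.
  have : 0 <= \sum_(i < n | i != l) g (rshift 1 i) i0 ^+ 2 by apply: sumr_ge0 => ? _; exact: sqr_ge0.
  lra.
rewrite -(splitK j); case: (fintype.split j) => l /=; first by rewrite ord1; case: (i0_le i).
have := lorentz_row i gi; rewrite (bigD1 l) //= => e.
have : 0 <= \sum_(k < n | k != l) g i (rshift 1 k) ^+ 2 by apply: sumr_ge0 => ? _; exact: sqr_ge0.
have [ii0|ii0] := eqVneq i i0.
  by move: e; rewrite ii0 signature_lshift; lra.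
have [_ /(_ ii0)] := i0_le i.
have : signature R i <= 1 by rewrite /signature; case: fintype.split => _; lra.
lra.
Qed.

Lemma SO0_isometry p q (g : 'M[R]_(p + q)) : SO0 R p q g -> isometries R p q g.
Proof. exact: connected_component_sub. Qed.

Lemma hyp_pointP v : bform v v = -1 -> 0 < v i0 0 -> v = hyp_point (dsubmx v).
Proof.
move=> vv v0; rewrite -[LHS]vsubmxK /hyp_point; congr col_mx.
apply/matrixP => i j; rewrite !ord1 !mxE.
have := vv; rewrite bformE {1}/dotp big_ord1 !mxE => e.
by rewrite /htime (_ : 1 + _ = v i0 0 ^+ 2) ?sqrtr_sqr ?gtr0_norm //; lra.
Qed.

Lemma SO0_forward g x : SO0 R 1 n g -> exists y, g *m hyp_point x = hyp_point y.
Proof.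
move=> gS; exists (dsubmx (g *m hyp_point x)).
have norm1 h : isometries R 1 n h -> bform (h *m hyp_point x) (h *m hyp_point x) = -1.
  by move=> hi; rewrite hi bform_hyp_point coshdxx.
apply: hyp_pointP; first exact/norm1/SO0_isometry.
apply: (@component_pos R _ (isometries R 1 n) 1%:M (fun h => (h *m hyp_point x) i0 0)) gS.
- have -> : (fun h => (h *m hyp_point x) i0 0) = (fun h => \sum_k h i0 k * hyp_point x k 0).
    by apply/funext => h; rewrite mxE.
  apply: continuous_sum => k; apply: continuous_mul; last exact: continuous_cst.
  exact: coord_continuous.
- move=> h /norm1; rewrite bformE {1}/dotp big_ord1 mxE => e; apply/eqP => h0.
  by move: e; rewrite h0 mul0r oppr0 add0r => e; have := dotp_ge0 (dsubmx (h *m hyp_point x)); rewrite e; lra.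
- by rewrite mul1mx /hyp_point col_mxEu mxE htime_gt0.
Qed.

(** The hyperbolic translation taking the base point to the point above [x]. The factor
    [(1 + htime x)^-1] is ([htime x] - 1) / |x|^2 in a form that makes sense at 0. *)
Definition boost x : 'M[R]_(1 + n) :=
  block_mx (const_mx (htime x)) x^T x (1%:M + (1 + htime x)^-1 *: (x *m x^T)).

Lemma trmx_dotp x y : x^T *m y = (dotp x y)%:M.
Proof.
apply/matrixP => i j; rewrite !ord1 !mxE eqxx mulr1n.
by apply: eq_bigr => k _; rewrite mxE.
Qed.

Lemma boostE x v : boost x *m v =
  col_mx (const_mx (htime x * v i0 0 + dotp x (dsubmx v)))
    ((v i0 0) *: x + dsubmx v + ((1 + htime x)^-1 * dotp x (dsubmx v)) *: x).
Proof.
rewrite -[v in LHS]vsubmxK /boost mul_block_col; congr col_mx.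
  apply/matrixP => i j; rewrite !ord1 [LHS]mxE trmx_dotp !mxE big_ord1 !mxE eqxx mulr1n.
  by [].
rewrite mulmxDl mul1mx -scalemxAl -mulmxA trmx_dotp mul_mx_scalar scalerA -addrA.
congr (_ + _).
have -> : usubmx v = (v i0 0)%:M by apply/matrixP => i j; rewrite !ord1 !mxE eqxx mulr1n.
by rewrite mul_mx_scalar.
Qed.

Lemma boost_isometry x : isometries R 1 n (boost x).
Proof.
move=> v w; rewrite [LHS]bformE !boostE !col_mxKu !col_mxKd bformE.
set a := v i0 0; set b := w i0 0; set u := dsubmx v; set z := dsubmx w.
have -> : dotp (usubmx v) (usubmx w) = a * b by rewrite /dotp big_ord1 !mxE.
rewrite {1}/dotp big_ord1 !mxE !dotpE (dotpC u x).
have -> : dotp x x = htime x ^+ 2 - 1 by rewrite sqr_htime; ring.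
have h0 : 1 + htime x != 0 by rewrite gt_eqF // addr_gt0 // htime_gt0.
by field.
Qed.

Lemma boost_hyp_point0 x : boost x *m hyp_point 0 = hyp_point x.
Proof.
rewrite boostE {1 3}/hyp_point !col_mxEu !col_mxKd !mxE htime0 dotpC dotp0l.
by rewrite mulr1 !addr0 mulr0 scale0r scale1r addr0.
Qed.

Lemma boost0 : boost 0 = 1%:M.
Proof.
rewrite /boost trmx0 mul0mx scaler0 addr0 htime0 [RHS]scalar_mx_block.
by congr block_mx; apply/matrixP => i j; rewrite !ord1 !mxE eqxx.
Qed.

Lemma boost_SO0 x : SO0 R 1 n (boost x).
Proof.
exists ((fun t : R => boost (t *: x)) @` `[0, 1]); last first.
  by exists 1; rewrite ?scale1r //= in_itv /= ler01 lexx.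
split.
- by exists 0; rewrite ?scale0r ?boost0 //= in_itv /= ler01 lexx.
- by move=> _ [t _ <-]; exact: boost_isometry.
apply: connected_continuous_connected; first exact: segment_connected.
apply: continuous_subspaceT.
have tx : continuous (fun t : R => t *: x).
  by apply: continuous_scale; [move=> ?; exact: cvg_id|exact: continuous_cst].
have txc i : continuous (fun t : R => (t *: x) i 0).
  move=> t; apply: (@continuous_comp _ _ _ (fun t : R => t *: x) (fun M : 'cV[R]_n => M i 0)).
    exact: tx.
  exact: coord_continuous.
have hc : continuous (fun t : R => htime (t *: x)) by exact: continuous_htime.
have eq_cont (f g : R -> R) : continuous f -> f =1 g -> continuous g.
  by move=> fc /funext <-.
apply: mx_continuous => i j.
rewrite -(splitK i) -(splitK j) /boost.
case: (fintype.split i) => k; case: (fintype.split j) => l /=.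
- by apply: (eq_cont _ _ hc) => t; rewrite block_mxEul mxE.
- by apply: (eq_cont _ _ (txc l)) => t; rewrite block_mxEur !ord1 [RHS]mxE.
- by apply: (eq_cont _ _ (txc k)) => t; rewrite block_mxEdl !ord1.
apply: (eq_cont (fun t => (1%:M : 'M[R]_n) k l + (1 + htime (t *: x))^-1 * ((t *: x) k 0 * (t *: x) l 0))); last first.
  move=> t; rewrite block_mxEdr [RHS]mxE; congr (_ + _).
  rewrite [RHS]mxE; congr (_ * _); rewrite [RHS]mxE big_ord1; congr (_ * _).
  by rewrite [RHS]mxE.
apply: continuous_add; first exact: continuous_cst.
apply: continuous_mul.
  apply: continuous_inv => [t|]; first by rewrite gt_eqF // addr_gt0 // htime_gt0.
  by apply: continuous_add; [exact: continuous_cst|exact: hc].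
by apply: continuous_mul; exact: txc.
Qed.

Section CocompactLattice.
Variable Gamma : set 'M[R]_(1 + n).
Hypothesis lattice : cocompact_lattice 1 n Gamma.

Lemma lattice_isometry g : Gamma g -> isometries R 1 n g.
Proof. by case: lattice => -[GS _ _ _] _ _ /GS/SO0_isometry. Qed.

Lemma lattice_finite (M : R) :
  finite_set [set g | Gamma g /\ - bform (hyp_point 0) (g *m hyp_point 0) <= M].
Proof.
case: (lattice) => -[GS G1 GM GV] Gd _.
apply: (sub_finite_set _ (@discrete_bounded_finite R 1 n Gamma M _ _ _ _ _)) => //.
  move=> g [Gg gM]; split=> //; move: gM.
  have [y gy] := SO0_forward 0 (GS _ Gg).
  have : 0 < g i0 i0.
    have : (g *m hyp_point 0) i0 0 = g i0 i0 by rewrite hyp_point0 -colE mxE.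
    by rewrite gy /hyp_point col_mxEu mxE => <-; exact: htime_gt0.
  move=> g0; rewrite bform_hyp_point0 opprK hyp_point0 -colE mxE => gM.
  apply: norm_le_coord => [|i j]; first by rewrite (le_trans _ gM) // ltW.
  apply: le_trans (lorentz_entry_le _ _ (lattice_isometry Gg)) _.
  by rewrite gtr0_norm.
by move=> g Gg; exact: lattice_isometry.
Qed.

(** The cosets with a representative whose top-left entry is below [T] form an open set; these sets
    exhaust the compact quotient, so one of them is everything. For the coset of a boost, that entry
    is the cosh of the distance from the point above [x] to an orbit point. *)
Lemma lattice_cocompact :
  exists T : R, forall x, exists g, Gamma g /\ - bform (hyp_point x) (g *m hyp_point 0) < T.
Proof.
case: (lattice) => -[GS G1 GM GV] Gd cpt.
pose Q := orbit_space 1 n Gamma.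
pose orb (g : SO0 R 1 n) := [set h *m \val g | h in Gamma].
pose P (T : R) (q : Q) := exists2 m, orb (generic_quotient.repr q) m & m i0 i0 < T.
have orb_repr (g : SO0 R 1 n) : orb (generic_quotient.repr (\pi_Q g)%qT) = orb g.
  have : (\pi_Q (generic_quotient.repr (\pi_Q g)) = \pi_Q g :> Q)%qT by rewrite reprK.
  by move=> /eqmodP/asboolP.
have : \forall T \near +oo, [set: Q] `<=` P T.
  move/compact_near_coveringP : cpt; apply => q _.
  pose T0 := (\val (generic_quotient.repr q) : 'M[R]_(1 + n)) i0 i0 + 1.
  have PT0 : P T0 q.
    by exists (\val (generic_quotient.repr q)); [exists 1%:M => //; rewrite mul1mx|rewrite /T0 ltrDl].
  have Popen : open (P T0).
    rewrite /open /= /quotient_open.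
    have -> : \pi_Q%qT @^-1` (P T0) = \bigcup_(h in Gamma) [set g : SO0 R 1 n | 0 < T0 - (h *m \val g) i0 i0].
      apply/seteqP; split=> g /=.
        by rewrite /P orb_repr => -[_ [h Gh <-]] lt; exists h => //=; rewrite subr_gt0.
      by move=> [h Gh /=]; rewrite subr_gt0 => lt; rewrite /P orb_repr; exists (h *m \val g) => //; exists h.
    apply: bigcup_open => h Gh.
    apply: (@open_comp _ _ (fun g : SO0 R 1 n => T0 - (h *m \val g) i0 i0) [set z | 0 < z]); last exact: open_gt.
    move=> g _; move: g; apply: continuous_sub; first exact: continuous_cst.
    have -> : (fun g : SO0 R 1 n => (h *m \val g) i0 i0) = (fun g : SO0 R 1 n => \sum_k h i0 k * (\val g : 'M[R]_(1 + n)) k i0).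
      by apply/funext => g; rewrite mxE.
    apply: continuous_sum => k; apply: continuous_mul; first exact: continuous_cst.
    move=> g; apply: (@continuous_comp _ _ _ (fun g : SO0 R 1 n => \val g : 'M[R]_(1 + n)) (fun M : 'M[R]_(1 + n) => M k i0)).
      exact: initial_continuous.
    exact: coord_continuous.
  near=> q' T.
  have Pq' : P T0 q' by near: q'; apply: open_nbhs_nbhs.
  have T0T : T0 <= T by near: T; apply: nbhs_pinfty_ge; exact: num_real.
  by case: Pq' => m om mT0; exists m => //; exact: lt_le_trans T0T.
move=> /filter_ex[T TP]; exists T => x.
pose b : SO0 R 1 n := SigSub (mem_set (boost_SO0 x)).
have := TP (\pi_Q b)%qT I; rewrite /P orb_repr => -[_ [h Gh <-]] lt.
exists (invmx h); split; first exact: GV.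
rewrite bformC bform_invmx; last exact: lattice_isometry.
rewrite bform_hyp_point0 opprK -boost_hyp_point0 mulmxA hyp_point0 -colE mxE.
exact: lt.
Unshelve. all: by end_near. Qed.

End CocompactLattice.
End HyperbolicSpace.

(** * The sphere of rays *)

Section RaySphereTheory.
Variables (R : realType) (m : nat).
Implicit Types (s : ray_sphere R m) (u v w : 'cV[R]_m) (A : set (ray_sphere R m)).

Definition nonzero_vector v (v0 : v != 0) : nonzero_vectors R m :=
  SigSub (@mem_set _ (nonzero_vectors R m) v v0).

Lemma open_ray_id v : open_ray v v.
Proof. by exists 1; rewrite ?scale1r //=. Qed.

Lemma open_ray_eq v w : open_ray v w -> open_ray v = open_ray w.
Proof.
move=> [t /= t0 <-]; apply/seteqP; split=> [_ [r /= r0 <-]|_ [r /= r0 <-]].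
  by exists (r / t); rewrite /= ?divr_gt0 // scalerA divfK // gt_eqF.
by exists (r * t); rewrite /= ?mulr_gt0 // scalerA.
Qed.

Lemma vectors_on_neq0 s v : vectors_on s v -> v != 0.
Proof.
move=> [t /= t0 <-]; rewrite scaler_eq0 negb_or gt_eqF //=.
exact: (set_valP (generic_quotient.repr s)).
Qed.

Lemma vectors_on_eq s v : vectors_on s v -> vectors_on s = open_ray v.
Proof. exact: open_ray_eq. Qed.

Lemma vectors_on_pi (v : nonzero_vectors R m) :
  vectors_on (\pi_(ray_sphere R m) v)%qT = open_ray (\val v).
Proof.
have : (\pi_(ray_sphere R m) (generic_quotient.repr (\pi_(ray_sphere R m) v)) =
        \pi_(ray_sphere R m) v)%qT by rewrite reprK.
by move=> /eqmodP/asboolP.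
Qed.

Lemma vectors_onI s s' v : vectors_on s v -> vectors_on s' v -> s = s'.
Proof.
move=> sv s'v; rewrite -[s]reprK -[s']reprK; apply/eqmodP/asboolP.
by rewrite -/(vectors_on s) -/(vectors_on s') (vectors_on_eq sv) (vectors_on_eq s'v).
Qed.

Lemma vectors_on_ex v : v != 0 -> exists s, vectors_on s v.
Proof.
move=> v0; exists (\pi_(ray_sphere R m) (nonzero_vector v0))%qT.
by rewrite vectors_on_pi; exact: open_ray_id.
Qed.

Lemma ray_vector s : exists v, vectors_on s v.
Proof. by exists (\val (generic_quotient.repr s)); exact: open_ray_id. Qed.

Lemma vectors_onZ s v t : vectors_on s v -> 0 < t -> vectors_on s (t *: v).
Proof. by move=> sv t0; rewrite (vectors_on_eq sv); exists t. Qed.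

Lemma vectors_onP s v w : vectors_on s v -> vectors_on s w ->
  exists2 t, 0 < t & w = t *: v.
Proof. by move=> sv; rewrite (vectors_on_eq sv) => -[t /= t0 <-]; exists t. Qed.

Lemma coneP A s v : vectors_on s v -> cone A v <-> A s.
Proof.
move=> sv; split=> [[s' As' s'v]|As]; last by exists s.
by rewrite (vectors_onI sv s'v).
Qed.

Lemma cone_neq0 A v : cone A v -> v != 0.
Proof. by move=> [s _ /vectors_on_neq0]. Qed.

Lemma coneZ A v t : cone A v -> 0 < t -> cone A (t *: v).
Proof. by move=> [s As sv] t0; exists s => //; exact: vectors_onZ. Qed.

Lemma cone_rays (V : set 'cV[R]_m) v :
  cone (rays V) v <-> v != 0 /\ exists t, 0 < t /\ V (t *: v).
Proof.
split=> [[s [w Vw sw] sv]|[v0 [t [t0 Vtv]]]].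
  split; first exact: vectors_on_neq0 sv.
  by have [t t0 wE] := vectors_onP sv sw; exists t; rewrite -wE.
have [s sv] := vectors_on_ex v0; exists s => //; exists (t *: v) => //.
exact: vectors_onZ.
Qed.

Lemma cone_ray_image (g : 'M[R]_m) A v : g \in unitmx ->
  cone (ray_image g A) v <-> cone A (invmx g *m v).
Proof.
move=> gu; rewrite cone_rays; split=> [[v0 [t [t0 [w Aw gw]]]]|Agv].
  have -> : invmx g *m v = t^-1 *: w.
    rewrite -[w](mulKmx gu) gw -scalemxAr scalerA mulVf ?scale1r //.
    by rewrite gt_eqF.
  by apply: coneZ; rewrite ?invr_gt0.
split.
  by apply: contraNneq (cone_neq0 Agv) => ->; rewrite mulmx0.
by exists 1; split=> //; rewrite scale1r; exists (invmx g *m v) => //; rewrite mulKVmx.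
Qed.

(** [ray_sphere] is a quotient of the subspace of nonzero vectors; compactness passes to that
    subspace because [Z] avoids 0. *)
Lemma compact_rays (Z : set 'cV[R]_m) : compact Z -> (forall v, Z v -> v != 0) ->
  compact (rays Z).
Proof.
move=> Zc Z0.
have Zc' : compact [set u : nonzero_vectors R m | Z (\val u)].
  move=> F FF FZ.
  have [z [Zz clz]] := Zc (set_val @ F) _ FZ.
  exists (nonzero_vector (Z0 _ Zz)); split=> // A B FA [C [[D Do <-] /= Dz DB]].
  have /(_ (set_val @` A) D) [] := clz.
  - by apply: (@filterS _ F _ A) => // u Au; exists u.
  - by apply: open_nbhs_nbhs; split.
  by move=> _ [[u Au <-] Du]; exists u; split=> //; exact: DB.
have -> : rays Z = \pi_(ray_sphere R m)%qT @` [set u : nonzero_vectors R m | Z (\val u)].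
  apply/seteqP; split=> [s [v Zv sv]|_ [u Zu <-]].
    exists (nonzero_vector (Z0 _ Zv)) => //.
    by apply: (@vectors_onI _ _ v) => //; rewrite vectors_on_pi; exact: open_ray_id.
  by exists (\val u) => //; rewrite vectors_on_pi; exact: open_ray_id.
apply: continuous_compact => //; apply: continuous_subspaceT.
exact: pi_continuous.
Qed.

Lemma open_rays_near (U : set (ray_sphere R m)) s v : open U -> U s -> vectors_on s v ->
  \forall w \near v, cone U w.
Proof.
move=> Uo Us sv.
have v0 := vectors_on_neq0 sv.
have [D Do DU] : open (\pi_(ray_sphere R m)%qT @^-1` U) by exact: Uo.
pose v' := nonzero_vector v0.
have Uw (u : nonzero_vectors R m) : D (\val u) <-> cone U (\val u).
  have uu : vectors_on (\pi_(ray_sphere R m) u)%qT (\val u) by rewrite vectors_on_pi; exact: open_ray_id.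
  by rewrite (coneP _ uu) -[D _]/((set_val @^-1` D) u) DU.
have Dv : D v by apply/(Uw v'); exists s.
have : \forall w \near v, w != 0.
  have := @near_positive R _ (fun w : 'cV[R]_m => `|w|) v (@norm_continuous _ _).
  by rewrite normr_gt0 => /(_ v0); apply: filterS => w; rewrite normr_gt0.
have : nbhs v D by apply: open_nbhs_nbhs.
apply: filterS2 => w Dw w0.
exact: (proj1 (Uw (nonzero_vector w0))).
Qed.

End RaySphereTheory.

(** * Cones over acausal spheres *)

Lemma compact_positive_bound (R : realType) (T : topologicalType) (A : set T) (f : T -> R) :
  compact A -> continuous f -> (forall x, A x -> 0 < f x) ->
  exists2 c, 0 < c & forall x, A x -> c <= f x.
Proof.
move=> /compact_near_coveringP Ac fc f0.
have : \forall c \near 0^'+, A `<=` (fun c x => c <= f x) c.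
  apply: Ac => x Ax.
  have fx2 : 0 < f x / 2 by rewrite divr_gt0 // f0.
  have near_x : \forall y \near x, 0 < f y - f x / 2.
    apply: (@near_positive _ _ (fun y => f y - f x / 2)); last by lra.
    by apply: continuous_sub => //; exact: continuous_cst.
  near=> y c.
  have h1 : 0 < f y - f x / 2 by near: y.
  have h2 : c < f x / 2 by near: c; exact: nbhs_right_lt.
  rewrite /=; lra.
by move=> /(filterI (nbhs_right_gt _)) /filter_ex[c [c0 cP]]; exists c.
Unshelve. all: by end_near. Qed.

(** * The convex cone spanned by a compact set of null vectors *)

Section NullCone.
Variables (R : realType) (p q : nat) (L CL : set 'cV[R]_(p + q)).
Local Notation V := 'cV[R]_(p + q).
Implicit Types (v w x l : V) (s : seq V).

Hypothesis L_compact : compact L.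
Hypothesis CLE : forall v, CL v <-> exists t l, [/\ 0 < t, L l & v = t *: l].
Hypothesis L_null : forall l, L l -> bform l l = 0.
Hypothesis L_neg : forall l l', L l -> L l' -> l <> l' -> bform l l' < 0.

Lemma CLZ t v : 0 < t -> CL v -> CL (t *: v).
Proof.
move=> t0 /CLE[r [l [r0 Ll ->]]]; apply/CLE; exists (t * r), l.
by rewrite mulr_gt0 // scalerA.
Qed.

Lemma CL_null v : CL v -> bform v v = 0.
Proof. by move=> /CLE[t [l [_ /L_null l0 ->]]]; rewrite bformZl bformZr l0 !mulr0. Qed.

Lemma CL_le0 v w : CL v -> CL w -> bform v w <= 0.
Proof.
move=> /CLE[t [l [t0 Ll ->]]] /CLE[r [l' [r0 Ll' ->]]].
rewrite bformZl bformZr !pmulr_rle0 //.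
have [->|/eqP ll'] := eqVneq l l'; first by rewrite L_null.
exact: ltW (L_neg _ _ _).
Qed.

Lemma CL_orthogonal v w : CL v -> CL w -> bform v w = 0 -> exists2 t, 0 < t & w = t *: v.
Proof.
move=> /CLE[t [l [t0 Ll ->]]] /CLE[r [l' [r0 Ll' ->]]] /eqP.
rewrite bformZl bformZr !mulf_eq0 (gt_eqF t0) (gt_eqF r0) /= => /eqP ll'.
exists (r / t); first by rewrite divr_gt0.
have [->|/eqP neq] := eqVneq l l'; first by rewrite scalerA divfK // gt_eqF.
by have := L_neg Ll Ll' neq; rewrite ll' ltxx.
Qed.

(** [CL] is stable under positive scaling, so coefficients are absorbed in the summands; the empty
    sum contributes 0. *)
Definition hull : set V :=
  [set v | exists2 s, (forall x, x \in s -> CL x) & v = \sum_(x <- s) x].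

Lemma hull0 : hull 0.
Proof. by exists [::] => //; rewrite big_nil. Qed.

Lemma hullD v w : hull v -> hull w -> hull (v + w).
Proof.
move=> [s sC ->] [s' s'C ->]; exists (s ++ s'); last by rewrite big_cat.
by move=> x; rewrite mem_cat => /orP[/sC|/s'C].
Qed.

Lemma CL_hull v : CL v -> hull v.
Proof.
move=> Cv; exists [:: v]; last by rewrite big_seq1.
by move=> x; rewrite inE => /eqP ->.
Qed.

Lemma hull_ind (P : V -> Prop) : P 0 ->
  (forall x v, CL x -> hull v -> P v -> P (x + v)) -> forall v, hull v -> P v.
Proof.
move=> P0 PD v [s + ->]; elim: s => [_|x s IH sC]; first by rewrite big_nil.
have sC' y : y \in s -> CL y by move=> ys; apply: sC; rewrite inE ys orbT.
rewrite big_cons; apply: PD; last exact: IH.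
  by apply: sC; rewrite inE eqxx.
by exists s.
Qed.

Lemma hullZ t v : 0 <= t -> hull v -> hull (t *: v).
Proof.
rewrite le_eqVlt => /predU1P[<- _|t0]; first by rewrite scale0r; exact: hull0.
move: v; apply: hull_ind => [|x v Cx _ hv]; first by rewrite scaler0; exact: hull0.
by rewrite scalerDr; apply: hullD => //; apply/CL_hull/CLZ.
Qed.

Lemma hull_sum (I : Type) (r : seq I) (a : I -> R) (F : I -> V) :
  (forall i, 0 <= a i) -> (forall i, hull (F i)) -> hull (\sum_(i <- r) a i *: F i).
Proof.
move=> a0 Fh; elim: r => [|i r IH]; first by rewrite big_nil; exact: hull0.
by rewrite big_cons; apply: hullD => //; exact: hullZ.
Qed.

Lemma hull_CL_le0 v l : hull v -> CL l -> bform v l <= 0.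
Proof.
move=> + Cl; move: v; apply: hull_ind => [|x v Cx _ hv]; first by rewrite bform0l.
by have := CL_le0 Cx Cl; rewrite bformDl; lra.
Qed.

Lemma hull_le0 v w : hull v -> hull w -> bform v w <= 0.
Proof.
move=> hv; move: w; apply: hull_ind => [|x w Cx _ hw]; first by rewrite bform0r.
by have := hull_CL_le0 hv Cx; rewrite bformDr; lra.
Qed.

(** All summands pair nonpositively with [l], so a zero total makes each of them orthogonal to [l],
    hence by acausality a multiple of it. *)
Lemma hull_orthogonal v l : hull v -> CL l -> bform v l = 0 -> exists2 t, 0 <= t & v = t *: l.
Proof.
move=> + Cl; move: v; apply: hull_ind => [_|x v Cx hv IH].
  by exists 0; rewrite ?scale0r.
rewrite bformDl => e.
have xl : bform x l <= 0 by exact: CL_le0.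
have vl : bform v l <= 0 by exact: hull_CL_le0.
have [t t0 ->] : exists2 t, 0 <= t & v = t *: l by apply: IH; lra.
have [r r0 ->] : exists2 r, 0 < r & x = r *: l.
  by apply: CL_orthogonal => //; rewrite bformC; lra.
by exists (r + t); rewrite ?addr_ge0 ?(ltW r0) // scalerDl.
Qed.

(** Split off a summand [x]: the products of [v] with [x] and with the rest are nonpositive and add
    up to 0, so [v] is orthogonal to [x] and therefore proportional to it. *)
Lemma hull_null v : hull v -> bform v v = 0 -> v = 0 \/ CL v.
Proof.
move=> [[_ ->|x s sC ->]]; first by rewrite big_nil; left.
rewrite big_cons; set w := \sum_(y <- s) y.
have Cx : CL x by apply: sC; rewrite inE eqxx.
have hw : hull w by exists s => // y ys; apply: sC; rewrite inE ys orbT.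
have hv : hull (x + w) by apply: hullD => //; exact: CL_hull.
have le1 := hull_CL_le0 hv Cx; have le2 := hull_le0 hv hw.
rewrite bformDr => e.
have [|t] := hull_orthogonal hv Cx; first by lra.
rewrite le_eqVlt => /predU1P[<- ->|t0 ->]; first by left; rewrite scale0r.
by right; exact: CLZ.
Qed.

(** The condition defining [E], freed from the normalisation of [x]. *)
Definition faces_cone x := forall l, CL l -> bform x l < 0.

Lemma hull_faces_cone v : hull v -> bform v v < 0 -> faces_cone v.
Proof.
move=> hv vv l Cl; rewrite lt_neqAle hull_CL_le0 // andbT; apply/eqP => vl.
have [t _ ve] := hull_orthogonal hv Cl vl.
by move: vv; rewrite ve bformZl bformZr CL_null // !mulr0 ltxx.
Qed.

Lemma L_CL l : L l -> CL l.
Proof. by move=> Ll; apply/CLE; exists 1, l; rewrite scale1r. Qed.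

Lemma faces_cone_bound x : faces_cone x ->
  exists2 c, 0 < c & forall l, L l -> c <= - bform x l.
Proof.
move=> xf; apply: (compact_positive_bound L_compact); last first.
  by move=> l /L_CL /xf; rewrite oppr_gt0.
have -> : (fun l => - bform x l) = (fun l => bform (- x) l).
  by apply/funext => l; rewrite bformNl.
by apply: continuous_bform; [exact: continuous_cst|move=> ?; exact: cvg_id].
Qed.

(** On the compact [L] the product with [x] stays away from 0, and the estimate passes to sums
    because the norm is subadditive. All properness arguments rest on it. *)
Lemma faces_cone_hull x : faces_cone x ->
  exists2 c, 0 < c & forall v, hull v -> c * `|v| <= - bform x v.
Proof.
move=> /faces_cone_bound[c c0 cL].
have [M [_ LM]] := compact_bounded L_compact.
pose B := `|M| + 1.
have B0 : 0 < B by rewrite ltr_pwDr.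
have LB l : L l -> `|l| <= B by apply: LM; rewrite /B; have := ler_norm M; lra.
exists (c / B); first by rewrite divr_gt0.
apply: hull_ind => [|y v Cy _ hv]; first by rewrite normr0 mulr0 bform0r oppr0.
rewrite bformDr opprD; apply: le_trans (ler_wpM2l _ (ler_normD _ _)) _.
  by rewrite divr_ge0 // ltW.
rewrite mulrDr lerD //; case/CLE: Cy => t [l [t0 Ll ->]].
rewrite bformZr normrZ (gtr0_norm t0) mulrCA -mulrN ler_pM2l //.
apply: le_trans (cL _ Ll); rewrite -mulrA ler_piMr ?(ltW c0) //.
by rewrite mulrC ler_pdivrMr // mul1r LB.
Qed.

Lemma bform_le_norm x v : `|bform x v| <= (p + q)%:R * (`|x| * `|v|).
Proof.
rewrite bform_signature; apply: le_trans (ler_norm_sum _ _ _) _.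
apply: (@le_trans _ _ (\sum_(i < p + q) `|x| * `|v|)).
  apply: ler_sum => i _; rewrite !normrM.
  have -> : `|signature R i| = 1.
    by rewrite /signature; case: fintype.split => _; rewrite ?normrN1 ?normr1.
  by rewrite mul1r ler_pM // coord_le_norm.
by rewrite sumr_const card_ord mulr_natl.
Qed.

(* Caratheodory: a linear relation between the summands lets one of them be absorbed
   in the others. *)
Lemma hull_caratheodory v : hull v ->
  exists s, [/\ (forall x, x \in s -> CL x), (size s <= p + q)%N & v = \sum_(x <- s) x].
Proof.
move=> [s sC ->]; have [k] := ubnP (size s); elim: k s sC => // k IH s sC sk.
have [sz|sz] := leqP (size s) (p + q); first by exists s.
pose S : 'M[R]_(size s, p + q) := \matrix_(i, j) (nth 0 s i) j 0.
have : kermx S != 0.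
  rewrite kermx_eq0 /row_free; apply: contraTneq sz => <-.
  by rewrite -leqNgt rank_leq_col.
case/rowV0Pn => a0 /sub_kermxP a0S a0_neq.
have [a [i1 ai1] aS] : exists2 a : 'rV[R]_(size s), (exists i, 0 < a 0 i) & a *m S = 0.
  have [i ai] : exists i, a0 0 i != 0.
    by apply/existsP; apply: contraNT a0_neq => /existsPn h; apply/eqP/rowP => i; rewrite mxE; apply/eqP; have := h i; rewrite negbK.
  have [ai0|ai0] := ltP 0 (a0 0 i); first by exists a0 => //; exists i.
  exists (- a0); last by rewrite mulNmx a0S oppr0.
  by exists i; rewrite mxE oppr_gt0 lt_neqAle ai ai0.
have rel : \sum_i a 0 i *: nth 0 s i = 0 :> V.
  apply/colP => j; rewrite summxE mxE; have := congr1 (fun M : 'rV[R]_(p + q) => M 0 j) aS.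
  by rewrite !mxE; apply: etrans; apply: eq_bigr => i _; rewrite !mxE.
have [i0 ai0 i0_min] : exists2 i0, 0 < a 0 i0 & forall i, 0 < a 0 i -> a 0 i <= a 0 i0.
  have := @arg_maxP _ _ _ i1 (fun i => 0 < a 0 i) (fun i => a 0 i) ai1.
  by case=> i0 ai0 h; exists i0.
pose c i := 1 - a 0 i / a 0 i0.
have c_ge0 i : 0 <= c i.
  rewrite subr_ge0 ler_pdivrMr // mul1r.
  have [/i0_min //|ai] := ltP 0 (a 0 i).
  exact: le_trans ai (ltW ai0).
have c_sum : \sum_(x <- s) x = \sum_i c i *: nth 0 s i.
  rewrite (big_nth 0) big_mkord.
  under [RHS]eq_bigr do rewrite scalerBl scale1r mulrC -scalerA.
  by rewrite sumrB -scaler_sumr rel scaler0 subr0.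
pose s' := [seq c i *: nth 0 s i | i <- enum 'I_(size s) & c i != 0].
have s'C x : x \in s' -> CL x.
  move=> /mapP[i]; rewrite mem_filter => /andP[ci _] ->.
  by apply: CLZ; [rewrite lt_neqAle eq_sym ci c_ge0|apply/sC/mem_nth].
have s'sum : \sum_(x <- s) x = \sum_(x <- s') x.
  rewrite c_sum big_map big_filter [RHS]big_mkcond /= [RHS]big_enum /=; apply: eq_bigr => i _.
  by case: eqVneq => [->|//]; rewrite scale0r.
rewrite s'sum; apply: IH => //; rewrite -ltnS; apply: leq_ltn_trans sk.
rewrite size_map size_filter.
rewrite -[X in (_ < X)%N](size_enum_ord (size s)).
rewrite -(count_predC (fun i => c i != 0) (enum 'I_(size s))) -[X in (X < _)%N]addn0 ltn_add2l.
rewrite -has_count; apply/hasP; exists i0; rewrite ?mem_enum //=.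
by rewrite negbK /c divff ?subrr // gt_eqF.
Qed.

(** Caratheodory bounds the number of summands and [x] their size: a summand [t *: l] contributes at
    least [t * c] to minus the product with [x], whence [T]. Short sums are padded with 0, which is
    why [A] contains it. *)
Lemma hull_ball_compact x M : faces_cone x ->
  exists K : set V, [/\ compact K, K `<=` hull & forall v, hull v -> `|v| <= M -> K v].
Proof.
move=> /faces_cone_bound[c c0 cL].
pose T := (p + q)%:R * (`|x| * `|M|) / c.
pose A : set V := (fun tl => tl.1 *: tl.2) @` (`[0, T] `*` L) `|` [set 0].
have Ac : compact A.
  apply: compactU; last exact: compact_set1.
  apply: continuous_compact; last by apply: compact_setX => //; exact: segment_compact.
  apply: continuous_subspaceT.
  by move=> tl; apply: cvgZ; [exact: cvg_fst|exact: cvg_snd].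
have Ah v : A v -> hull v.
  move=> [|->]; last exact: hull0.
  move=> [[t l] /= [+ Ll] <-]; rewrite in_itv /= => /andP[t0 _].
  by apply: hullZ => //; exact/CL_hull/L_CL.
pose K := (fun r : 'rV[V]_(p + q) => \sum_i r 0 i) @` [set r : 'rV[V]_(p + q) | forall i, A (r 0 i)].
exists K; split.
- apply: continuous_compact; last by apply: (rV_compact (A := fun=> A)) => _.
  apply: continuous_subspaceT; apply: (@continuous_sum _ _ _ _ _ (fun i (r : 'rV[V]_(p + q)) => r 0 i)) => i.
  exact: continuous_entry.
- move=> _ [r rA <-]; under eq_bigr do rewrite -[r 0 _]scale1r.
  by apply: hull_sum => // i; exact: Ah.
move=> v /hull_caratheodory[s [sC sz ->]] sM.
exists (\row_i nth 0 s i).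
  move=> i; rewrite mxE; have [is_|is_] := ltnP i (size s); last first.
    by right; rewrite nth_default.
  left; have Ci := sC _ (mem_nth 0 is_).
  have := Ci; case/CLE=> t [l [t0 Ll ti]]; exists (t, l) => //=; split=> //=.
  rewrite in_itv /= (ltW t0) /= ler_pdivlMr //.
  apply: (@le_trans _ _ (- bform x (nth 0 s i))).
    by rewrite ti bformZr -mulrN ler_pM2l // cL.
  apply: (@le_trans _ _ (- bform x (\sum_(y <- s) y))).
    rewrite lerN2 (big_rem (nth 0 s i)) ?mem_nth //= bformDr gerDl bform_sumr.
    rewrite big_seq_cond; apply: sumr_le0 => y; rewrite andbT => /mem_rem/sC yC.
    have := yC => /CLE[r [l' [r0 Ll' ->]]]; rewrite bformZr pmulr_rle0 //.
    by have := cL _ Ll'; lra.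
  apply: le_trans (ler_norm _) _; rewrite normrN.
  apply: le_trans (bform_le_norm _ _) _; rewrite ler_wpM2l // ler_wpM2l //.
  exact: le_trans sM (ler_norm M).
under eq_bigr do rewrite mxE.
rewrite [RHS](big_nth 0) [RHS]big_mkord [RHS](big_ord_widen _ _ sz) [RHS]big_mkcond.
by apply: eq_bigr => i _; case: ltnP => // si; rewrite nth_default.
Qed.

End NullCone.

Lemma lipschitz_image_compact (R : realType) (V W : normedModType R) (A : set V) (f : V -> W) (K : R) :
  compact A -> (forall x y, A x -> A y -> `|f x - f y| <= K * `|x - y|) ->
  compact (f @` A).
Proof.
move=> Ac fK; apply: continuous_compact => //.
apply/subspace_continuousP => x Ax; apply/cvgrPdist_le => e e0.
rewrite near_withinE.
have : \forall y \near x, `|x - y| < e / (`|K| + 1).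
  apply/nbhs_ballP; exists (e / (`|K| + 1)); first by rewrite /= divr_gt0 // ltr_pwDr.
  by rewrite -ball_normE.
apply: filterS => y xy Ay.
apply: le_trans (fK _ _ Ax Ay) _; apply: (@le_trans _ _ ((`|K| + 1) * `|x - y|)).
  by rewrite ler_wpM2r // (le_trans (ler_norm K)) // lerDl.
by rewrite mulrC -ler_pdivlMr ?ltW // ltr_pwDr.
Qed.

(** * Acausal spheres as graphs in the Einstein universe *)

Section AcausalSphere.
Variables (R : realType) (n : nat) (f : 'cV[R]_n -> R).
Hypothesis f_acausal : forall y y', unit_sphere R n y -> unit_sphere R n y' -> y <> y' ->
  `|f y - f y'| < round_dist y y'.
Implicit Types y : 'cV[R]_n.

Local Notation lift_pt := (fun y => Ein_param (f y) y).

Lemma unit_sphereE y : unit_sphere R n y <-> dotp y y = 1.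
Proof. by rewrite /unit_sphere /= trmx_dotp !mxE eqxx mulr1n. Qed.

Lemma dotp_circle (a b : R) : dotp (\col_(i < 2) if i == 0 then cos a else sin a)
  (\col_(i < 2) if i == 0 then cos b else sin b) = cos (a - b).
Proof. by rewrite /dotp big_ord_recl big_ord1 !mxE /= cosB. Qed.

Lemma bform_Ein_param (a b : R) y y' :
  bform (Ein_param a y) (Ein_param b y') = - cos (a - b) + dotp y y'.
Proof. by rewrite bformE /Ein_param !col_mxKu !col_mxKd dotp_circle. Qed.

Lemma Ein_param_null (a : R) y : unit_sphere R n y -> bform (Ein_param a y) (Ein_param a y) = 0.
Proof. by move=> /unit_sphereE yy; rewrite bform_Ein_param subrr cos0 yy addNr. Qed.

Lemma unit_dotp_bounds y y' : unit_sphere R n y -> unit_sphere R n y' -> -1 <= dotp y y' <= 1.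
Proof.
move=> /unit_sphereE yy /unit_sphereE yy'; have := cauchy_schwarz y y'.
by rewrite yy yy' mulr1 -ler_norml; rewrite -[leRHS](expr1n R 2) -real_normK ?num_real // ler_pXn2r ?nnegrE.
Qed.

(** As |f y - f y'| is less than the round distance, itself at most pi, and cos decreases on
    [0, pi], the cosine of the time difference exceeds the dot product. *)
Lemma Ein_graph_neg y y' : unit_sphere R n y -> unit_sphere R n y' -> y <> y' ->
  bform (lift_pt y) (lift_pt y') < 0.
Proof.
move=> Sy Sy' neq; rewrite bform_Ein_param addrC subr_lt0.
have b := unit_dotp_bounds Sy Sy'.
have lt := f_acausal Sy Sy' neq; rewrite /round_dist trmx_dotp !mxE eqxx mulr1n in lt.
have api := acos_lepi b.
rewrite -[ltLHS]acosK ?in_itv //= -(cos_norm (f y - f y')).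
rewrite ltr_cos ?in_itv //= ?normr_ge0 ?acos_ge0 //=.
exact: le_trans (ltW lt) api.
Qed.

Definition Ein_graph : set 'cV[R]_(2 + n) := [set lift_pt y | y in unit_sphere R n].

Lemma unit_sphere_compact : compact (unit_sphere R n).
Proof.
have c : continuous (fun y => dotp y y) by apply: continuous_dotp => ?; exact: cvg_id.
apply: (@compact_cV _ _ _ 1) => [|y /unit_sphereE yy].
  have -> : unit_sphere R n = (fun y => dotp y y) @^-1` [set 1].
    by apply/seteqP; split=> y /unit_sphereE.
  by apply: preimage_closed => // *; exact: c.
apply: norm_le_coord => // i j; rewrite ord1 -(@ler_pXn2r _ 2) ?nnegrE //.
by rewrite real_normK ?num_real // expr1n -yy sqr_coord_le_dotp.
Qed.

(* The pairing of two points of the graph being nonpositive says that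
   y |-> (cos (f y), sin (f y)) is 1-Lipschitz for the Euclidean distances. *)
Lemma Ein_graph_compact : compact Ein_graph.
Proof.
apply: (@lipschitz_image_compact _ _ _ _ _ n.+1%:R) => [|y y' Sy Sy'].
  exact: unit_sphere_compact.
set v := lift_pt y; set w := lift_pt y'.
have vw : bform v w <= 0.
  have [yy'|/eqP neq] := eqVneq y y'; last exact/ltW/Ein_graph_neg.
  by rewrite /v /w -yy' Ein_param_null.
have dd : bform (v - w) (v - w) = - (2 * bform v w).
  by rewrite !bform_linE (bformC w v) !Ein_param_null //; ring.
have dE : dsubmx (v - w) = y - y' by rewrite linearB /= !col_mxKd.
have n1 : 1 <= n.+1%:R :> R by rewrite ler1n.
apply: norm_le_coord => [|i j]; first by rewrite mulr_ge0.
rewrite ord1 -(vsubmxK (v - w)) -(splitK i); case: (fintype.split i) => k /=.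
  rewrite col_mxEu -(@ler_pXn2r _ 2) ?nnegrE ?mulr_ge0 // real_normK ?num_real //.
  apply: le_trans (sqr_coord_le_dotp _ _) _.
  apply: (@le_trans _ _ (dotp (y - y') (y - y'))).
    by move: dd; rewrite bformE dE => dd; lra.
  apply: le_trans (dotp_le_norm _) _; rewrite exprMn ler_wpM2r ?exprn_ge0 //.
  by rewrite -natrX ler_nat expnS expn1 (leq_trans (leqnSn n)) // leq_pmull.
rewrite col_mxEd dE; apply: le_trans (coord_le_norm _ _ _) _.
by rewrite ler_peMl.
Qed.

Lemma Ein_param_neq0 (a : R) y : unit_sphere R n y -> Ein_param a y != 0.
Proof.
move=> /unit_sphereE yy; apply: contraPneq yy => e.
have : dsubmx (Ein_param a y) = y by rewrite col_mxKd.
by rewrite e linear0 => <-; rewrite dotp0l => /esym/eqP; rewrite oner_eq0.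
Qed.

Lemma cone_Ein_graph v : cone (rays Ein_graph) v <->
  exists t l, [/\ 0 < t, Ein_graph l & v = t *: l].
Proof.
rewrite cone_rays; split=> [[v0 [t [t0 tv]]]|[t [l [t0 [y Sy ley] ->]]]].
  by exists t^-1, (t *: v); rewrite invr_gt0 scalerA mulVf ?scale1r // gt_eqF.
have l0 : l != 0 by rewrite -ley Ein_param_neq0.
split; first by rewrite scaler_eq0 negb_or gt_eqF.
by exists t^-1; rewrite invr_gt0 scalerA mulVf ?scale1r ?gt_eqF //; split=> //; exists y.
Qed.

End AcausalSphere.

Section ConvexHull.
Variables (R : realType) (n : nat) (Lambda : set (ray_sphere R (2 + n))).
Hypothesis Lambda_Ein : Lambda `<=` Ein R n.

Lemma cone_Ein v : cone Lambda v -> bform v v = 0.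
Proof.
move=> [s /Lambda_Ein[w /= w0 sw] sv].
have [t _ ->] := vectors_onP sw sv.
by rewrite bformZl bformZr w0 !mulr0.
Qed.

Lemma cone_Conv v : cone (Conv Lambda) v <-> v != 0 /\ hull (cone Lambda) v.
Proof.
rewrite /Conv cone_rays; split=> [[v0 [t [t0 [k [a [x [a0 _ xC tv]]]]]]]|[v0 [s sC sv]]].
  split=> //; rewrite -[v](scalerK (lt0r_neq0 t0)) tv scaler_sumr.
  exists [seq t^-1 *: (a i *: x i) | i <- enum 'I_k].
    move=> y /mapP[i _ ->]; have [_ xi] := xC i.
    by apply: coneZ; [exact: coneZ|rewrite invr_gt0].
  by rewrite big_map big_enum.
have s0 : (0 < size s)%N.
  by rewrite lt0n; apply: contra v0 => /nilP s0; rewrite sv s0 big_nil.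
(* Only the ray matters: [v] is replaced by [k^-1 *: v], for which equal weights sum to 1. *)
split=> //; pose k := (size s)%:R : R.
have k0 : 0 < k by rewrite ltr0n.
exists k^-1; split; first by rewrite invr_gt0.
exists (size s), (fun=> k^-1), (fun i => nth 0 s i); split=> [i||i|].
- by rewrite invr_gt0.
- by rewrite sumr_const card_ord -mulr_natl mulfV // gt_eqF.
- by have Ci := sC _ (mem_nth 0 (ltn_ord i)); split=> //; exact: cone_Ein.
- by rewrite sv (big_nth 0) big_mkord scaler_sumr.
Qed.

End ConvexHull.

(** * Causality *)

Section TimeOrientation.
Variables (R : realType) (n : nat).
Implicit Types (u v w x y z : 'cV[R]_(2 + n)) (g : 'M[R]_(2 + n)).

Local Notation t0 := (lshift n (0 : 'I_2)).
Local Notation t1 := (lshift n (1 : 'I_2)).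

Definition time_det u v : R := u t0 0 * v t1 0 - u t1 0 * v t0 0.

Lemma time_free_ge0 w : w t0 0 = 0 -> w t1 0 = 0 -> 0 <= bform w w /\ (bform w w <= 0 -> w = 0).
Proof.
move=> w0 w1; have wu : usubmx w = 0.
  apply/colP => i; rewrite !mxE.
  by case: i => [[|[|//]] i2]; [rewrite -[RHS]w0|rewrite -[RHS]w1]; congr (w _ _); exact/val_inj.
have -> : bform w w = dotp (dsubmx w) (dsubmx w) by rewrite bformE wu dotp0l oppr0 add0r.
split=> [|le0]; first exact: dotp_ge0.
have wd : dsubmx w = 0 by apply: dotp_eq0; apply/eqP; rewrite eq_le le0 dotp_ge0.
by rewrite -[w]vsubmxK wu wd col_mx0.
Qed.

Definition causal_plane u v :=
  (forall a b : R, bform (a *: u + b *: v) (a *: u + b *: v) <= 0) /\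
  (forall a b : R, a *: u + b *: v = 0 -> a = 0 /\ b = 0).

(** If the determinant vanished, the plane would contain a nonzero vector without time coordinates,
    on which the form is positive. *)
Lemma time_det_neq0 u v : causal_plane u v -> time_det u v != 0.
Proof.
move=> [neg indep]; apply/eqP => det0.
have contra (a b : R) : a * u t0 0 + b * v t0 0 = 0 -> a * u t1 0 + b * v t1 0 = 0 -> a = 0 /\ b = 0.
  move=> e0 e1; apply: indep.
  by apply: (proj2 (@time_free_ge0 (a *: u + b *: v) _ _)); rewrite ?mxE // !mxE.
have [u0 v0] : u t0 0 = 0 /\ u t1 0 = 0.
  have [_ /eqP] := contra (v t0 0) (- u t0 0) ltac:(ring) ltac:(rewrite /time_det in det0; lra).
  rewrite oppr_eq0 => /eqP ->.
  have [_ /eqP] := contra (v t1 0) (- u t1 0) ltac:(rewrite /time_det in det0; lra) ltac:(ring).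
  by rewrite oppr_eq0 => /eqP ->.
have [/eqP] := contra 1 0 ltac:(rewrite u0; ring) ltac:(rewrite v0; ring).
by rewrite oner_eq0.
Qed.

Lemma isometry_causal_plane g u v : isometries R 2 n g -> causal_plane u v ->
  causal_plane (g *m u) (g *m v).
Proof.
move=> gi [neg indep]; split=> a b; rewrite !scalemxAr -mulmxDr; first by rewrite gi.
move=> /(congr1 (mulmx (invmx g))); rewrite mulKmx ?isometry_unit // mulmx0.
exact: indep.
Qed.

Lemma SO0_time_det g u v : SO0 R 2 n g -> causal_plane u v -> 0 < time_det u v ->
  0 < time_det (g *m u) (g *m v).
Proof.
move=> gS uv uv0.
apply: (@component_pos R _ (isometries R 2 n) 1%:M (fun h => time_det (h *m u) (h *m v))) gS.
- have c w i : continuous (fun h : 'M[R]_(2 + n) => (h *m w) i 0).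
    have -> : (fun h : 'M[R]_(2 + n) => (h *m w) i 0) = (fun h => \sum_k h i k * w k 0).
      by apply/funext => h; rewrite mxE.
    apply: continuous_sum => k; apply: continuous_mul; last exact: continuous_cst.
    exact: coord_continuous.
  by apply: continuous_sub; apply: continuous_mul; exact: c.
- by move=> h hi; apply: time_det_neq0; exact: isometry_causal_plane.
- by rewrite !mul1mx.
Qed.

(* The sign of time_det tells the future from the past. *)
Definition future x y :=
  [/\ bform x x = -1, bform y y = -1, -1 <= bform x y, bform x y < 0 & 0 < time_det x y].

(** With c the product of [x] and [y], the form at [a *: x + b *: y] is c (a + b)^2 - (1 + c) (a^2 +
    b^2). *)
Lemma causal_pair_plane x y : bform x x = -1 -> bform y y = -1 -> -1 <= bform x y ->
  bform x y < 0 -> x <> y -> causal_plane x y.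
Proof.
move=> xx yy ge lt neq; split=> a b.
  rewrite !bform_linE (bformC y x) xx yy.
  have : 0 <= (a + b) ^+ 2 * - bform x y by rewrite mulr_ge0 ?sqr_ge0 //; lra.
  have : 0 <= (a ^+ 2 + b ^+ 2) * (1 + bform x y).
    apply: mulr_ge0; [by apply: addr_ge0; exact: sqr_ge0|lra].
  lra.
move=> e.
have e1 : - a + b * bform x y = 0.
  by rewrite -(bform0r x) -e !bform_linE xx; ring.
have e2 : a * bform x y - b = 0.
  by rewrite -(bform0r y) -e !bform_linE yy (bformC y x); ring.
have aE : a = b * bform x y by lra.
have [b0|b0] := eqVneq b 0; first by split=> //; rewrite aE b0 mul0r.
exfalso; have : b * (bform x y ^+ 2 - 1) = 0 by move: e2; rewrite aE => <-; ring.
move=> /eqP; rewrite mulf_eq0 (negbTE b0) /= subr_eq0 sqrf_eq1 => /orP[]/eqP c1; first lra.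
apply: neq; move: e; rewrite aE c1 mulrN1 scaleNr addrC => /eqP.
by rewrite subr_eq0 => /eqP /(scalerI b0).
Qed.

Lemma time_detC x y : time_det y x = - time_det x y.
Proof. by rewrite /time_det; ring. Qed.

Lemma future_neq x y : future x y -> x <> y.
Proof. by move=> [_ _ _ _ + e]; rewrite e /time_det mulrC subrr ltxx. Qed.

Lemma future_plane x y : future x y -> causal_plane x y.
Proof. by move=> /[dup] /future_neq neq [xx yy ge lt _]; exact: causal_pair_plane. Qed.

Lemma future_total x y : bform x x = -1 -> bform y y = -1 -> -1 <= bform x y ->
  bform x y < 0 -> x <> y -> future x y \/ future y x.
Proof.
move=> xx yy ge lt neq.
have := time_det_neq0 (causal_pair_plane xx yy ge lt neq).
rewrite neq_lt => /orP[h|h]; last by left.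
by right; split=> //; rewrite 1?bformC // time_detC oppr_gt0.
Qed.

Lemma future_SO0 g x y : SO0 R 2 n g -> future x y -> future (g *m x) (g *m y).
Proof.
move=> gS xy; have gi := SO0_isometry gS.
have := SO0_time_det gS (future_plane xy).
by case: xy => *; split; rewrite ?gi //; auto.
Qed.

(** The components [x'] and [z'] orthogonal to [y] are causal vectors of a Lorentzian space, with
    opposite time directions as the signs of [time_det] show. So their product is nonnegative, while
    [a * b <= 1]. *)
Lemma future_causal x y z : future x y -> future y z -> -1 <= bform x z.
Proof.
move=> [xx yy xy1 xy0 xyd] [_ zz yz1 yz0 yzd].
set a := - bform x y; set b := - bform y z.
pose x' := x - a *: y; pose z' := z - b *: y.
have x'y : bform x' y = 0 by rewrite /x' !bform_linE yy /a; ring.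
have z'y : bform z' y = 0 by rewrite /z' !bform_linE yy /b (bformC z y); ring.
have x'x' : bform x' x' <= 0.
  rewrite (_ : bform x' x' = bform x y ^+ 2 - 1).
    by rewrite subr_le0 -[leRHS](expr1n R 2) -real_normK ?num_real // ler_pXn2r ?nnegrE // ler_norml; lra.
  by rewrite /x' !bform_linE xx yy (bformC y x) /a; ring.
have z'z' : bform z' z' <= 0.
  rewrite (_ : bform z' z' = bform y z ^+ 2 - 1).
    by rewrite subr_le0 -[leRHS](expr1n R 2) -real_normK ?num_real // ler_pXn2r ?nnegrE // ler_norml; lra.
  by rewrite /z' !bform_linE zz yy (bformC z y) /b; ring.
have xE : x = x' + a *: y by rewrite /x' subrK.
have zE : z = z' + b *: y by rewrite /z' subrK.
have dx' : time_det y x' = - time_det x y by rewrite /x' /time_det !mxE; ring.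
have dz' : time_det y z' = time_det y z by rewrite /z' /time_det !mxE; ring.
have ab0 : 0 < a <= 1 /\ 0 < b <= 1 by rewrite /a /b; lra.
clearbody a b x' z'.
have xzE : bform x z = - (a * b) + bform x' z'.
  by rewrite xE zE !bform_linE yy x'y (bformC y z') z'y; ring.
have ab : a * b <= 1.
  by rewrite -[leRHS](mulr1 1); apply: ler_pM; lra.
suff : 0 <= bform x' z' by rewrite xzE; lra.
rewrite leNgt; apply/negP => x'z'.
(* This [s] makes [time_det y w] vanish. A negative product of [x'] and [z'] would make [w] causal,
   so that [y] and [w] span a causal plane of zero determinant; the case [w = 0] contradicts the
   sign of the product. *)
pose s := time_det x y / time_det y z.
have s0 : 0 < s by rewrite divr_gt0.
pose w := x' + s *: z'.
have wy : bform y w = 0 by rewrite bformC /w !bform_linE x'y z'y; ring.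
have ww : bform w w <= 0.
  rewrite /w !bform_linE (bformC z' x').
  have : 0 <= s * - bform x' z' by apply: mulr_ge0; lra.
  have : 0 <= s * s * - bform z' z' by apply: mulr_ge0; [apply: mulr_ge0; lra|lra].
  lra.
have dw : time_det y w = 0.
  have -> : time_det y w = s * time_det y z - time_det x y.
    by rewrite -dz' -[time_det x y]opprK -dx' /w /time_det !mxE; ring.
  by rewrite /s divfK ?subrr // gt_eqF.
have wE : w = x' + s *: z' by [].
clearbody w.
have [w0|w0] := eqVneq w 0.
  have : bform x' z' = - s * bform z' z'.
    have -> : x' = - (s *: z') by apply/eqP; rewrite -addr_eq0 -wE; apply/eqP.
    by rewrite bformNl bformZl mulNr.
  have : 0 <= s * - bform z' z' by apply: mulr_ge0; lra.
  lra.
have : causal_plane y w.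
  split=> c d.
    rewrite !bform_linE yy wy (bformC w y) wy.
    have : 0 <= c * c by rewrite -expr2 sqr_ge0.
    have : 0 <= d * d * - bform w w by apply: mulr_ge0; [rewrite -expr2 sqr_ge0|lra].
    lra.
  move=> e; have c0 : c = 0.
    by have := bform0r y; rewrite -e !bform_linE yy wy; lra.
  by move: e; rewrite c0 scale0r add0r => /eqP; rewrite scaler_eq0 (negbTE w0) orbF => /eqP.
by move=> /time_det_neq0; rewrite dw eqxx.
Qed.

(** Otherwise the three points are cyclically ordered. The combination [w], given by Cramer's rule,
    has no time coordinates but positive coefficients, so that negative products would make its
    square negative. *)
Lemma future_trans x y z : future x y -> future y z -> bform x z < 0 -> future x z.
Proof.
move=> xy yz xz0; have xz1 := future_causal xy yz.
case: (xy) (yz) => xx yy xy1 xy0 xyd [_ zz yz1 yz0 yzd].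
have [xz|/eqP neq] := eqVneq x z.
  by move: yzd; rewrite -xz time_detC; lra.
case: (future_total xx zz xz1 xz0 neq) => // -[_ _ _ _ zxd].
pose w := time_det y z *: x + time_det z x *: y + time_det x y *: z.
have [] := @time_free_ge0 w; [by rewrite /w /time_det !mxE; ring..|].
move=> + _; rewrite leNgt => /negP; case.
rewrite /w !bform_linE xx yy zz (bformC y x) (bformC z x) (bformC z y).
move: (time_det y z) (time_det z x) (time_det x y) yzd zxd xyd => a b c a0 b0 c0.
have : 0 < a * b * - bform x y by rewrite !mulr_gt0 ?oppr_gt0.
have : 0 < a * c * - bform x z by rewrite !mulr_gt0 ?oppr_gt0.
have : 0 < b * c * - bform y z by rewrite !mulr_gt0 ?oppr_gt0.
have : 0 < a * a by rewrite mulr_gt0.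
have : 0 < b * b by rewrite mulr_gt0.
have : 0 < c * c by rewrite mulr_gt0.
lra.
Qed.

(** The iterates move steadily into the future, or steadily into the past; the sign hypothesis lets
    transitivity be applied at each step. *)
Lemma causal_orbit g x : SO0 R 2 n g -> bform x x = -1 ->
  (forall k, bform x (g ^+ k *m x) < 0) -> -1 <= bform x (g *m x) ->
  forall k, -1 <= bform x (g ^+ k *m x).
Proof.
move=> gS xx neg ge1; have gi := SO0_isometry gS.
have xgx : bform x (g *m x) < 0 by have := neg 1%N; rewrite expr1.
have gg : bform (g *m x) (g *m x) = -1 by rewrite gi.
have [e k|/eqP neq] := eqVneq x (g *m x).
  have -> : g ^+ k *m x = x.
    by elim: k => [|k IH]; rewrite ?expr0 ?mul1mx // exprSr -mulmxA -e.
  by rewrite xx.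
case: (future_total xx gg ge1 xgx neq) => fut k.
  have fk j : future x (g ^+ j.+1 *m x).
    elim: j => [|j IH]; first by rewrite expr1.
    rewrite exprS -mulmxA; apply: (future_trans fut); first exact: future_SO0.
    by have := neg j.+2; rewrite exprS -mulmxA.
  case: k => [|k]; first by rewrite expr0 mul1mx xx.
  by case: (fk k).
have fk j : future (g ^+ j.+1 *m x) x.
  elim: j => [|j IH]; first by rewrite expr1.
  rewrite exprS -mulmxA; apply: (future_trans _ fut); first exact: future_SO0.
  by have := neg j.+2; rewrite exprS -mulmxA bformC.
case: k => [|k]; first by rewrite expr0 mul1mx xx.
by rewrite bformC; case: (fk k).
Qed.

End TimeOrientation.

(** * The action of the lattice *)

Lemma finite_set_bound (R : realType) (T : choiceType) (A : set T) (F : T -> R) :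
  finite_set A -> exists M, forall a, A a -> F a <= M.
Proof.
move=> /finite_seqP[s ->]; exists (\sum_(a <- s) `|F a|) => a as_.
rewrite (big_rem a) //=; apply: le_trans (ler_norm _) _.
by rewrite lerDl sumr_ge0.
Qed.

Lemma finite_set_max (R : realType) (T : choiceType) (A : set T) (F : T -> R) a0 :
  finite_set A -> A a0 -> exists2 a, A a & forall b, A b -> F b <= F a.
Proof.
move=> /finite_seqP[s ->] /=; elim: s a0 => // a s IH a0 _.
have [[b0 b0s]|b0s] := pselect (exists b, b \in s); last first.
  exists a => [|b]; first by rewrite /= inE eqxx.
  by rewrite /= inE => /predU1P[->//|bs]; case: b0s; exists b.
have [b bs bmax] := IH b0 b0s.
have [ab|ba] := leP (F a) (F b).
  exists b => [|c]; first by rewrite /= inE bs orbT.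
  by rewrite /= inE => /predU1P[->//|/bmax].
exists a => [|c]; first by rewrite /= inE eqxx.
rewrite /= inE => /predU1P[->//|/bmax]; move/le_trans; apply; exact: ltW.
Qed.

Lemma finite_inj (T U : Type) (A : set T) (f : T -> U) :
  set_inj A f -> finite_set (f @` A) -> finite_set A.
Proof. by move=> /inj_card_eq/eq_finite_set ->. Qed.

Section LatticeAction.
Variables (R : realType) (n : nat) (Gamma : set 'M[R]_(1 + n)).
Variables (rho : 'M[R]_(1 + n) -> 'M[R]_(2 + n)) (Lambda : set (ray_sphere R (2 + n))).
Variables (L : set 'cV[R]_(2 + n)) (x0 : 'cV[R]_(2 + n)).
Local Notation V := 'cV[R]_(2 + n).
Local Notation CL := (cone Lambda).
Local Notation HC := (hull (cone Lambda)).
Implicit Types (v w x : V) (g h : 'M[R]_(1 + n)).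

Hypothesis lattice : cocompact_lattice 1 n Gamma.
Hypothesis tf : torsion_free Gamma.
Hypothesis hrho : faithful_discrete_rep Gamma rho.
Hypothesis Lambda_Ein : Lambda `<=` Ein R n.
Hypothesis L_compact : compact L.
Hypothesis CLE : forall v, CL v <-> exists t l, [/\ 0 < t, L l & v = t *: l].
Hypothesis L_null : forall l, L l -> bform l l = 0.
Hypothesis L_neg : forall l l', L l -> L l' -> l <> l' -> bform l l' < 0.
Hypothesis hinv : forall g, Gamma g -> ray_image (rho g) Lambda = Lambda.
Hypothesis hint : interior (Conv Lambda) !=set0.
Hypothesis x0_AdS : bform x0 x0 = -1.
Hypothesis x0_hull : HC x0.

Lemma lattice1 : Gamma 1%:M. Proof. by case: lattice => -[]. Qed.

Lemma latticeM g h : Gamma g -> Gamma h -> Gamma (g *m h).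
Proof. by case: lattice => -[_ _ GM _] _ _; exact: GM. Qed.

Lemma latticeV g : Gamma g -> Gamma (invmx g).
Proof. by case: lattice => -[_ _ _ GV] _ _; exact: GV. Qed.

Lemma lattice_unit g : Gamma g -> g \in unitmx.
Proof. by move=> /(lattice_isometry lattice)/isometry_unit. Qed.

Lemma rho_SO0 g : Gamma g -> SO0 R 2 n (rho g).
Proof. by case: hrho => + _ _ _; exact. Qed.

Lemma rho_isometry g : Gamma g -> isometries R 2 n (rho g).
Proof. by move=> /rho_SO0/SO0_isometry. Qed.

Lemma rho_unit g : Gamma g -> rho g \in unitmx.
Proof. by move=> /rho_isometry/isometry_unit. Qed.

Lemma rhoM g h : Gamma g -> Gamma h -> rho (g *m h) = rho g *m rho h.
Proof. by case: hrho => _ + _ _; exact. Qed.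

Lemma rho1 : rho 1%:M = 1%:M.
Proof.
have := rhoM lattice1 lattice1; rewrite mul1mx => e.
have u1 := rho_unit lattice1.
by rewrite -[LHS](mulmxK u1) -e mulmxV.
Qed.

Lemma rhoV g : Gamma g -> rho (invmx g) = invmx (rho g).
Proof.
move=> Gg; have := rhoM (latticeV Gg) Gg; rewrite mulVmx ?lattice_unit // rho1 => e.
by rewrite -[LHS](mulmxK (rho_unit Gg)) -e mul1mx.
Qed.

Lemma bform_rhoV g v w : Gamma g -> bform v (rho (invmx g) *m w) = bform (rho g *m v) w.
Proof.
move=> Gg; rewrite rhoV // [LHS]bformC bform_invmx; first exact: bformC.
exact: rho_isometry.
Qed.

Lemma rho_cone g v : Gamma g -> CL v -> CL (rho g *m v).
Proof.
move=> Gg Cv; rewrite -(hinv Gg); apply/cone_ray_image; first exact: rho_unit.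
by rewrite mulKmx // rho_unit.
Qed.

Lemma rho_hull g v : Gamma g -> HC v -> HC (rho g *m v).
Proof.
move=> Gg; move: v; apply: hull_ind => [|x w Cx _ hw]; first by rewrite mulmx0; exact: hull0.
by rewrite mulmxDr; apply: hullD => //; apply/CL_hull/rho_cone.
Qed.

Lemma x0_faces : faces_cone CL x0.
Proof. by apply: (hull_faces_cone CLE L_null L_neg) => //; rewrite x0_AdS; lra. Qed.

Lemma faces_cone_hull_lt0 x v : faces_cone CL x -> HC v -> v != 0 -> bform x v < 0.
Proof.
move=> xf hv v0; have [c c0 cP] := faces_cone_hull L_compact CLE xf.
have := cP _ hv; have : 0 < c * `|v| by rewrite mulr_gt0 ?normr_gt0.
lra.
Qed.

Lemma orbit_AdS g : Gamma g -> bform (rho g *m x0) (rho g *m x0) = -1.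
Proof. by move=> Gg; rewrite rho_isometry. Qed.

Lemma orbit_hull g : Gamma g -> HC (rho g *m x0).
Proof. by move=> Gg; exact: rho_hull. Qed.

Lemma orbit_neq0 g : Gamma g -> rho g *m x0 != 0.
Proof.
move=> Gg; apply: contraPneq (orbit_AdS Gg) => ->; rewrite bform0l => /eqP.
by rewrite eq_sym oppr_eq0 oner_eq0.
Qed.

Lemma orbit_faces g : Gamma g -> faces_cone CL (rho g *m x0).
Proof.
move=> Gg; apply: (hull_faces_cone CLE L_null L_neg); first exact: orbit_hull.
by rewrite orbit_AdS //; lra.
Qed.

Lemma orbit_bform g h : Gamma g -> Gamma h ->
  bform (rho g *m x0) (rho h *m x0) = bform x0 (rho (invmx g *m h) *m x0).
Proof.
move=> Gg Gh; have GVg := latticeV Gg; rewrite rhoM // rhoV // -mulmxA.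
by rewrite [RHS]bformC bform_invmx; [exact: bformC|exact: rho_isometry].
Qed.

Lemma orbit_lt0 g h : Gamma g -> Gamma h -> bform (rho g *m x0) (rho h *m x0) < 0.
Proof.
by move=> Gg Gh; apply: faces_cone_hull_lt0 (orbit_faces Gg) (orbit_hull Gh) (orbit_neq0 Gh).
Qed.

Lemma hull_interior : exists v d, 0 < d /\ forall u, `|u| <= d -> HC (v + u).
Proof.
have [s sint] := hint; have [v sv] := ray_vector s.
have := @open_rays_near _ _ (interior (Conv Lambda)) s v (open_interior _) sint sv.
move=> /nbhs_ballP[e /= e0 eP]; exists v, (e / 2); split; first by rewrite divr_gt0.
move=> u ue; have [t /interior_subset tC tvu] : cone (interior (Conv Lambda)) (v + u).
  apply: eP; rewrite -ball_normE /= opprD addrA subrr add0r normrN.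
  lra.
by have /(cone_Conv Lambda_Ein)[] : cone (Conv Lambda) (v + u) by exists t.
Qed.

(** The inverse [h] of [rho g] preserves the convex cone, where norms are comparable to products
    with [x0]; so [h *m z] is controlled by the product of [rho g *m x0] with [z]. A ball in the
    cone writes every small [u] as the difference of [v + u] and [v], which extends the bound to all
    vectors. *)
Lemma rho_bounded (M : R) :
  exists K, forall g, Gamma g -> - bform x0 (rho g *m x0) <= M -> `|rho g| <= K.
Proof.
have [v [d [d0 vd]]] := hull_interior.
have [c c0 cP] := faces_cone_hull L_compact CLE x0_faces.
pose N : R := (2 + n)%:R.
pose K1 := N * (M / c) / c.
exists (K1 * (2 * `|v| + d) / d) => g Gg gM.
have GVg := latticeV Gg; set h := rho (invmx g).
have hE : rho g = invmx h by rewrite /h rhoV // invmxK.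
have gx0 : `|rho g *m x0| <= M / c.
  rewrite ler_pdivlMr // mulrC; apply: le_trans gM; apply: cP; exact: orbit_hull.
have M0 : 0 <= M / c by apply: le_trans gx0.
have hz z : HC z -> `|h *m z| <= K1 * `|z|.
  move=> hz; rewrite /K1 mulrAC ler_pdivlMr // mulrC.
  apply: le_trans (cP _ (rho_hull GVg hz)) _.
  rewrite bform_rhoV //.
  apply: le_trans (ler_norm _) _; rewrite normrN.
  apply: le_trans (bform_le_norm _ _) _; rewrite -mulrA ler_wpM2l // ler_wpM2r //.
have K10 : 0 <= K1 by rewrite /K1 divr_ge0 ?(ltW c0) // mulr_ge0.
rewrite hE; apply: le_trans (norm_invmx (rho_isometry GVg)) _.
apply: norm_le_coord => [|i j].
  by rewrite divr_ge0 ?(ltW d0) // mulr_ge0 // addr_ge0 ?(ltW d0) // mulr_ge0.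
pose u : V := d *: delta_mx j 0.
have ud : `|u| <= d.
  apply: norm_le_coord => [|k l]; first exact: ltW.
  rewrite !mxE normrM (gtr0_norm d0) ler_piMr ?(ltW d0) //.
  by case: andb; rewrite ?normr1 ?normr0.
rewrite ler_pdivlMr // mulrC -{1}(gtr0_norm d0) -normrM.
have -> : d * h i j = (h *m u) i 0 by rewrite -scalemxAr -colE !mxE.
apply: le_trans (coord_le_norm _ _ _) _.
have -> : h *m u = h *m (v + u) - h *m (v + 0) by rewrite addr0 mulmxDr addrAC subrr add0r.
apply: le_trans (ler_normB _ _) _.
have h1 := hz _ (vd _ ud).
have h2 : `|h *m (v + 0)| <= K1 * `|v + 0| by apply: hz; apply: vd; rewrite normr0 ltW.
apply: (@le_trans _ _ (K1 * `|v + u| + K1 * `|v|)); first by rewrite lerD // -{2}(addr0 v).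
rewrite -mulrDr ler_wpM2l // mulrDl mul1r.
by have := ler_normD v u; lra.
Qed.

Lemma rho_finite0 (M : R) :
  finite_set [set g | Gamma g /\ - bform x0 (rho g *m x0) <= M].
Proof.
have [K KP] := rho_bounded M.
have rho_inj : set_inj Gamma rho by case: hrho.
have fin : finite_set [set h | (rho @` Gamma) h /\ `|h| <= K].
  apply: discrete_bounded_finite.
  - by move=> _ [g Gg <-]; exact: rho_isometry.
  - by exists 1%:M; [exact: lattice1|exact: rho1].
  - move=> _ _ [g Gg <-] [h Gh <-]; exists (g *m h); first exact: latticeM.
    exact: rhoM.
  - move=> _ [g Gg <-]; exists (invmx g); first exact: latticeV.
    exact: rhoV.
  - by case: hrho.
apply: (@finite_inj _ _ _ rho).
  move=> g h /set_mem[Gg _] /set_mem[Gh _]; apply: rho_inj; exact: mem_set.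
by apply: sub_finite_set fin => _ [g [Gg gM] <-]; split; [exists g|exact: KP].
Qed.

Lemma rho_finite x (M : R) : faces_cone CL x ->
  finite_set [set g | Gamma g /\ - bform x (rho g *m x0) <= M].
Proof.
move=> xf; have [c c0 cP] := faces_cone_hull L_compact CLE xf.
apply: sub_finite_set (rho_finite0 ((2 + n)%:R * (`|x0| * (M / c)))) => g [Gg gM].
split=> //; apply: le_trans (ler_norm _) _; rewrite normrN.
apply: le_trans (bform_le_norm _ _) _; rewrite ler_wpM2l // ler_wpM2l //.
rewrite ler_pdivlMr // mulrC; apply: le_trans gM; apply: cP; exact: orbit_hull.
Qed.

Lemma latticeX g k : Gamma g -> Gamma (g ^+ k).
Proof.
move=> Gg; elim: k => [|k IH]; first exact: lattice1.
by rewrite exprS; exact: latticeM.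
Qed.

Lemma rhoX g k : Gamma g -> rho (g ^+ k) = rho g ^+ k.
Proof.
move=> Gg; elim: k => [|k IH]; first exact: rho1.
by rewrite !exprS [LHS]rhoM ?IH //; exact: latticeX.
Qed.

Lemma latticeX_inj g : Gamma g -> g != 1%:M -> injective (fun k => g ^+ k).
Proof.
move=> Gg g1.
suff lt i j : (i < j)%N -> g ^+ i <> g ^+ j.
  by move=> i j /= e; case: (ltngtP i j) => // /lt; rewrite e.
move=> ij e; move/eqP: g1; apply; apply: (@tf g (j - i)%N) => //; first by rewrite subn_gt0.
have gi : g ^+ i \in unitmx by apply: lattice_unit; exact: latticeX.
rewrite -[LHS](mulmxK gi) -[g ^+ (j - i)%N *m g ^+ i]/(g ^+ (j - i)%N * g ^+ i).
by rewrite -exprD subnK ?(ltnW ij) // -e mulmxV.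
Qed.

Lemma orbit_lt g : Gamma g -> g != 1%:M -> bform x0 (rho g *m x0) < -1.
Proof.
move=> Gg g1; rewrite ltNge; apply/negP => ge.
have neg k : bform x0 (rho g ^+ k *m x0) < 0.
  rewrite -rhoX //; have := orbit_lt0 lattice1 (latticeX k Gg).
  by rewrite rho1 mul1mx.
have causal := causal_orbit (rho_SO0 Gg) x0_AdS neg ge.
apply: infinite_nat; apply: (@finite_inj _ _ _ (fun k => g ^+ k)).
  by move=> i j _ _; exact: latticeX_inj.
apply: sub_finite_set (rho_finite0 1) => _ [k _ <-]; split; first exact: latticeX.
by rewrite rhoX // -[leRHS]opprK lerN2; exact: causal.
Qed.

Hypothesis L_time : forall l, L l -> dotp (usubmx l) (usubmx l) = 1.

(** * Orbit averages as a coarse embedding *)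

Section Core.
Variable T : R.
Hypothesis T_cocompact : forall x : 'cV[R]_n, exists g, Gamma g /\
  - bform (hyp_point x) (g *m hyp_point 0) < T.

Local Notation o := (hyp_point (0 : 'cV[R]_n)).
Implicit Types xi : 'cV[R]_n.

(** A tent function of the cosh of the distance to an orbit point; cocompactness makes some weight
    positive at every [xi]. *)
Let wt g xi := Num.max 0 (T + bform (hyp_point xi) (g *m o)).

Lemma wt_ge0 g xi : 0 <= wt g xi.
Proof. by rewrite le_max lexx. Qed.

Lemma wt_gt0 g xi : 0 < wt g xi -> - bform (hyp_point xi) (g *m o) < T.
Proof. by rewrite lt_max ltxx /= => h; lra. Qed.

Lemma lattice_hyp_point g : Gamma g -> exists y, g *m o = hyp_point y.
Proof. by move=> Gg; apply: SO0_forward; case: lattice => -[+ _ _ _] _ _; exact. Qed.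

Lemma cocompact_ge1 : 1 < T.
Proof.
have [g [Gg]] := T_cocompact 0; have [y ->] := lattice_hyp_point Gg.
rewrite bform_hyp_point opprK coshd0x; exact: le_lt_trans (htime_ge1 y).
Qed.

Lemma wt_support (M : R) : exists s : seq 'M[R]_(1 + n), [/\ uniq s, forall g, g \in s -> Gamma g &
  forall g xi, Gamma g -> `|xi| <= M -> 0 < wt g xi -> g \in s].
Proof.
pose K := 2 * Num.sqrt (1 + n%:R * M ^+ 2) * T.
have /finite_seqP[s sP] := lattice_finite lattice K.
exists (undup s); split=> [|g|g xi Gg xiM /wt_gt0]; first exact: undup_uniq.
  by rewrite mem_undup => gs; have : [set` s] g by []; rewrite -sP => -[].
rewrite mem_undup => lt.
suff : [set` s] g by [].
rewrite -sP; split=> //; move: lt; have [y ->] := lattice_hyp_point Gg.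
rewrite !bform_hyp_point !opprK coshd0x => lt.
apply: le_trans (htime_le_coshd xi y) _; rewrite /K.
apply: ler_pM; [|exact: ltW (coshd_gt0 _ _)| |exact: ltW].
  by rewrite mulr_ge0 // ltW // htime_gt0.
rewrite ler_pM2l // /htime; apply: ler_wsqrtr; rewrite lerD2l.
apply: le_trans (dotp_le_norm _) _; rewrite ler_wpM2l // ler_pXn2r ?nnegrE //.
exact: le_trans xiM.
Qed.

(** A locally finite sum over an infinite group: [phi_seq] makes it finite on a ball, and [phi_repr]
    keeps positive weights only. *)
Let phi xi : V := \sum_(g \in Gamma) wt g xi *: (rho g *m x0).

Lemma phi_seq (M : R) (s : seq 'M[R]_(1 + n)) : uniq s -> (forall g, g \in s -> Gamma g) ->
  (forall g xi, Gamma g -> `|xi| <= M -> 0 < wt g xi -> g \in s) ->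
  forall xi, `|xi| <= M -> phi xi = \sum_(g <- s) wt g xi *: (rho g *m x0).
Proof.
move=> su sG sP xi xiM; rewrite fsbig_seq // /phi; apply/esym/fsbig_widen => [g /sG//|].
move=> g [Gg gs] /=; suff -> : wt g xi = 0 by rewrite scale0r.
apply/eqP; rewrite eq_le wt_ge0 andbT leNgt; apply/negP => h.
by apply: gs; exact: sP h.
Qed.

Lemma continuous_wt g : continuous (wt g).
Proof.
apply: continuous_maxR; first exact: continuous_cst.
apply: continuous_add; first exact: continuous_cst.
apply: continuous_bform; last exact: continuous_cst.
apply: mx_continuous => i j; rewrite -(splitK i) ord1; case: (fintype.split i) => k /=.
  have -> : (fun xi => hyp_point xi (lshift n k) 0) = (fun xi => htime xi).
    by apply/funext => xi; rewrite /hyp_point col_mxEu mxE.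
  by apply: continuous_htime => ?; exact: cvg_id.
have -> : (fun xi => hyp_point xi (rshift 1 k) 0) = (fun xi => xi k 0).
  by apply/funext => xi; rewrite /hyp_point col_mxEd.
exact: coord_continuous.
Qed.

Lemma continuous_phi : continuous phi.
Proof.
move=> xi; have [s [su sG sP]] := wt_support (`|xi| + 1).
pose psi xi := \sum_(g <- s) wt g xi *: (rho g *m x0).
have psic : continuous psi.
  apply: continuous_sum => g; apply: continuous_scale; first exact: continuous_wt.
  exact: continuous_cst.
have near_eq : \forall xi' \near xi, psi xi' = phi xi'.
  apply/nbhs_ballP; exists 1 => //= xi'; rewrite -ball_normE /= => d.
  apply/esym/(phi_seq su sG sP).
  have : `|xi'| <= `|xi| + `|xi' - xi| by rewrite -{1}(subrK xi xi') addrC ler_normD.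
  rewrite distrC; lra.
have e : phi xi = psi xi by rewrite (phi_seq su sG sP) // lerDl.
rewrite /continuous_at e.
by move=> A /(psic xi); apply: filterS2 near_eq => z e' /=; rewrite e'.
Qed.

Lemma phi_repr xi : exists s, [/\ forall g, g \in s -> Gamma g /\ 0 < wt g xi,
  0 < \sum_(g <- s) wt g xi & phi xi = \sum_(g <- s) wt g xi *: (rho g *m x0)].
Proof.
have [s [su sG sP]] := wt_support `|xi|.
exists [seq g <- s | 0 < wt g xi]; split.
- by move=> g; rewrite mem_filter => /andP[g0 /sG].
- have [g [Gg gT]] := T_cocompact xi.
  have g0 : 0 < wt g xi by rewrite lt_max; apply/orP; right; lra.
  rewrite big_filter (big_rem g) ?(sP g xi) //= g0 ltr_pwDl // sumr_ge0 // => h _.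
  exact: wt_ge0.
- rewrite (phi_seq su sG sP) // big_filter [RHS]big_mkcond /=; apply: eq_bigr => g _.
  case: ifP => // /negbT; rewrite -leNgt => le0.
  have -> : wt g xi = 0 by apply/eqP; rewrite eq_le le0 wt_ge0.
  by rewrite scale0r.
Qed.

Lemma wt_close g h xi : Gamma g -> Gamma h -> 0 < wt g xi -> 0 < wt h xi ->
  - bform (g *m o) (h *m o) <= 2 * T * T.
Proof.
move=> Gg Gh /wt_gt0 + /wt_gt0; have [y ->] := lattice_hyp_point Gg; have [z ->] := lattice_hyp_point Gh.
rewrite !bform_hyp_point !opprK => lt1 lt2.
apply: le_trans (coshd_triangle _ xi _) _; rewrite coshdC -!mulrA ler_pM2l //.
by apply: ler_pM; rewrite ?(ltW (coshd_gt0 _ _)) // ltW.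
Qed.

Lemma lattice_bform g h : Gamma g -> Gamma h ->
  bform (g *m o) (h *m o) = bform o (invmx g *m h *m o).
Proof.
move=> Gg Gh; rewrite -mulmxA [RHS]bformC bform_invmx; first exact: bformC.
exact: lattice_isometry Gg.
Qed.

(** Two elements with positive weight at the same [xi] differ by one of finitely many lattice
    elements, and the products are equivariant. *)
Lemma orbit_near : exists2 M, 0 < M & forall g h xi, Gamma g -> Gamma h -> 0 < wt g xi -> 0 < wt h xi ->
  - bform (rho g *m x0) (rho h *m x0) <= M.
Proof.
have [M MP] := finite_set_bound (fun k => - bform x0 (rho k *m x0)) (lattice_finite lattice (2 * T * T)).
exists (`|M| + 1) => [|g h xi Gg Gh g0 h0]; first by rewrite ltr_pwDr.
rewrite orbit_bform //; apply: (@le_trans _ _ M); last by have := ler_norm M; lra.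
apply: (MP (invmx g *m h)); split; first by apply: latticeM => //; exact: latticeV.
by rewrite -lattice_bform //; exact: wt_close h0.
Qed.

(** The comparison in the converse direction, finiteness now coming from the action through
    [rho]. *)
Lemma hyp_near (M : R) : exists2 N, 0 < N & forall g h, Gamma g -> Gamma h ->
  - bform (rho g *m x0) (rho h *m x0) <= M -> - bform (g *m o) (h *m o) <= N.
Proof.
have [N NP] := finite_set_bound (fun k => - bform o (k *m o)) (rho_finite0 M).
exists (`|N| + 1) => [|g h Gg Gh]; first by rewrite ltr_pwDr.
rewrite orbit_bform // lattice_bform // => le; apply: (@le_trans _ _ N); last by have := ler_norm N; lra.
apply: (NP (invmx g *m h)); split=> //; apply: latticeM => //; exact: latticeV.
Qed.

Lemma bform_wsum (s s' : seq 'M[R]_(1 + n)) xi xi' :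
  bform (\sum_(g <- s) wt g xi *: (rho g *m x0)) (\sum_(h <- s') wt h xi' *: (rho h *m x0)) =
  \sum_(g <- s) \sum_(h <- s') wt g xi * (wt h xi' * bform (rho g *m x0) (rho h *m x0)).
Proof.
rewrite bform_suml; apply: eq_bigr => g _; rewrite bform_sumr; apply: eq_bigr => h _.
by rewrite bformZl bformZr.
Qed.

Lemma wsum_le (s s' : seq 'M[R]_(1 + n)) xi xi' (F : 'M[R]_(1 + n) -> 'M[R]_(1 + n) -> R) M :
  (forall g h, g \in s -> h \in s' -> F g h <= M) ->
  \sum_(g <- s) \sum_(h <- s') wt g xi * (wt h xi' * F g h) <=
  M * ((\sum_(g <- s) wt g xi) * (\sum_(h <- s') wt h xi')).
Proof.
move=> FM; rewrite mulr_suml mulr_sumr big_seq [leRHS]big_seq; apply: ler_sum => g gs.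
rewrite mulr_sumr mulr_sumr big_seq [leRHS]big_seq; apply: ler_sum => h hs.
by rewrite [leRHS]mulrC -mulrA !ler_wpM2l ?wt_ge0 // FM.
Qed.

Lemma phi_neg xi : bform (phi xi) (phi xi) < 0.
Proof.
have [s [sP s0 ->]] := phi_repr xi; rewrite bform_wsum.
have [g0 g0s] : exists g, g \in s.
  by case: s s0 {sP} => [|g s _]; [rewrite big_nil ltxx|exists g; rewrite inE eqxx].
have le0 g h : g \in s -> h \in s ->
    wt g xi * (wt h xi * bform (rho g *m x0) (rho h *m x0)) < 0.
  move=> /sP[Gg wg] /sP[Gh wh].
  by rewrite pmulr_rlt0 // pmulr_rlt0 // orbit_lt0.
rewrite (big_rem g0) //= (big_rem g0) //=.
have : \sum_(y <- rem g0 s) wt g0 xi * (wt y xi * bform (rho g0 *m x0) (rho y *m x0)) <= 0.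
  by rewrite big_seq; apply: sumr_le0 => h /mem_rem hs; exact/ltW/le0.
have : \sum_(y <- rem g0 s) \sum_(h <- s) wt y xi * (wt h xi * bform (rho y *m x0) (rho h *m x0)) <= 0.
  rewrite big_seq; apply: sumr_le0 => g /mem_rem gs.
  by rewrite big_seq; apply: sumr_le0 => h hs; exact/ltW/le0.
have := le0 _ _ g0s g0s; lra.
Qed.

Let nu xi := Num.sqrt (- bform (phi xi) (phi xi)).
Let Phi xi : 'cV[R]_n := dsubmx ((nu xi)^-1 *: phi xi).

Lemma nu_gt0 xi : 0 < nu xi.
Proof. by rewrite sqrtr_gt0 oppr_gt0 phi_neg. Qed.

Lemma sqr_nu xi : nu xi ^+ 2 = - bform (phi xi) (phi xi).
Proof. by rewrite sqr_sqrtr // oppr_ge0 ltW // phi_neg. Qed.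

Lemma continuous_Phi : continuous Phi.
Proof.
apply: mx_continuous => i j.
have -> : (fun xi => Phi xi i j) = (fun xi => (nu xi)^-1 * phi xi (rshift 2 i) j).
  by apply/funext => xi; rewrite /Phi !mxE.
apply: continuous_mul.
  apply: continuous_inv => [xi|]; first by rewrite gt_eqF // nu_gt0.
  move=> xi; apply: (@continuous_comp _ _ _ (fun xi => - bform (phi xi) (phi xi)) Num.sqrt).
    have -> : (fun xi => - bform (phi xi) (phi xi)) = (fun xi => bform (- phi xi) (phi xi)).
      by apply/funext => z; rewrite bformNl.
    apply: continuous_bform; last exact: continuous_phi.
    have -> : (fun xi => - phi xi) = (fun xi => 0 - phi xi) by apply/funext => z; rewrite sub0r.
    by apply: continuous_sub; [exact: continuous_cst|exact: continuous_phi].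
  exact: sqrt_continuous.
move=> xi; apply: (@continuous_comp _ _ _ phi (fun M : V => M (rshift 2 i) j)).
  exact: continuous_phi.
exact: coord_continuous.
Qed.

Lemma AdS_usubmx v : bform v v = -1 -> dotp (usubmx v) (usubmx v) = htime (dsubmx v) ^+ 2.
Proof. by rewrite bformE sqr_htime => h; lra. Qed.

Lemma normalized_phi xi : bform ((nu xi)^-1 *: phi xi) ((nu xi)^-1 *: phi xi) = -1.
Proof.
rewrite bformZl bformZr; have := sqr_nu xi; have n0 := nu_gt0 xi => e.
have -> : bform (phi xi) (phi xi) = - (nu xi ^+ 2) by rewrite e opprK.
by field; rewrite gt_eqF.
Qed.

(** Products between orbit points active at [xi] are at least [- M], so normalising divides by at
    most the square root of [M] times the total weight. *)
Lemma nu_le (M : R) xi s : 0 < M ->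
  (forall g h xi, Gamma g -> Gamma h -> 0 < wt g xi -> 0 < wt h xi ->
    - bform (rho g *m x0) (rho h *m x0) <= M) ->
  (forall g, g \in s -> Gamma g /\ 0 < wt g xi) ->
  phi xi = \sum_(g <- s) wt g xi *: (rho g *m x0) ->
  nu xi <= Num.sqrt M * \sum_(g <- s) wt g xi.
Proof.
move=> M0 MP sP phiE.
have A0 : 0 <= \sum_(g <- s) wt g xi by apply: sumr_ge0 => g _; exact: wt_ge0.
rewrite -(@ler_pXn2r _ 2) ?nnegrE ?(ltW (nu_gt0 xi)) ?mulr_ge0 ?sqrtr_ge0 //.
rewrite sqr_nu exprMn sqr_sqrtr ?(ltW M0) // phiE bform_wsum expr2.
rewrite -sumrN; under eq_bigr do rewrite -sumrN.
have le_M g h : g \in s -> h \in s -> - bform (rho g *m x0) (rho h *m x0) <= M.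
  by move=> /sP[Gg wg] /sP[Gh wh]; exact: MP wg wh.
apply: le_trans (wsum_le xi xi le_M).
by apply: ler_sum => g _; apply: ler_sum => h _; rewrite !mulrN.
Qed.

Lemma Phi_coarse : exists C, forall xi xi', coshd (Phi xi) (Phi xi') <= 4 -> coshd xi xi' <= C.
Proof.
have [M M0 MP] := orbit_near.
(* If all pairs of active orbit points had minus their product above [4 * M + 1], the averages would
   violate the bound [le1]; so one pair is below this threshold. *)
have [N N0 NP] := hyp_near (4 * M + 1).
have T1 := cocompact_ge1.
exists (2 * T * (2 * N * T)) => xi xi' le4.
have [s [sP s0 phiE]] := phi_repr xi; have [s' [s'P s'0 phi'E]] := phi_repr xi'.
have nule := nu_le M0 MP sP phiE; have nu'le := nu_le M0 MP s'P phi'E.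
set A := \sum_(g <- s) _ in s0 nule; set A' := \sum_(g <- s') _ in s'0 nu'le.
have n0 := nu_gt0 xi; have n'0 := nu_gt0 xi'.
(* Cauchy-Schwarz in the time plane: the time part of a vector of square -1 has length [htime] of
   its space part. *)
have yy' : - bform ((nu xi)^-1 *: phi xi) ((nu xi')^-1 *: phi xi') <= 4.
  apply: le_trans le4; rewrite bformE opprD opprK lerD2r.
  apply: cauchy_schwarz_le; rewrite ?(ltW (htime_gt0 _)) //.
    by rewrite (AdS_usubmx (normalized_phi xi)).
  by rewrite (AdS_usubmx (normalized_phi xi')).
have le1 : - bform (phi xi) (phi xi') <= 4 * M * (A * A').
  have : - bform (phi xi) (phi xi') <= 4 * (nu xi * nu xi').
    have -> : - bform (phi xi) (phi xi') =
        nu xi * nu xi' * - bform ((nu xi)^-1 *: phi xi) ((nu xi')^-1 *: phi xi').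
      by rewrite bformZl bformZr; field; rewrite !gt_eqF.
    by rewrite (mulrC 4) ler_pM2l // mulr_gt0.
  move=> h; apply: le_trans h _; rewrite -mulrA ler_pM2l //.
  have -> : M * (A * A') = (Num.sqrt M * A) * (Num.sqrt M * A').
    by rewrite -{1}(sqr_sqrtr (ltW M0)); ring.
  by apply: ler_pM => //; exact: ltW.
have [g [h [gs hs' gh]]] : exists g h, [/\ g \in s, h \in s' &
    - bform (rho g *m x0) (rho h *m x0) <= 4 * M + 1].
  apply: contrapT => none.
  have lt g h : g \in s -> h \in s' -> bform (rho g *m x0) (rho h *m x0) <= - (4 * M + 1).
    move=> gs hs'; rewrite lerNr leNgt; apply/negP => h'.
    apply: none; exists g, h; split=> //; exact: ltW.
  have := wsum_le xi xi' lt; rewrite -bform_wsum -phiE -phi'E -/A -/A'.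
  have : 0 < A * A' by rewrite mulr_gt0.
  lra.
have [Gg /wt_gt0 wg] := sP _ gs; have [Gh /wt_gt0 wh] := s'P _ hs'.
have := NP _ _ Gg Gh gh; move: wg wh.
have [y ->] := lattice_hyp_point Gg; have [z ->] := lattice_hyp_point Gh.
rewrite !bform_hyp_point !opprK => wg wh yz.
apply: le_trans (coshd_triangle _ y _) _; apply: ler_pM.
- by rewrite mulr_ge0 // ltW // coshd_gt0.
- exact: ltW (coshd_gt0 _ _).
- by rewrite ler_pM2l // ltW.
apply: le_trans (coshd_triangle _ z _) _; rewrite coshdC in wh; apply: ler_pM.
- by rewrite mulr_ge0 // ltW // coshd_gt0.
- exact: ltW (coshd_gt0 _ _).
- by rewrite ler_pM2l.
- by rewrite ltW.
Qed.

(* A null vector l in the cone over Lambda, such that the whole orbit stays out of a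
   horoball centred at l, would be missed by Phi near the endpoint l. *)
Lemma no_horoball l : CL l -> exists2 g, Gamma g & bform l x0 < bform l (rho g *m x0).
Proof.
move=> /CLE[t [l' [t0 Ll' ->]]]; apply: contrapT => none.
have {}none g : Gamma g -> bform l' (rho g *m x0) <= bform l' x0.
  move=> Gg; rewrite leNgt; apply/negP => lt; apply: none; exists g => //.
  by rewrite !bformZl ltr_pM2l.
have l'C : CL l' by exact: (L_CL CLE).
set c := - bform l' x0.
have c0 : 0 < c by rewrite oppr_gt0 bformC; exact: x0_faces.
have uu := L_time Ll'.
have dd : dotp (dsubmx l') (dsubmx l') = 1.
  by have := L_null Ll'; rewrite bformE uu => h; lra.
have [M M0 MP] := orbit_near.
have sM0 : 0 < Num.sqrt M by rewrite sqrtr_gt0.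
(* Orbit points have product at most [- c] with [l'], and normalising costs at most the square root
   of [M]: every normalised average has product at most [- d] with [l']. *)
pose d := c / Num.sqrt M.
have d0 : 0 < d by rewrite divr_gt0.
have [C CP] := Phi_coarse.
(* The point that should be missed: a vector of square -1 with this space part has [htime] below
   [d^-1 + d], so its product with [l'] exceeds [- d]. In dimension 0 the target is a single
   point. *)
have [xi Phixi] : exists xi, Phi xi = d^-1 *: dsubmx l'.
  move: continuous_Phi CP; case: (n) (Phi) (dsubmx l') => [|k] F z Fc CP.
    by exists 0; apply/matrixP => -[].
  by apply: coarse_embedding_surjective Fc CP _.
have [s [sP s0 phiE]] := phi_repr xi.
have nule := nu_le M0 MP sP phiE; have n0 := nu_gt0 xi.
set y := (nu xi)^-1 *: phi xi.
have ly : d <= - bform l' y.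
  rewrite /y bformZr -mulrN mulrC ler_pdivlMr // /d -mulrA.
  apply: (@le_trans _ _ (c * \sum_(g <- s) wt g xi)).
    by rewrite ler_pM2l // mulrC ler_pdivrMr // mulrC.
  rewrite phiE bform_sumr -sumrN mulr_sumr big_seq [leRHS]big_seq.
  apply: ler_sum => g gs; have [Gg _] := sP _ gs.
  by rewrite bformZr -mulrN mulrC ler_wpM2l ?wt_ge0 // lerN2 none.
have yd : dsubmx y = d^-1 *: dsubmx l' by exact: Phixi.
have yu := AdS_usubmx (normalized_phi xi); rewrite -/y in yu.
have hy : htime (dsubmx y) < d^-1 + d.
  rewrite -(@ltr_pXn2r _ 2) ?nnegrE ?(ltW (htime_gt0 _)) ?addr_ge0 ?invr_ge0 ?(ltW d0) //.
  rewrite sqr_htime yd dotpZl dotpZr dd sqrrD mulVf ?gt_eqF //.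
  have := exprn_gt0 2 d0; rewrite mulr1 -expr2; lra.
move: ly; rewrite bformE yd dotpZr dd mulr1 opprD opprK.
have : dotp (usubmx l') (usubmx y) <= 1 * htime (dsubmx y).
  by apply: cauchy_schwarz_le; rewrite ?(ltW (htime_gt0 _)) // ?uu ?expr1n ?yu.
lra.
Qed.

End Core.

Lemma horoball l : CL l -> exists2 g, Gamma g & bform l x0 < bform l (rho g *m x0).
Proof. by have [T TP] := lattice_cocompact lattice; exact: no_horoball TP _. Qed.

(** * The Dirichlet domain inside the convex hull *)

Lemma best_translate x : faces_cone CL x -> exists2 g, Gamma g &
  forall h, Gamma h -> bform x (rho h *m x0) <= bform x (rho g *m x0).
Proof.
move=> xf; pose m := - bform x (rho 1%:M *m x0).
have [g [Gg gm] gmax] := finite_set_max (fun g => bform x (rho g *m x0))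
  (rho_finite m xf) (conj lattice1 (lexx m)).
exists g => // h Gh; have [hm|hm] := leP (- bform x (rho h *m x0)) m; first exact: gmax.
by move: gm; rewrite /m in hm *; lra.
Qed.

(* The unit vectors whose rays form the closed Dirichlet domain in Conv Lambda. *)
Let Z : set V := [set v | [/\ HC v, `|v| = 1 &
  forall g, Gamma g -> bform v (rho g *m x0) <= bform v x0]].

Lemma Z_compact : compact Z.
Proof.
have [K [Kc Kh hK]] := hull_ball_compact L_compact CLE 1 x0_faces.
pose B g := [set v : V | 0 <= bform v (x0 - rho g *m x0)].
have -> : Z = K `&` ([set v | `|v| = 1] `&` \bigcap_(g in Gamma) B g).
  apply/seteqP; split=> [v [hv v1 vg]|v [Kv [v1 vg]]].
    split; first by apply: hK => //; rewrite v1.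
    by split=> // g Gg; rewrite /B /= bformDr bformNr subr_ge0 vg.
  split=> //; first exact: Kh.
  by move=> g /vg; rewrite /B /= bformDr bformNr subr_ge0.
apply: compact_closedI => //; apply: closedI.
  have -> : [set v : V | `|v| = 1] = (fun v : V => `|v|) @^-1` [set 1] by [].
  by apply: preimage_closed => // v _; exact: norm_continuous.
apply: closed_bigI => g Gg.
apply: (@preimage_closed _ _ (fun v => bform v (x0 - rho g *m x0)) [set z | 0 <= z]); last exact: closed_ge.
move=> v _; move: v; apply: continuous_bform; last exact: continuous_cst.
by move=> ?; exact: cvg_id.
Qed.

(** A null vector of [Z] would lie over [Lambda], and the inequalities defining [Z] would keep the
    orbit out of a horoball centred there. *)
Lemma Z_neg v : Z v -> bform v v < 0.
Proof.
move=> [hv v1 vg]; rewrite lt_neqAle (hull_le0 CLE L_null L_neg) // andbT.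
apply/eqP => /(hull_null CLE L_null L_neg hv)[v0|/horoball[g Gg]].
  by move: v1; rewrite v0 normr0 => /esym/eqP; rewrite oner_eq0.
by rewrite ltNge vg.
Qed.

Lemma Z_neq0 v : Z v -> v != 0.
Proof. by move=> [_ v1 _]; rewrite -normr_gt0 v1. Qed.

Lemma hull_E x : bform x x = -1 -> HC x -> E Lambda x.
Proof.
move=> xx hx; split=> // l; apply: (hull_faces_cone CLE L_null L_neg) => //.
by rewrite xx; lra.
Qed.

Local Notation D := (Dirichlet Gamma rho Lambda x0).

Lemma closure_Dirichlet_le x g : closure D x -> Gamma g -> bform x (rho g *m x0) <= bform x x0.
Proof.
move=> xD Gg; have [->|g1] := eqVneq g 1%:M; first by rewrite rho1 mul1mx.
pose C := [set v : V | 0 <= bform v (x0 - rho g *m x0)].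
have Ccl : closed C.
  apply: (@preimage_closed _ _ (fun v => bform v (x0 - rho g *m x0)) [set z | 0 <= z]); last exact: closed_ge.
  move=> v _; move: v; apply: continuous_bform; last exact: continuous_cst.
  by move=> ?; exact: cvg_id.
have : closure C x.
  apply: closureS xD => v Dv; have [_] := Dv g (conj Gg (elimN eqP g1)).
  by rewrite /C /= bformDr bformNr subr_ge0 => /ltW.
by move/closure_id : Ccl => <-; rewrite /C /= bformDr bformNr subr_ge0.
Qed.

Lemma weak_Dirichlet_closure x : HC x -> bform x x = -1 ->
  (forall g, Gamma g -> bform x (rho g *m x0) <= bform x x0) -> closure D x.
Proof.
move=> hx xx xg.
have x_neq0 : x != 0.
  by apply: contraPneq xx => ->; rewrite bform0l => /eqP; rewrite eq_sym oppr_eq0 oner_eq0.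
have b0 : bform x x0 < 0.
  by rewrite bformC; apply: faces_cone_hull_lt0 x0_faces hx x_neq0.
(* Minus the square of [x + |e| *: x0]. The absolute value keeps it at least 1 for every [e], so
   that [y] is continuous on the whole line. *)
pose k (e : R) := 1 - 2 * `|e| * bform x x0 + e ^+ 2.
have k_ge1 e : 1 <= k e.
  rewrite /k -addrA lerDl addr_ge0 ?sqr_ge0 // oppr_ge0.
  by rewrite nmulr_lle0 // mulr_ge0.
pose y (e : R) : V := (Num.sqrt (k e))^-1 *: (x + `|e| *: x0).
have sk0 e : 0 < Num.sqrt (k e) by rewrite sqrtr_gt0 (lt_le_trans ltr01).
have yc : continuous y.
  have absc : continuous (fun e : R => `|e|) by exact: norm_continuous.
  apply: continuous_scale.
    apply: continuous_inv => [e|]; first by rewrite gt_eqF.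
    move=> e; apply: (@continuous_comp _ _ _ k Num.sqrt); last exact: sqrt_continuous.
    move: e; apply: continuous_add.
      apply: continuous_sub; first exact: continuous_cst.
      apply: continuous_mul; last exact: continuous_cst.
      by apply: continuous_mul; first exact: continuous_cst.
    have -> : (fun e : R => e ^+ 2) = (fun e : R => e * e) by apply/funext => e; rewrite expr2.
    by apply: continuous_mul => ?; exact: cvg_id.
  apply: continuous_add; first exact: continuous_cst.
  by apply: continuous_scale; [exact: absc|exact: continuous_cst].
have y0 : y 0 = x.
  by rewrite /y /k normr0 mulr0 mul0r subr0 expr0n addr0 sqrtr1 invr1 !scale1r scale0r addr0.
have yD e : 0 < e -> D (y e).
  move=> e0 g [Gg g1].
  have hsum : HC (x + `|e| *: x0) by apply: hullD => //; exact: (hullZ CLE).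
  have yy : bform (y e) (y e) = -1.
    rewrite /y bformZl bformZr.
    have -> : bform (x + `|e| *: x0) (x + `|e| *: x0) = - (Num.sqrt (k e) ^+ 2).
      rewrite sqr_sqrtr ?(le_trans ler01) // /k !bform_linE xx x0_AdS (bformC x0 x).
      by rewrite (gtr0_norm e0); ring.
    by field; rewrite gt_eqF.
  split.
    by apply: hull_E => //; apply: (hullZ CLE) => //; rewrite invr_ge0 ltW.
  (* Strictness comes from the [x0] term: its product with itself is -1, and with the other orbit
     points below -1. *)
  rewrite /y !bformZl ltr_pM2l ?invr_gt0 // !bformDl !bformZl x0_AdS.
  have := xg _ Gg; have := orbit_lt Gg (introN eqP g1).
  move: (bform x0 _) (bform x _) => p q p1 qx.
  have : 0 < `|e| * (-1 - p) by rewrite mulr_gt0 ?normr_gt0 ?gt_eqF //; lra.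
  lra.
move=> U Ux.
have : \forall e \near 0^'+, U (y e).
  have : y e @[e --> 0^'+] --> y 0 by apply: cvg_at_right_filter; exact: yc.
  by apply; rewrite y0.
move=> /(filterI (nbhs_right_gt _)) /filter_ex[e [e0 Uy]].
by exists (y e); split=> //; exact: yD.
Qed.

(** The Dirichlet inequalities are homogeneous, so they can be read on unit vectors; [Z_neg] allows
    the return to vectors of square -1. *)
Lemma Dirichlet_convE : Dirichlet_conv Gamma rho Lambda x0 = rays Z.
Proof.
apply/seteqP; split=> [s [[w [wD [ww wf]] sw] Cs]|s [z Zz sz]].
  have w0 := vectors_on_neq0 sw.
  have nw : 0 < `|w|^-1 by rewrite invr_gt0 normr_gt0.
  have sv := vectors_onZ sw nw.
  have [_ hv] : `|w|^-1 *: w != 0 /\ HC (`|w|^-1 *: w).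
    by apply/(cone_Conv Lambda_Ein); exists s.
  exists (`|w|^-1 *: w) => //; split=> // [|g Gg].
    by rewrite normrZ gtr0_norm // mulVf // normr_eq0.
  by rewrite !bformZl ler_pM2l //; exact: closure_Dirichlet_le.
have q0 := Z_neg Zz; have [hz z1 zg] := Zz.
pose r := (Num.sqrt (- bform z z))^-1.
have r0 : 0 < r by rewrite invr_gt0 sqrtr_gt0 oppr_gt0.
have hx : HC (r *: z) by apply: (hullZ CLE) => //; exact: ltW.
have xx : bform (r *: z) (r *: z) = -1.
  rewrite bformZl bformZr mulrA -expr2 exprVn sqr_sqrtr ?oppr_ge0 ?ltW //.
  by field; rewrite lt_eqF.
split; last first.
  by apply/(coneP (Conv Lambda) sz)/(cone_Conv Lambda_Ein); split=> //; exact: Z_neq0.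
exists (r *: z); last exact: vectors_onZ.
split; last exact: hull_E.
apply: weak_Dirichlet_closure => // g Gg.
by rewrite !bformZl ler_pM2l // zg.
Qed.

Theorem Dirichlet_fundamental_domain :
  [/\ compact (Dirichlet_conv Gamma rho Lambda x0),
      Conv Lambda `\` Lambda `<=`
        \bigcup_(g in Gamma) ray_image (rho g) (Dirichlet_conv Gamma rho Lambda x0)
    & trivIset Gamma (fun g => ray_image (rho g) (rays D `&` Conv Lambda))].
Proof.
rewrite Dirichlet_convE; split.
- by apply: compact_rays; [exact: Z_compact|exact: Z_neq0].
- move=> s [Cs Ls]; have [v sv] := ray_vector s.
  have [v0 hv] : v != 0 /\ HC v by apply/(cone_Conv Lambda_Ein); exists s.
  have vv : bform v v < 0.
    rewrite lt_neqAle (hull_le0 CLE L_null L_neg) // andbT; apply/eqP.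
    move=> /(hull_null CLE L_null L_neg hv)[e|/(coneP Lambda sv)//].
    by rewrite e eqxx in v0.
  have [g Gg gmax] := best_translate (hull_faces_cone CLE L_null L_neg hv vv).
  exists g => //; apply/(coneP _ sv)/cone_ray_image; first exact: rho_unit.
  rewrite -rhoV //; set w := rho (invmx g) *m v.
  have hw : HC w by apply: rho_hull => //; exact: latticeV.
  have w0 : w != 0.
    apply: contra v0 => /eqP e; rewrite -(mulKVmx (rho_unit Gg) v) -rhoV // -/w e.
    by rewrite mulmx0.
  apply/cone_rays; split=> //; exists `|w|^-1.
  have nw : 0 < `|w|^-1 by rewrite invr_gt0 normr_gt0.
  split=> //; split=> [||h Gh].
  + by apply: (hullZ CLE) => //; exact: ltW.
  + by rewrite normrZ gtr0_norm // mulVf // normr_eq0.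
  rewrite !bformZl ler_pM2l // ![bform w _]bformC !bform_rhoV //.
  by rewrite mulmxA -rhoM // bformC [leRHS]bformC gmax //; exact: latticeM.
- move=> g h Gg Gh [s [sg sh]]; apply: contrapT => gh.
  have [v sv] := ray_vector s.
  (* On the translate by [k], the orbit point [rho k *m x0] has the strictly largest product with
     [v]; two distinct translates thus exclude each other. *)
  have half k k' : Gamma k -> Gamma k' -> k <> k' ->
      ray_image (rho k) (rays D `&` Conv Lambda) s ->
      bform v (rho k' *m x0) < bform v (rho k *m x0).
    move=> Gk Gk' kk' /(coneP _ sv)/(cone_ray_image _ _ (rho_unit Gk))[s' [Ds' _] s'v].
    have /cone_rays[_ [t [t0 Dt]]] : cone (rays D) (invmx (rho k) *m v) by exists s'.
    have GV := latticeV Gk.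
    have [|_] := Dt (invmx k *m k').
      split; first exact: latticeM.
      move=> /(congr1 (mulmx k)); rewrite mulKVmx ?lattice_unit // mulmx1 => e.
      exact: kk'.
    rewrite !bformZl ltr_pM2l // !bform_invmx; try exact: rho_isometry.
    by rewrite mulmxA -rhoM ?mulKVmx ?lattice_unit //; exact: latticeM.
  have := half g h Gg Gh gh sg.
  have := half h g Gh Gg (fun e => gh (esym e)) sh; lra.
Qed.

End LatticeAction.

Theorem proposition4p15 (R : realType) (n : nat) (hn : (2 <= n)%N)
  (Gamma : set 'M[R]_(1 + n))
  (hlattice : cocompact_lattice 1 n Gamma)
  (htf : torsion_free Gamma)
  (rho : 'M[R]_(1 + n) -> 'M[R]_(2 + n))
  (hrho : faithful_discrete_rep Gamma rho)
  (Lambda : set (ray_sphere R (2 + n)))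
  (hLambda : acausal_sphere Lambda)
  (hinv : forall g, Gamma g -> ray_image (rho g) Lambda = Lambda)
  (hint : interior (Conv Lambda) !=set0)
  (x0 : 'cV[R]_(2 + n))
  (hx0 : (AdS R n `&` cone (Conv Lambda `\` Lambda)) x0) :
  [/\ compact (Dirichlet_conv Gamma rho Lambda x0),
      Conv Lambda `\` Lambda `<=`
        \bigcup_(g in Gamma)
          ray_image (rho g) (Dirichlet_conv Gamma rho Lambda x0)
    & trivIset Gamma (fun g =>
        ray_image (rho g)
          (rays (Dirichlet Gamma rho Lambda x0) `&` Conv Lambda))].
Proof.
case: hLambda => Lambda_Ein [f [f_acausal LambdaE]].
case: hx0 => x0_AdS [s [Cs _] sx0].
have [_ x0_hull] : x0 != 0 /\ hull (cone Lambda) x0.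
  by apply/(cone_Conv Lambda_Ein); exists s.
apply: (@Dirichlet_fundamental_domain R n Gamma rho Lambda (Ein_graph f)) => //.
- exact: Ein_graph_compact.
- by move=> v; rewrite LambdaE; exact: cone_Ein_graph.
- by move=> _ [y Sy <-]; exact: Ein_param_null.
- move=> _ _ [y Sy <-] [y' Sy' <-] neq; apply: Ein_graph_neg => // e.
  by apply: neq; rewrite e.
- by move=> _ [y _ <-]; rewrite /Ein_param col_mxKu dotp_circle subrr cos0.
Qed.
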